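(* Let $\nu>0$ be a constant, $\eta>0$, and let $A,B_1,B_2,M_{Q_h}$ be the matrices of the discrete mass-conserving mixed stress (MCS) Stokes system defined in the context. Let $$\mathcal A_\eta=\begin{bmatrix}A&B_2^T&0\\ B_2&-\eta\nu B_1^TM_{Q_h}^{-1}B_1&B_1^T\\ 0&B_1&0\end{bmatrix},\qquad \mathcal L_{\eta,D}=\begin{bmatrix}A^{-1}&0&0\\0&S_{U_h,\eta}^{-1}&0\\0&0&S_{Q_h,\eta}^{-1}\end{bmatrix},$$ where $S_{U_h,\eta}=B_2A^{-1}B_2^T+\eta\nu B_1^TM_{Q_h}^{-1}B_1$ and $S_{Q_h,\eta}=B_1S_{U_h,\eta}^{-1}B_1^T$. Then the spectrum of the preconditioned operator satisfies $$\sigma(\mathcal L_{\eta,D}\mathcal A_\eta)\subset[-\psi,-\psi^{-1}]\cup[\psi^{-1},\psi],\qquad \psi=2(1+\sqrt5).$$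
   Context: Domain and mesh. $\Omega\subset\mathbb R^d$ ($d=2,3$) is a bounded polyhedral domain, $\mathcal T_h$ a quasi-uniform simplicial mesh of $\Omega$ with mesh size $h$, and $\mathcal F_h=\mathcal F_h^{\mathrm{int}}\cup\mathcal F_h^{\mathrm{bd}}$ its interior and boundary facets. Each interior facet $F$ carries a fixed unit normal $n=n_F$ pointing from the neighbouring element $T^+$ to the other neighbour $T^-$; on boundary facets $n$ is the outward unit normal. Jumps: $\llbracket z\rrbracket=z|_{T^+}-z|_{T^-}$ on interior facets, $\llbracket z\rrbracket=z|_T$ on boundary facets. For a vector $v$ and matrix $\tau$: $v_n=v\cdot n$, $v_t=v-v_nn$, $\tau_{nn}=n^T\tau n$, $\tau_{nt}=\tau n-\tau_{nn}n$. $\mathbb M=\mathbb R^{d\times d}$, $\mathbb K=\{\gamma\in\mathbb M:\gamma^T=-\gamma\}$, $\operatorname{dev}\varsigma=\varsigma-\frac1d(\operatorname{tr}\varsigma)I$. $\mathbb P^k(\mathcal T_h,X)$ denotes $X$-valued piecewise polynomials of degree $\le k$ (no interelement continuity). Spaces ($k\ge1$ integer). $V_h=H_0(\operatorname{div};\Omega)\cap\mathcal{RT}^k(\mathcal T_h)$, with local Raviart–Thomas space $\mathbb P^k(T,\mathbb R^d)+x\,\mathbb P^k(T)$; $Q_h=L^2_0(\Omega)\cap\mathbb P^k(\mathcal T_h)$ (zero mean); $W_h=\mathbb P^k(\mathcal T_h,\mathbb K)$; $U_h=V_h\times W_h$. Stress: $\Sigma_h=\{\tau\in\mathbb P^k(\mathcal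 T_h,\mathbb M):\operatorname{tr}\tau=0,\ \llbracket\tau_{nt}\rrbracket=0\ \forall F\in\mathcal F_h^{\mathrm{int}}\}$ and $\Sigma_h^+=\Sigma_h\oplus\delta\Sigma_h$, where $\delta\Sigma_h=\{\operatorname{dev}(\operatorname{curl}(\operatorname{curl}(r_h)B)):r_h\in\mathbb P^k_\perp(\mathcal T_h,\mathbb K)\}$, all operations elementwise; $\mathbb P_\perp^k(\mathcal T_h,\mathbb K)=\prod_T\mathbb P^k_\perp(T,\mathbb K)$ with $\mathbb P^k_\perp(T,\mathbb K)$ the $L^2(T)$-orthogonal complement of $\mathbb P^{k-1}(T,\mathbb K)$ in $\mathbb P^k(T,\mathbb K)$; with barycentric coordinates $\lambda_i$ of $T$, $B=\sum_{i=0}^3\lambda_{i-3}\lambda_{i-2}\lambda_{i-1}\nabla\lambda_i\otimes\nabla\lambda_i$ (indices mod 4) if $d=3$, $B=\lambda_0\lambda_1\lambda_2$ if $d=2$; $\operatorname{curl}$ acts row-wise (for $d=2$ the inner curl maps the matrix to a vector, and the outer curl maps a vector field to the matrix whose rows are the rotated gradients of its components). Forms. $a(\varsigma,\tau)=\int_\Omega\nu^{-1}\operatorname{dev}\varsigma:\operatorname{dev}\tau\,dx$ on $\Sigma_h^+$; $b_1((v,\gamma),q)=\int_\Omega q\operatorname{div}v\,dx$ for $(v,\gamma)\in U_h$, $q\in Q_h$; $b_2(\tau,(v,\gamma))=-\sum_{T}\int_T\tau:(\nabla v-\gamma)\,dx+\sum_{F\in\mathcal F_h}\int_F\tau_{nt}\cdot\llbracket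 v_t\rrbracket\,ds$ for $\tau\in\Sigma_h^+$, $(v,\gamma)\in U_h$. Matrices. Finite element functions are identified with coefficient vectors in fixed bases; $(\cdot,\cdot)$ is the Euclidean inner product, $^T$ the Euclidean transpose. $(A\varsigma,\tau)=a(\varsigma,\tau)$, $(B_1(v,\gamma),q)=b_1((v,\gamma),q)$, $(B_2\tau,(v,\gamma))=b_2(\tau,(v,\gamma))$, $(M_{Q_h}q,r)=(q,r)_{L^2(\Omega)}$. $\sigma(\cdot)$ denotes the spectrum. *)

(* Defs.v *)
From HB Require Import structures.
From mathcomp Require Import all_boot all_order all_algebra.
From mathcomp Require Import all_classical all_reals all_analysis.
From mathcomp Require Import complex.
From mathcomp Require Import -(notations) mpoly.

Set Implicit Arguments.
Unset Strict Implicit.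
Unset Printing Implicit Defensive.

Import Order.TTheory GRing.Theory Num.Theory.
Import numFieldNormedType.Exports.
Local Open Scope classical_set_scope.
Local Open Scope ring_scope.

Section Geometry.
Variables (R : realType) (d : nat).
Implicit Types (x y n : 'cV[R]_d) (t : 'M[R]_d).

Definition dot x y : R := (x^T *m y) 0 0.
Definition enorm x : R := Num.sqrt (dot x x).

Definition tang n x : 'cV[R]_d := x - dot x n *: n.

Definition nt n t : 'cV[R]_d := t *m n - dot n (t *m n) *: n.

Definition hull (I : finType) (p : I -> 'cV[R]_d) (S : {set I}) :
    set 'cV[R]_d :=
  [set x | exists c : I -> R,
     [/\ forall i, 0 <= c i, forall i, i \notin S -> c i = 0,
         \sum_i c i = 1 & x = \sum_i c i *: p i]].

(* Row [i] is (1, p_i); invertible iff the points are affinely independent,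
   and then the barycentric coordinates of [x] are (1, x) times the inverse. *)
Definition vertex_mx (p : 'I_d.+1 -> 'cV[R]_d) : 'M[R]_d.+1 :=
  \matrix_(i < d.+1) row_mx 1%:M (p i)^T.

Definition nondegenerate (p : 'I_d.+1 -> 'cV[R]_d) : bool :=
  vertex_mx p \in unitmx.

Definition polyhedral_domain (Omega : set 'cV[R]_d) : Prop :=
  [/\ open Omega, connected Omega, Omega !=set0,
      exists r : R, forall x, Omega x -> enorm x <= r &
      exists (m : nat) (s : 'I_m -> 'I_d.+1 -> 'cV[R]_d),
        (forall j, nondegenerate (s j)) /\
        Omega = interior (\bigcup_(j in [set: 'I_m]) hull (s j) [set: _]%SET)].

End Geometry.

Section Integration.
Variable R : realType.

(* Lebesgue integral, as an iterated integral, over the simplex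
   { y : y_i >= 0, sum_i y_i <= s } of R^n. *)
Fixpoint std_int (n : nat) (s : R) : ('cV[R]_n -> R) -> R :=
  match n with
  | 0 => fun f => f 0
  | n'.+1 => fun f =>
      \int[@lebesgue_measure R]_(t in `[0, s])
        std_int (s - t) (fun y : 'cV[R]_n' => f (col_mx (t%:M : 'cV[R]_1) y))
  end.

(* Integral with respect to the n-dimensional (surface) measure over the
   n-simplex of R^d with vertices pts_0, ..., pts_n: pull-back to the standard
   simplex with the Gram factor, which is |det J| when n = d. *)
Definition simplex_int (d n : nat) (pts : seq 'cV[R]_d)
    (f : 'cV[R]_d -> R) : R :=
  let J : 'M[R]_(d, n) := \matrix_(i, j) (pts`_j.+1 - pts`_0) i 0 in
  Num.sqrt (\det (J^T *m J)) *
  std_int 1 (fun y : 'cV[R]_n => f (pts`_0 + J *m y)).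

End Integration.

Section Polynomials.
Variables (R : realType) (d : nat).

Definition Poly := mpoly.mpoly d R.

Definition ev (x : 'cV[R]_d) (p : Poly) : R := meval (fun i => x i 0) p.

Definition Pk (k : nat) (p : Poly) : Prop := (mpoly.msize p <= k.+1)%N.

Definition pd (i : 'I_d) (p : Poly) : Poly := mderiv i p.

Definition div_poly (v : 'cV[Poly]_d) : Poly := \sum_i pd i (v i 0).
Definition grad_vec (v : 'cV[Poly]_d) : 'M[Poly]_d :=
  \matrix_(i, j) pd j (v i 0).

Definition frob (s t : 'M[Poly]_d) : Poly := \sum_i \sum_j s i j * t i j.

Definition dev (t : 'M[Poly]_d) : 'M[Poly]_d :=
  t - (d%:R^-1 *: \tr t : Poly)%:M.

Definition PkM (k : nat) (t : 'M[Poly]_d) : Prop := forall i j, Pk k (t i j).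

Definition PkK (k : nat) (t : 'M[Poly]_d) : Prop := PkM k t /\ t^T = - t.

(* P^k(T, R^d) + x P^k(T) *)
Definition RTk (k : nat) (v : 'cV[Poly]_d) : Prop :=
  exists (a : 'cV[Poly]_d) (p : Poly),
    [/\ forall i, Pk k (a i 0), Pk k p &
        forall i, v i 0 = a i 0 + mpolyX R (mnm1 i) * p].

Definition gradbary (p : 'I_d.+1 -> 'cV[R]_d) (i : 'I_d.+1) : 'cV[R]_d :=
  \col_(j < d) invmx (vertex_mx p) (lift ord0 j) i.

Definition bary (p : 'I_d.+1 -> 'cV[R]_d) (i : 'I_d.+1) : Poly :=
  mpolyC d (invmx (vertex_mx p) ord0 i) +
  \sum_(j < d) gradbary p i j 0 *: mpolyX R (mnm1 j).

End Polynomials.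

Section Bubbles.
Variable R : realType.

(* Arithmetic on 'I_3 and 'I_4 below is modular. *)
Definition curl3 (t : 'M[Poly R 3]_3) : 'M[Poly R 3]_3 :=
  \matrix_(i, j) (pd (j + 1) (t i (j + 2)) - pd (j + 2) (t i (j + 1))).

Definition curl2_mx (t : 'M[Poly R 2]_2) : 'cV[Poly R 2]_2 :=
  \col_i (pd 0 (t i 1) - pd 1 (t i 0)).

Definition curl2_vec (w : 'cV[Poly R 2]_2) : 'M[Poly R 2]_2 :=
  \matrix_(i, j) (if j == 0 then pd 1 (w i 0) else - pd 0 (w i 0)).

Definition bubble3 (p : 'I_4 -> 'cV[R]_3) : 'M[Poly R 3]_3 :=
  \sum_(i < 4)
    (bary p (i - 3) * bary p (i - 2) * bary p (i - 1)) *: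
    map_mx (@mpolyC 3 R) (gradbary p i *m (gradbary p i)^T).

Definition bubble2 (p : 'I_3 -> 'cV[R]_2) : Poly R 2 :=
  bary p 0 * bary p 1 * bary p 2.

(* Only meaningful for d = 2, 3. *)
Definition dev_curl_curl (d : nat) :
    ('I_d.+1 -> 'cV[R]_d) -> 'M[Poly R d]_d -> 'M[Poly R d]_d :=
  match d with
  | 2 => fun p r => dev (curl2_vec (bubble2 p *: curl2_mx r))
  | 3 => fun p r => dev (curl3 (curl3 r *m bubble3 p))
  | _ => fun _ _ => 0
  end.

End Bubbles.

(* Element [T] is the simplex with vertices [vtx (elt T i)].  A facet is
   identified with its set of vertices; [ori F] is the pair (T^+, i) such that
   F is the facet of T^+ opposite to its i-th vertex.  The fixed unit normal on
   F is the outward one of T^+. *)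
Record mesh (R : realType) (d : nat) := Mesh {
  nv : nat;
  ne : nat;
  vtx : 'I_nv -> 'cV[R]_d;
  elt : 'I_ne -> 'I_d.+1 -> 'I_nv;
  ori : {set 'I_nv} -> 'I_ne * 'I_d.+1 }.

Section MeshDefs.
Variables (R : realType) (d : nat) (M : mesh R d).
Implicit Types (T : 'I_(ne M)) (F : {set 'I_(nv M)}).

Definition vert T (i : 'I_d.+1) : 'cV[R]_d := vtx (elt T i).
Definition vset T : {set 'I_(nv M)} := [set elt T i | i : 'I_d.+1]%SET.
Definition fverts (p : 'I_(ne M) * 'I_d.+1) : {set 'I_(nv M)} :=
  [set elt p.1 i | i : 'I_d.+1 & i != p.2]%SET.
Definition facets : {set {set 'I_(nv M)}} :=
  [set fverts p | p : 'I_(ne M) * 'I_d.+1]%SET.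

Definition simplex T : set 'cV[R]_d := hull (@vtx _ _ M) (vset T).

Definition is_mesh (Omega : set 'cV[R]_d) : Prop :=
  [/\ injective (@vtx _ _ M) /\ injective vset,
      forall T, nondegenerate (vert T),
      forall T T', simplex T `&` simplex T' =
                   hull (@vtx _ _ M) (vset T :&: vset T')%SET,
      closure Omega = \bigcup_(T in [set: 'I_(ne M)]) simplex T &
      forall F, F \in facets -> fverts (ori F) = F].

Definition diam T : R :=
  \big[Num.max/0]_(i < d.+1) \big[Num.max/0]_(j < d.+1)
    enorm (vert T i - vert T j).
Definition mesh_size : R := \big[Num.max/0]_(T < ne M) diam T.

(* A ball of radius c h in every element bounds both the shape and the relative
   size of the elements. *)
Definition quasi_uniform (c : R) : Prop :=
  forall T, exists x, forall y, enorm (y - x) <= c * mesh_size -> simplex T y.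

Definition neighbours F : {set 'I_(ne M)} := [set T | F \subset vset T]%SET.
Definition int_facets : {set {set 'I_(nv M)}} :=
  [set F in facets | #|neighbours F| == 2]%SET.

Definition plus F : 'I_(ne M) := (ori F).1.
(* T^- on an interior facet, [None] on a boundary facet *)
Definition minus F : option 'I_(ne M) :=
  [pick T in neighbours F | T != plus F].

Definition normal F : 'cV[R]_d :=
  let g := gradbary (vert (plus F)) (ori F).2 in - (enorm g)^-1 *: g.

Definition facet (F : {set 'I_(nv M)}) : set 'cV[R]_d := hull (@vtx _ _ M) F.

Definition jump (V : zmodType) F (z : 'I_(ne M) -> V) : V :=
  z (plus F) - (if minus F is Some T then z T else 0).

Definition elt_int T (f : 'cV[R]_d -> R) : R :=
  simplex_int d [seq vert T i | i : 'I_d.+1] f.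
Definition facet_int F (f : 'cV[R]_d -> R) : R :=
  simplex_int d.-1 [seq vert (plus F) (lift (ori F).2 i) | i : 'I_d] f.

End MeshDefs.

Section Spaces.
Variables (R : realType) (d : nat) (M : mesh R d) (k : nat).

(* Formal polynomials on each element; they are determined by their values
   there because nondegenerate simplices have nonempty interior. *)
Definition mx_field := {ffun 'I_(ne M) -> 'M[Poly R d]_d}.
Definition vec_field := {ffun 'I_(ne M) -> 'cV[Poly R d]_d}.
Definition sc_field := {ffun 'I_(ne M) -> (Poly R d)^o}.

Definition omega_int (q : 'I_(ne M) -> Poly R d) : R :=
  \sum_T elt_int T (fun x => ev x (q T)).

Definition jump_nt (F : {set 'I_(nv M)}) (x : 'cV[R]_d) (t : mx_field) :=
  jump F (fun T => nt (normal F) (map_mx (ev x) (t T))).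
Definition jump_n (F : {set 'I_(nv M)}) (x : 'cV[R]_d) (v : vec_field) :=
  jump F (fun T => dot (map_mx (ev x) (v T)) (normal F)).
Definition jump_t (F : {set 'I_(nv M)}) (x : 'cV[R]_d) (v : vec_field) :=
  jump F (fun T => tang (normal F) (map_mx (ev x) (v T))).

(* For a piecewise polynomial field, membership in H_0(div) means that the
   normal component is continuous across interior facets and vanishes on
   boundary facets, i.e. has zero jump on every facet. *)
Definition V_h (v : vec_field) : Prop :=
  (forall T, RTk k (v T)) /\
  (forall F, F \in facets M -> forall x, facet F x -> jump_n F x v = 0).

Definition Q_h (q : sc_field) : Prop :=
  (forall T, Pk k (q T)) /\ omega_int q = 0.

Definition W_h (g : mx_field) : Prop := forall T, PkK k (g T).

Definition U_h (u : vec_field * mx_field) : Prop := V_h u.1 /\ W_h u.2.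

Definition Sigma_h (t : mx_field) : Prop :=
  [/\ forall T, PkM k (t T), forall T, \tr (t T) = 0 &
      forall F, F \in int_facets M -> forall x, facet F x -> jump_nt F x t = 0].

(* [k.-1] is the degree k - 1 only for k >= 1. *)
Definition PkK_perp (T : 'I_(ne M)) (r : 'M[Poly R d]_d) : Prop :=
  PkK k r /\
  forall s, PkK k.-1 s -> elt_int T (fun x => ev x (frob r s)) = 0.

Definition deltaSigma_h (t : mx_field) : Prop :=
  exists r : 'I_(ne M) -> 'M[Poly R d]_d,
    forall T, PkK_perp T (r T) /\ t T = dev_curl_curl (vert T) (r T).

Definition Sigma_h_plus (t : mx_field) : Prop :=
  exists s e : mx_field, [/\ Sigma_h s, deltaSigma_h e & t = s + e].

Definition form_a (nu : R) (s t : mx_field) : R :=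
  omega_int (fun T => nu^-1 *: frob (dev (s T)) (dev (t T))).

Definition form_b1 (u : vec_field * mx_field) (q : sc_field) : R :=
  omega_int (fun T => (q T : Poly R d) * div_poly (u.1 T)).

(* tau_nt is single valued for tau in Sigma_h^+ on interior facets (it vanishes
   there for the elements of deltaSigma_h); its trace from T^+ is used. *)
Definition form_b2 (t : mx_field) (u : vec_field * mx_field) : R :=
  - omega_int (fun T => frob (t T) (grad_vec (u.1 T) - u.2 T)) +
  \sum_(F in facets M)
    facet_int F (fun x =>
      dot (nt (normal F) (map_mx (ev x) (t (plus F)))) (jump_t F x u.1)).

Definition form_mass (q r : sc_field) : R :=
  omega_int (fun T => (q T : Poly R d) * (r T : Poly R d)).

End Spaces.

(* [e] is a basis over R of the space [P]; real scalars act on polynomial fields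
   as constant polynomials. *)
Definition is_basis (R : realType) (d : nat) (V : lmodType (Poly R d))
    (P : V -> Prop) (m : nat) (e : 'I_m -> V) : Prop :=
  (forall i, P (e i)) /\
  forall w, P w -> exists! c : 'cV[R]_m,
    w = \sum_i mpolyC d (c i 0) *: e i.

Section Blocks.
Variables (R : realType) (s u q : nat).
Variables (A : 'M[R]_s) (B1 : 'M[R]_(q, u)) (B2 : 'M[R]_(u, s)) (MQ : 'M[R]_q).
Variables (nu eta : R).

Definition aug : 'M[R]_u := (eta * nu) *: (B1^T *m invmx MQ *m B1).
Definition S_U : 'M[R]_u := B2 *m invmx A *m B2^T + aug.
Definition S_Q : 'M[R]_q := B1 *m invmx S_U *m B1^T.

Definition A_eta : 'M[R]_(s + (u + q)) :=
  block_mx A (row_mx B2^T 0)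
           (col_mx B2 0) (block_mx (- aug) B1^T B1 0).

Definition L_eta_D : 'M[R]_(s + (u + q)) :=
  block_mx (invmx A) 0 0 (block_mx (invmx S_U) 0 0 (invmx S_Q)).

End Blocks.

Local Open Scope complex_scope.

Definition spectrum (R : realType) (n : nat) (X : 'M[R]_n) : set R[i] :=
  [set z | eigenvalue (map_mx (real_complex R) X) z].

(* Main.v *)
(* Everything reduces to two injectivity statements.

   If q in Q_h is orthogonal to div V_h, the Raviart-Thomas bubble
   sum_i lam_i (x_i . grad q) (x - x_i) shows that q is constant on every element; a
   field supported on two neighbouring elements shows that q does not jump between
   them; hence q is constant, and q = 0 since its mean is zero.

   If b_1 and b_2 annihilate (v, g) in U_h, then div v = 0, so v is in P^k; testing with
   dev curl(curl(g) B) gives curl g = 0, so g is constant on every element; the bubbles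
   lam_i grad(lam_j) (x_j - x_i)^T then give grad v = g, so v is an elementwise rigid
   motion; test fields attached to the facets show that v has no jumps.  As the mesh is
   facet-connected and has a boundary facet, v = 0 and g = 0.

   The divergence theorem on a simplex is read off from the value m! / (|m| + n)! of the
   integral of lam^m.

   Let (sg, u, p) be an eigenvector of diag(A, S_U, S_Q)^-1 A_eta with eigenvalue al, which is
   real by symmetry.  Young's inequality gives |al| <= 2.  If |al| < 1/6, eliminating sg
   yields B_1^T p = X u with 0 <= X <= 2 S_U, so |p|^2 <= 2 (X u, u) = 2 al |p|^2 in the
   S_Q-norm, and p, u and sg vanish.  So 1/6 <= |al| <= 2, which is more than needed. *)

Require Import Defs.
From HB Require Import structures.
From mathcomp Require Import all_boot all_order all_algebra fingroup perm.
From mathcomp Require Import all_classical all_reals all_analysis.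
From mathcomp Require Import complex.
From mathcomp Require Import -(notations) mpoly.
From mathcomp Require Import ring lra.

Set Implicit Arguments.
Unset Strict Implicit.
Unset Printing Implicit Defensive.

Import Order.TTheory GRing.Theory Num.Theory.
Import numFieldNormedType.Exports.
Local Open Scope classical_set_scope.
Local Open Scope ring_scope.
Import Defs.

(** * Integrals of monomials over the standard simplex *)

(** Integrals are iterated Lebesgue integrals, for which additivity, independence of the order of
    the vertices and integration by parts are not immediate. Every integrand that matters is a
    polynomial in barycentric coordinates, and the closed value on monomials turns all three facts
    into identities between coefficients. The injectivity arguments share one pattern: the test
    field is chosen so that the tested expression becomes the integral of a sum of squares with
    nonnegative, nonzero polynomial weights, whence each square vanishes as a polynomial. The
    definition of a mesh gives only a face-to-face covering of the closure of Omega; the passage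
    from element to element through facets has to be derived from the connectedness of the open set
    Omega. The orthogonality in P_perp^k does not restrict the test field dev curl(curl(g) B): the
    projection of g to degree k - 1 contributes a stress that already lies in Sigma_h. Injectivity
    enters the matrix part only through positive definiteness of S_U and S_Q. The eigenvalue bounds
    fit because sqrt 5 >= 2 gives psi >= 6. *)

Section StdInt.
Variable R : realType.
Local Notation mu := (@lebesgue_measure R).

Lemma Rintegral_deriv_poly (p : {poly R}) (s : R) : 0 <= s ->
  \int[mu]_(t in `[0, s]) p^`().[t] = p.[s] - p.[0].
Proof.
rewrite le_eqVlt => /predU1P[<-|s0].
  by rewrite set_itv1 Rintegral_set1 subrr.
rewrite /Rintegral (@continuous_FTC2 _ _ (horner p)) //.
- exact/continuous_subspaceT/continuous_horner.
- split=> [x _| |]; first exact: derivable_horner.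
  + by apply: cvg_at_right_filter; exact: continuous_horner.
  + by apply: cvg_at_left_filter; exact: continuous_horner.
- by move=> x _; rewrite derivE.
Qed.

Lemma eq_int_itv (f g : R -> R) (s : R) :
  (forall t, 0 <= t <= s -> f t = g t) ->
  \int[mu]_(t in `[0, s]) f t = \int[mu]_(t in `[0, s]) g t.
Proof.
by move=> fg; apply: eq_Rintegral => t; rewrite inE /= in_itv => /fg.
Qed.

(** At [i = 0] the factor [0%:R^-1] is 0, so the constant term vanishes and the antiderivative is
    the one that is 0 at 0. *)
Definition antideriv (p : {poly R}) : {poly R} :=
  \poly_(i < (size p).+1) (p`_i.-1 * i%:R^-1).

Lemma deriv_antideriv p : (antideriv p)^`() = p.
Proof.
apply/polyP => i; rewrite coef_deriv coef_poly.
have [lti|] := ltnP i.+1 (size p).+1; last first.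
  by rewrite ltnS => lei; rewrite mul0rn nth_default.
by rewrite -[LHS]mulr_natr divfK // pnatr_eq0.
Qed.

Lemma Rintegral_poly (p : {poly R}) (s : R) : 0 <= s ->
  \int[mu]_(t in `[0, s]) p.[t] = (antideriv p).[s].
Proof.
move=> s0; rewrite -{1}[p]deriv_antideriv Rintegral_deriv_poly //.
by rewrite [X in _ - X]horner_coef0 coef_poly /= invr0 mulr0 subr0.
Qed.

Lemma antideriv_is_linear (a : R) p q :
  antideriv (a *: p + q) = a *: antideriv p + antideriv q.
Proof.
apply/polyP => i; rewrite coefD coefZ.
have co r : (antideriv r)`_i = r`_i.-1 * i%:R^-1.
  rewrite coef_poly; case: ltnP => //; case: i => [|i] //.
  by rewrite ltnS => h; rewrite nth_default ?mul0r.
by rewrite !co coefD coefZ mulrDl mulrA.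
Qed.

Lemma antideriv0 : antideriv 0 = 0.
Proof.
by have := antideriv_is_linear (-1) 0 0; rewrite scaler0 addr0 scaleN1r addNr.
Qed.

Lemma antiderivZ (a : R) p : antideriv (a *: p) = a *: antideriv p.
Proof. by have := antideriv_is_linear a p 0; rewrite antideriv0 !addr0. Qed.

(** Euler's Beta integral. The derivative of t^(a+1) (s-t)^(b+1) has integral 0, which trades one
    power of s - t for one power of t; induction on [b]. *)
Lemma Rintegral_beta (a b : nat) (s : R) : 0 <= s ->
  \int[mu]_(t in `[0, s]) (t ^+ a * (s - t) ^+ b) =
  (a`! * b`!)%:R / ((a + b).+1)`!%:R * s ^+ (a + b).+1.
Proof.
move=> s0; elim: b a => [|b IH] a.
  have -> : (fun t => t ^+ a * (s - t) ^+ 0) =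
            (fun t => (('X^(a.+1) : {poly R})^`() * a.+1%:R^-1%:P).[t]).
    apply/funext => t; rewrite derivXn !hornerE hornerMn !hornerE /=.
    by rewrite -[_ *+ _]mulr_natr mulfK ?pnatr_eq0.
  have -> : (('X^(a.+1) : {poly R})^`() * a.+1%:R^-1%:P) =
            (('X^(a.+1) : {poly R}) * a.+1%:R^-1%:P)^`().
    by rewrite derivM derivC mulr0 addr0.
  rewrite Rintegral_deriv_poly // !hornerE expr0n /= mul0r subr0 ?addn0.
  rewrite ?fact0 ?muln1 factS natrM invfM [LHS]mulrC; congr (_ * _).
  by rewrite mulrCA mulfV ?mulr1 // pnatr_eq0 -lt0n fact_gt0.
pose q : {poly R} := 'X^(a.+1) * (s%:P - 'X) ^+ b.+1.
have e1 : \int[mu]_(t in `[0, s]) q^`().[t] = 0.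
  rewrite Rintegral_deriv_poly // /q !hornerE ?horner_exp ?hornerE subrr.
  by rewrite !exprS !mul0r mulr0 subrr.
pose r1 : {poly R} := 'X^a * (s%:P - 'X) ^+ b.+1.
pose r2 : {poly R} := 'X^(a.+1) * (s%:P - 'X) ^+ b.
have e2 : q^`() = a.+1%:R *: r1 + (- b.+1%:R) *: r2.
  rewrite /q derivM derivXn deriv_exp derivB derivC derivX sub0r.
  by rewrite /= scaleNr !scaler_nat mulrnAl mulN1r mulNrn mulrN mulrnAr.
have hr1 t : r1.[t] = t ^+ a * (s - t) ^+ b.+1.
  by rewrite /r1 !hornerE ?horner_exp ?hornerE.
have hr2 t : r2.[t] = t ^+ a.+1 * (s - t) ^+ b.
  by rewrite /r2 !hornerE ?horner_exp ?hornerE.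
have := IH a.+1.
rewrite -(@eq_int_itv (fun t => r2.[t])); last by move=> t _; rewrite hr2.
rewrite Rintegral_poly // => I2.
rewrite -(@eq_int_itv (fun t => r1.[t])); last by move=> t _; rewrite hr1.
rewrite Rintegral_poly //.
move: e1; rewrite Rintegral_poly // e2 antideriv_is_linear antiderivZ hornerD !hornerZ I2.
rewrite addSnnS => /eqP; rewrite mulNr subr_eq0 => /eqP e.
apply: (mulfI (x := a.+1%:R)); first by rewrite pnatr_eq0.
rewrite e !factS !natrM; ring.
Qed.

Lemma Rintegral_sum_beta (J : Type) (r : seq J) (k : J -> R) (a b : J -> nat) (s : R) :
  0 <= s ->
  \int[mu]_(t in `[0, s]) (\sum_(j <- r) k j * (t ^+ a j * (s - t) ^+ b j)) =
  \sum_(j <- r) k j * ((a j)`! * (b j)`!)%:R / ((a j + b j).+1)`!%:R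
                 * s ^+ (a j + b j).+1.
Proof.
move=> s0.
pose q j : {poly R} := 'X^(a j) * (s%:P - 'X) ^+ b j.
have hq j t : (q j).[t] = t ^+ a j * (s - t) ^+ b j.
  by rewrite /q !hornerE ?horner_exp ?hornerE.
rewrite -(@eq_int_itv (fun t => (\sum_(j <- r) k j *: q j).[t])); last first.
  by move=> t _; rewrite horner_sum; apply: eq_bigr => j _; rewrite hornerZ hq.
rewrite Rintegral_poly //.
have -> : antideriv (\sum_(j <- r) k j *: q j) = \sum_(j <- r) k j *: antideriv (q j).
  elim: r => [|j r IH]; last by rewrite !big_cons antideriv_is_linear IH.
  by rewrite !big_nil antideriv0.
rewrite horner_sum; apply: eq_bigr => j _.
rewrite hornerZ -Rintegral_poly // (@eq_int_itv _ (fun t => t ^+ a j * (s - t) ^+ b j)).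
  by rewrite Rintegral_beta // !mulrA.
by move=> t _; rewrite hq.
Qed.

(** Barycentric coordinates scaled so that their sum is [s]; index 0 belongs to the origin. The
    scale is kept because the recursion of [std_int] shrinks the simplex. *)
Definition bcoord n (s : R) (y : 'cV[R]_n) (i : 'I_n.+1) : R :=
  if unlift ord0 i is Some j then y j 0 else s - \sum_j y j 0.

Definition factm n (e : 'I_n -> nat) : nat := \prod_i (e i)`!.

Lemma col_mx_scalar0 n (t : R) (y : 'cV[R]_n) :
  (col_mx (t%:M : 'cV_1) y : 'cV_n.+1) ord0 0 = t.
Proof.
have -> : ord0 = lshift n (0 : 'I_1) :> 'I_n.+1 by apply: val_inj.
by rewrite (@col_mxEu _ 1 n) mxE mulr1n.
Qed.

Lemma col_mx_scalarS n (t : R) (y : 'cV[R]_n) j :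
  (col_mx (t%:M : 'cV_1) y : 'cV_n.+1) (lift ord0 j) 0 = y j 0.
Proof.
have -> : lift ord0 j = rshift 1 j :> 'I_n.+1 by apply: val_inj.
by rewrite (@col_mxEd _ 1 n).
Qed.

(** Fixing the first Cartesian coordinate, which is barycentric coordinate number 1, to [t] leaves
    the coordinates of a simplex of size [s - t]. *)
Lemma bcoord_col_mx n (s t : R) (y : 'cV[R]_n) i :
  @bcoord n.+1 s (col_mx (t%:M : 'cV_1) y) (lift (lift ord0 ord0) i) =
  bcoord (s - t) y i.
Proof.
rewrite /bcoord.
case: (unliftP ord0 i) => [j ->|->].
  have -> : lift (lift ord0 ord0) (lift ord0 j) = lift ord0 (lift ord0 j) :> 'I_n.+2.
    by apply: val_inj.
  by rewrite !liftK col_mx_scalarS.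
have -> : lift (lift ord0 ord0) ord0 = ord0 :> 'I_n.+2 by apply: val_inj.
rewrite unlift_none big_ord_recl /=.
rewrite col_mx_scalar0 opprD addrA.
by congr (_ - _); apply: eq_bigr => j _; rewrite col_mx_scalarS.
Qed.

Lemma bcoord_col_mx1 n (s t : R) (y : 'cV[R]_n) :
  @bcoord n.+1 s (col_mx (t%:M : 'cV_1) y) (lift ord0 ord0) = t.
Proof.
by rewrite /bcoord liftK col_mx_scalar0.
Qed.

(** Dirichlet's formula. The inner integral is a power of [s - t] by induction, so the outer one is
    a Beta integral. It is stated for finite sums so that additivity comes with it. *)
Lemma std_int_monomials n (J : Type) (r : seq J) (c : J -> R)
    (e : J -> 'I_n.+1 -> nat) (s : R) : 0 <= s ->
  std_int s (fun y : 'cV_n =>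
     \sum_(j <- r) c j * \prod_i bcoord s y i ^+ e j i) =
  \sum_(j <- r) c j * (factm (e j))%:R / (\sum_i e j i + n)`!%:R
                 * s ^+ (\sum_i e j i + n).
Proof.
elim: n r c e s => [|n IH] r c e s s0.
  rewrite /=; apply: eq_bigr => j _.
  rewrite /factm !big_ord_recl !big_ord0 /bcoord unlift_none big_ord0 subr0 mulr1.
  by rewrite muln1 addn0 addn0 mulfK // pnatr_eq0 -lt0n fact_gt0.
rewrite /=.
pose o1 : 'I_n.+2 := lift ord0 ord0.
pose e' j i := e j (lift o1 i).
rewrite (@eq_int_itv _ (fun t : R => \sum_(j <- r)
   (c j * (factm (e' j))%:R / (\sum_i e' j i + n)`!%:R) *
   (t ^+ e j o1 * (s - t) ^+ (\sum_i e' j i + n)))); last first.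
  move=> t /andP[t0 ts].
  transitivity (std_int (s - t) (fun y : 'cV_n =>
     \sum_(j <- r) (c j * t ^+ e j o1) * \prod_i bcoord (s - t) y i ^+ e' j i)).
    congr std_int; apply/funext => y; apply: eq_bigr => j _.
    rewrite (bigD1_ord o1) //= bcoord_col_mx1 -mulrA; congr (_ * (_ * _)).
    by apply: eq_bigr => i _; rewrite bcoord_col_mx.
  rewrite IH ?subr_ge0 //; apply: eq_bigr => j _; ring.
rewrite Rintegral_sum_beta //; apply: eq_bigr => j _.
have -> : (\sum_i e j i + n.+1 = (e j o1 + (\sum_i e' j i + n)).+1)%N.
  by rewrite (bigD1_ord o1) //= addnS addnA.
congr (_ * _); rewrite /factm (bigD1_ord o1) //= !natrM.
rewrite -!mulrA; congr (_ * _); rewrite [RHS]mulrCA; congr (_ * _).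
rewrite mulrCA; congr (_ * _).
by rewrite mulKf // pnatr_eq0 -lt0n fact_gt0.
Qed.

(** The points s / (i+1) with i < [size p] are pairwise distinct roots, one more than the degree
    allows. *)
Lemma poly_eq0_itv (p : {poly R}) (s : R) : 0 < s ->
  (forall t, 0 <= t <= s -> p.[t] = 0) -> p = 0.
Proof.
move=> s0 hp; apply/eqP; apply: contraT => p0.
pose r := [seq s / (i.+1)%:R | i <- iota 0 (size p)].
have := @max_poly_roots _ p r p0.
rewrite size_map size_iota ltnn => -> //.
- apply/allP => _ /mapP[i _ ->]; rewrite rootE hp //.
  rewrite divr_ge0 ?ler0n ?(ltW s0) //=.
  by rewrite ler_pdivrMr ?ltr0n // ler_peMr ?(ltW s0) // ler1n.
- rewrite map_inj_uniq ?iota_uniq // => i j /(mulfI (lt0r_neq0 s0)) /invr_inj /eqP.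
  by rewrite eqr_nat eqSS => /eqP.
Qed.

(** The antiderivative is nondecreasing and equal to 0 at both ends of the interval, hence 0 on
    it. *)
Lemma poly_Rintegral_eq0 (p : {poly R}) (s : R) : 0 < s ->
  (forall t, 0 <= t <= s -> 0 <= p.[t]) ->
  \int[mu]_(t in `[0, s]) p.[t] = 0 -> p = 0.
Proof.
move=> s0 p0; rewrite Rintegral_poly ?ltW // => A0.
suff A_eq0 : antideriv p = 0 by rewrite -[p]deriv_antideriv A_eq0 deriv0.
apply: (@poly_eq0_itv _ s s0) => t /andP[t0 ts].
have nd : {in `[0, s] &, nondecreasing_fun (horner (antideriv p))}.
  move=> x y xs ys xy; apply: (@ger0_derive1_ndecr R (horner (antideriv p)) 0 s) => //.
  - move=> z; rewrite in_itv /= => /andP[z0 zs].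
    by rewrite -derivE deriv_antideriv p0 // (ltW z0) (ltW zs).
  - exact/continuous_subspaceT/continuous_horner.
  - by move: xs; rewrite in_itv => /andP[].
  - by move: ys; rewrite in_itv => /andP[].
have A00 : (antideriv p).[0] = 0.
  by rewrite horner_coef0 coef_poly /= invr0 mulr0.
apply/eqP; rewrite eq_le -{1}A0 -{1}A00 !nd ?in_itv /= ?t0 ?ts ?lexx ?(ltW s0) //.
Qed.

Lemma std_int_ge0 n (s : R) (f : 'cV[R]_n -> R) :
  (forall y : 'cV_n, (forall i, 0 <= y i 0) -> \sum_i y i 0 <= s -> 0 <= f y) ->
  0 <= s -> 0 <= std_int s f.
Proof.
elim: n s f => [|n IH] s f f0 s0 /=.
  by apply: f0 => [[]//|]; rewrite big_ord0.
apply: Rintegral_ge0 => t /=; rewrite in_itv /= => /andP[t0 ts].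
apply: IH; last by rewrite subr_ge0.
move=> y y0 ys; apply: f0 => [i|].
  by case: (unliftP ord0 i) => [j ->|->]; rewrite ?col_mx_scalar0 ?col_mx_scalarS.
rewrite big_ord_recl col_mx_scalar0 addrC -lerBrDr.
by under eq_bigr do rewrite col_mx_scalarS.
Qed.

Lemma eq_std_int n (s : R) (f g : 'cV[R]_n -> R) :
  (forall y : 'cV_n, (forall i, 0 <= y i 0) -> \sum_i y i 0 <= s -> f y = g y) ->
  0 <= s -> std_int s f = std_int s g.
Proof.
elim: n s f g => [|n IH] s f g fg s0 /=.
  by apply: fg => [[]//|]; rewrite big_ord0.
apply: eq_int_itv => t /andP[t0 ts]; apply: IH; last by rewrite subr_ge0.
move=> y y0 ys; apply: fg => [i|].
  by case: (unliftP ord0 i) => [j ->|->]; rewrite ?col_mx_scalar0 ?col_mx_scalarS.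
rewrite big_ord_recl col_mx_scalar0 addrC -lerBrDr.
by under eq_bigr do rewrite col_mx_scalarS.
Qed.

(** Slice by slice: the inner integral is a nonnegative polynomial [g] in [t] with integral 0, so
    [g = 0] and the induction applies to each slice. The strict bound on the sum of the coordinates
    keeps every slice of positive size. *)
Lemma std_int_eq0 n (J : Type) (r : seq J) (c : J -> R)
    (e : J -> 'I_n.+1 -> nat) (s : R) : 0 < s ->
  let f s y := \sum_(j <- r) c j * \prod_i bcoord s y i ^+ e j i in
  (forall y : 'cV_n, (forall i, 0 <= y i 0) -> \sum_i y i 0 <= s -> 0 <= f s y) ->
  std_int s (f s) = 0 ->
  forall y : 'cV_n, (forall i, 0 <= y i 0) -> \sum_i y i 0 < s -> f s y = 0.
Proof.
elim: n r c e s => [|n IH] r c e s s0 f f0 /= I0 y y0 ys.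
  by rewrite -I0; congr f; apply/matrixP => -[].
pose o1 : 'I_n.+2 := lift ord0 ord0.
pose e' j i := e j (lift o1 i).
have fE t (z : 'cV[R]_n) : f s (col_mx (t%:M : 'cV_1) z) =
     \sum_(j <- r) (c j * t ^+ e j o1) * \prod_i bcoord (s - t) z i ^+ e' j i.
  apply: eq_bigr => j _.
  rewrite (bigD1_ord o1) //= bcoord_col_mx1 -mulrA; congr (_ * (_ * _)).
  by apply: eq_bigr => i _; rewrite bcoord_col_mx.
pose g : {poly R} := \sum_(j <- r)
   (c j * (factm (e' j))%:R / (\sum_i e' j i + n)`!%:R) *:
   ('X^(e j o1) * (s%:P - 'X) ^+ (\sum_i e' j i + n)).
have gE t : 0 <= t <= s ->
    std_int (s - t) (fun z => f s (col_mx (t%:M : 'cV_1) z)) = g.[t].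
  move=> /andP[t0 ts]; under [X in std_int _ X]funext do rewrite fE.
  rewrite std_int_monomials ?subr_ge0 // /g horner_sum.
  apply: eq_bigr => j _; rewrite hornerZ hornerM hornerXn horner_exp hornerD hornerN.
  rewrite hornerC hornerX; ring.
have fs0 t : 0 <= t <= s -> forall z : 'cV_n, (forall i, 0 <= z i 0) ->
    \sum_i z i 0 <= s - t -> 0 <= f s (col_mx (t%:M : 'cV_1) z).
  move=> /andP[t0 ts] z z0 zs; apply: f0 => [i|].
    by case: (unliftP ord0 i) => [j ->|->]; rewrite ?col_mx_scalar0 ?col_mx_scalarS.
  rewrite big_ord_recl col_mx_scalar0 addrC -lerBrDr.
  by under eq_bigr do rewrite col_mx_scalarS.
have g0 : g = 0.
  apply: (poly_Rintegral_eq0 s0) => [t tE|].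
    rewrite -gE //; apply: std_int_ge0; first exact: fs0.
    by rewrite subr_ge0; case/andP: tE.
  by rewrite -(eq_int_itv gE).
have yE : y = col_mx ((y ord0 0)%:M : 'cV_1) (\col_i y (lift ord0 i) 0).
  apply/matrixP => i j; rewrite ord1.
  by case: (unliftP ord0 i) => [k ->|->]; rewrite ?col_mx_scalar0 ?col_mx_scalarS ?mxE.
have ysE : \sum_i y i 0 = y ord0 0 + \sum_i y (lift ord0 i) 0.
  by rewrite big_ord_recl.
have yt : 0 <= y ord0 0 <= s.
  rewrite y0 /=; apply: le_trans (ltW ys); rewrite ysE lerDl.
  by apply: sumr_ge0 => i _.
rewrite yE fE; apply: IH.
- rewrite subr_gt0; apply: le_lt_trans ys; rewrite ysE lerDl.
  by apply: sumr_ge0 => i _.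
- by move=> z z0 zs; rewrite -fE; apply: fs0.
- have e0 := gE _ yt; rewrite g0 horner0 in e0; rewrite -[RHS]e0.
  congr std_int; apply/funext => z.
  by rewrite fE.
- by move=> i; rewrite mxE.
- by under eq_bigr do rewrite mxE; rewrite ltrBrDl -ysE.
Qed.
End StdInt.

(** * Integration over a simplex as a functional on formal polynomials *)

HB.lock Definition Phi (R : realType) (n : nat) (P : mpoly.mpoly n.+1 R) : R :=
  std_int 1 (fun y : 'cV[R]_n => meval (bcoord 1 y) P).

Section Phi.
Variable R : realType.

Lemma PhiE n (P : mpoly.mpoly n.+1 R) :
  Phi P = std_int 1 (fun y : 'cV[R]_n => meval (bcoord 1 y) P).
Proof. by rewrite Phi.unlock. Qed.

(** The terms of [c *: P] and those of [Q] are concatenated into one list and integrated by the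
    monomial formula, so neither integrability nor the support of the sum is needed. *)
Lemma Phi_lin n c (P Q : mpoly.mpoly n.+1 R) : Phi (c *: P + Q) = c * Phi P + Phi Q.
Proof.
pose J := (R * multinom n.+1)%type.
pose sq k (p : mpoly.mpoly n.+1 R) : seq J := [seq (k * mcoeff m p, m) | m <- msupp p].
have E k p r : std_int 1 (fun y : 'cV[R]_n => k * meval (bcoord 1 y) p + \sum_(j <- r : seq J) j.1 * \prod_i bcoord 1 y i ^+ j.2 i)
    = \sum_(j <- sq k p ++ r) j.1 * (factm (fun i => j.2 i))%:R / (\sum_i j.2 i + n)`!%:R
                 * 1 ^+ (\sum_i j.2 i + n).
  rewrite -(std_int_monomials (n := n) _ _ (fun j : J => fun i => j.2 i)) //.
  congr std_int; apply/funext => y; rewrite big_cat /=; congr (_ + _).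
  rewrite /sq big_map mevalE big_distrr /=; apply: eq_bigr => m _.
  by rewrite mulrA.
have E1 p : Phi p = \sum_(j <- sq 1 p) j.1 * (factm (fun i => j.2 i))%:R / (\sum_i j.2 i + n)`!%:R
                 * 1 ^+ (\sum_i j.2 i + n).
  rewrite -[sq 1 p]cats0 -E PhiE; congr std_int; apply/funext => y.
  by rewrite big_nil addr0 mul1r.
rewrite !E1 big_distrr /= -[X in _ = X + _]/(\sum_(j <- _) _).
have := E c P (sq 1 Q).
rewrite big_cat /= => e.
have -> : \sum_(i <- sq 1 P) c * (i.1 * (factm (fun i0 => i.2 i0))%:R / (\sum_i0 i.2 i0 + n)`!%:R
     * 1 ^+ (\sum_i0 i.2 i0 + n)) = \sum_(j <- sq c P) j.1 * (factm (fun i => j.2 i))%:R / (\sum_i j.2 i + n)`!%:R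
                 * 1 ^+ (\sum_i j.2 i + n).
  by rewrite /sq !big_map; apply: eq_bigr => m _ /=; rewrite !mulrA mulr1.
rewrite -e -E1 !PhiE; congr std_int; apply/funext => y.
rewrite mevalD mevalZ; congr (_ + _).
by rewrite /sq big_map mevalE; apply: eq_bigr => m _ /=; rewrite mul1r.
Qed.

Lemma Phi0 n : Phi (0 : mpoly.mpoly n.+1 R) = 0.
Proof. by have := Phi_lin (-1) (0 : mpoly.mpoly n.+1 R) 0; rewrite scaler0 addr0 mulN1r addNr. Qed.

Lemma PhiZ n c (P : mpoly.mpoly n.+1 R) : Phi (c *: P) = c * Phi P.
Proof. by rewrite -[c *: P]addr0 Phi_lin Phi0 addr0. Qed.

Lemma PhiD n (P Q : mpoly.mpoly n.+1 R) : Phi (P + Q) = Phi P + Phi Q.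
Proof. by rewrite -[P]scale1r Phi_lin scale1r mul1r. Qed.

Lemma Phi_sum n (I : Type) (r : seq I) (P : pred I) (F : I -> mpoly.mpoly n.+1 R) :
  Phi (\sum_(i <- r | P i) F i) = \sum_(i <- r | P i) Phi (F i).
Proof. by apply: (big_morph _ (@PhiD n) (@Phi0 n)). Qed.

Lemma PhiX n (m : multinom n.+1) :
  Phi (mpolyX R m) = (factm m)%:R / (mdeg m + n)`!%:R.
Proof.
have := std_int_monomials (n := n) [:: m] (fun=> 1) (fun m i => m i) (@ler01 R).
rewrite big_seq1 expr1n mulr1 mul1r -mdegE => <-.
by rewrite PhiE; congr std_int; apply/funext => y; rewrite mevalX big_seq1 mul1r.
Qed.

(** Restriction to the face where coordinate [a] vanishes: that variable becomes 0 and the others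
    are renumbered. *)
Definition face_sub n (a : 'I_n.+2) : n.+2.-tuple (mpoly.mpoly n.+1 R) :=
  mktuple (fun i => if unlift a i is Some j then mpolyX R (mnm1 j) else 0).

Definition Face n (a : 'I_n.+2) (P : mpoly.mpoly n.+2 R) : R :=
  Phi (comp_mpoly (face_sub a) P).

Lemma FaceX n a (m : multinom n.+2) :
  Face a (mpolyX R m) =
  if m a == 0%N then (factm m)%:R / (mdeg m + n)`!%:R else 0.
Proof.
rewrite /Face comp_mpolyX (bigD1_ord a) //= tnth_mktuple unlift_none.
case: eqP => [ma|/eqP ma]; last by rewrite expr0n (negPf ma) mul0r Phi0.
rewrite ma expr0 mul1r.
have -> : \prod_(i < n.+1) tnth (face_sub a) (lift a i) ^+ m (lift a i) =
  mpolyX R (Multinom (mktuple (fun i : 'I_n.+1 => m (lift a i)))).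
  rewrite [RHS]mpolyXE_id; apply: eq_bigr => i _.
  by rewrite tnth_mktuple liftK mnmE.
rewrite PhiX !mdegE [in RHS](bigD1_ord a) //= ma add0n.
rewrite /factm [in RHS](bigD1_ord a) //= ma fact0 mul1n.
by congr (_%:R / (_ + _)`!%:R); apply: eq_bigr => i _; rewrite mnmE.
Qed.

(** Here m_a (m - e_a)! = m!, and the lost degree offsets the extra dimension, so the value is that
    of [FaceX] in the complementary case. *)
Lemma Phi_derivX n (a : 'I_n.+2) (m : multinom n.+2) :
  Phi (mderiv a (mpolyX R m)) =
  if m a == 0%N then 0 else (factm m)%:R / (mdeg m + n)`!%:R.
Proof.
rewrite mderivX PhiZ PhiX; case: eqP => [->|/eqP ma]; first by rewrite mul0r.
have mE : m = (mnm_add (mnm_sub m (mnm1 a)) (mnm1 a)).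
  by rewrite submK // lep1mP.
set m' := mnm_sub m (mnm1 a) in mE *.
have ma' : m a = (m' a).+1 by rewrite mE mnmDE mnm1E eqxx addn1.
rewrite {3}mE mdegD mdeg1 addn1 addnS mulrA -natrM; congr (_%:R / _).
rewrite /factm (bigD1_ord a) // [in RHS](bigD1_ord a) //= ma' factS -mulnA.
congr (_ * (_ * _))%N; apply: eq_bigr => i _.
by rewrite mE mnmDE mnm1E (negPf (neq_lift a i)) addn0.
Qed.

Lemma Face_lin n a c (P Q : mpoly.mpoly n.+2 R) :
  Face a (c *: P + Q) = c * Face a P + Face a Q.
Proof. by rewrite /Face comp_mpolyD comp_mpolyZ Phi_lin. Qed.

Lemma Face0 n (a : 'I_n.+2) : Face a 0 = 0.
Proof. by rewrite /Face comp_mpoly0 Phi0. Qed.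

(* On a monomial both sides equal m! / (|m| + n)!, whatever the index. *)
Lemma Phi_deriv_Face n (a b : 'I_n.+2) P :
  Phi (mderiv a P) + Face a P = Phi (mderiv b P) + Face b P.
Proof.
elim/mpolyind: P => [|c m P _ _ IH]; first by rewrite !mderiv0 !Phi0 !Face0.
have dE i : mderiv i (c *: mpolyX R m + P) = c *: mderiv i (mpolyX R m) + mderiv i P.
  by rewrite mderivD mderivZ.
rewrite !dE !Phi_lin !Face_lin.
rewrite [LHS]addrACA [RHS]addrACA.
congr (_ + _); last exact: IH.
rewrite -[LHS]mulrDr -[RHS]mulrDr; congr (_ * _).
by rewrite !FaceX !Phi_derivX; do 2!case: ifP; rewrite ?addr0 ?add0r.
Qed.

(** Substitution x = sum_j lam_j p_j, which rewrites a polynomial in x in barycentric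
    coordinates. *)
Definition pull_sub n d (p : 'I_n.+1 -> 'cV[R]_d) : d.-tuple (mpoly.mpoly n.+1 R) :=
  mktuple (fun c => \sum_j p j c 0 *: mpolyX R (mnm1 j)).

Definition pull n d (p : 'I_n.+1 -> 'cV[R]_d) (f : Poly R d) : mpoly.mpoly n.+1 R :=
  comp_mpoly (pull_sub p) f.

Lemma meval_pull n d (p : 'I_n.+1 -> 'cV[R]_d) f l :
  meval l (pull p f) = ev (\sum_j l j *: p j) f.
Proof.
rewrite /pull comp_mpoly_meval /ev; apply: meval_eq => c.
rewrite tnth_mktuple summxE raddf_sum /=; apply: eq_bigr => j _.
by rewrite mevalZ mevalXU !mxE mulrC.
Qed.

(** The integral divided by the Gram factor. It is the mean value up to the factor 1/n!, which is
    the value on the constant 1. *)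
Definition avg n d (p : 'I_n.+1 -> 'cV[R]_d) (f : Poly R d) : R := Phi (pull p f).

Lemma avgE n d (p : 'I_n.+1 -> 'cV[R]_d) f :
  avg p f = std_int 1 (fun y : 'cV[R]_n => ev (\sum_j bcoord 1 y j *: p j) f).
Proof. by rewrite /avg PhiE; congr std_int; apply/funext => y; rewrite meval_pull. Qed.

Lemma avg_lin n d (p : 'I_n.+1 -> 'cV[R]_d) c f g :
  avg p (c *: f + g) = c * avg p f + avg p g.
Proof. by rewrite /avg /pull comp_mpolyD comp_mpolyZ Phi_lin. Qed.

Lemma avg0 n d (p : 'I_n.+1 -> 'cV[R]_d) : avg p 0 = 0.
Proof. by rewrite /avg /pull comp_mpoly0 Phi0. Qed.

(** The iterated integral treats the vertices unequally, but its value on monomials is symmetric in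
    the exponents. This is what lets two elements that list a common facet in different orders agree
    on its integrals. *)
Lemma Phi_perm n (s : 'S_n.+1) (P : mpoly.mpoly n.+1 R) :
  Phi (comp_mpoly (mktuple (fun i => mpolyX R (mnm1 (s i)))) P) = Phi P.
Proof.
elim/mpolyind: P => [|c m P _ _ IH]; first by rewrite comp_mpoly0.
rewrite comp_mpolyD comp_mpolyZ !Phi_lin IH; congr (_ * _ + _).
rewrite comp_mpolyX.
have -> : \prod_(i < n.+1) tnth (mktuple (fun i => mpolyX R (mnm1 (s i)))) i ^+ m i =
  mpolyX R (Multinom (mktuple (fun i : 'I_n.+1 => m ((s^-1)%g i)))).
  rewrite mpolyXE_id [RHS](reindex_inj (@perm_inj _ s)) /=; apply: eq_bigr => i _.
  by rewrite tnth_mktuple mnmE permK.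
rewrite !PhiX !mdegE [in RHS](reindex_inj (@perm_inj _ (s^-1)%g)) /=.
rewrite /factm [in RHS](reindex_inj (@perm_inj _ (s^-1)%g)) /=.
by congr (_%:R / (_ + _)`!%:R); apply: eq_bigr => i _; rewrite mnmE.
Qed.

Lemma avg_perm n d (s : 'S_n.+1) (p : 'I_n.+1 -> 'cV[R]_d) f :
  avg (p \o s) f = avg p f.
Proof.
rewrite /avg -[RHS](Phi_perm s^-1) !PhiE; congr std_int; apply/funext => y.
rewrite [in RHS]comp_mpoly_meval !meval_pull [in RHS](reindex_inj (@perm_inj _ s)).
congr ev; apply: eq_bigr => j _ /=.
by rewrite tnth_mktuple mevalXU permK.
Qed.

Lemma Face_pull n d (p : 'I_n.+2 -> 'cV[R]_d) a f :
  Face a (pull p f) = avg (fun j => p (lift a j)) f.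
Proof.
rewrite /Face /avg !PhiE; congr std_int; apply/funext => y; rewrite comp_mpoly_meval !meval_pull.
congr ev; rewrite (bigD1_ord a) //= tnth_mktuple unlift_none meval0 scale0r add0r.
by apply: eq_bigr => j _; rewrite tnth_mktuple liftK mevalXU.
Qed.

(** Chain rule. Both sides obey the product rule and are additive, so it suffices to check constants
    and coordinates. *)
Lemma mderiv_pull n d (p : 'I_n.+1 -> 'cV[R]_d) a f :
  mderiv a (pull p f) = \sum_c p a c 0 *: pull p (pd c f).
Proof.
pose Q g := mderiv a (pull p g) = \sum_c p a c 0 *: pull p (pd c g).
have pullM g h : pull p (g * h) = pull p g * pull p h by rewrite /pull rmorphM.
have pullD g h : pull p (g + h) = pull p g + pull p h by rewrite /pull rmorphD.
have QM g h : Q g -> Q h -> Q (g * h).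
  rewrite /Q => Qg Qh; rewrite pullM mderivM Qg Qh mulr_suml mulr_sumr -big_split /=.
  apply: eq_bigr => c _; rewrite /pd mderivM pullD !pullM scalerDr.
  by rewrite -scalerAl -scalerAr.
have Q1 : Q 1.
  rewrite /Q /pull rmorph1 -mpolyC1 mderivC big1 // => c _.
  by rewrite /pd mderivC comp_mpoly0 scaler0.
have QX c : Q (mpolyX R (mnm1 c)).
  rewrite /Q /pull comp_mpolyXU -tnth_nth tnth_mktuple raddf_sum /=.
  rewrite (bigD1 a) //= mderivZ mderivX mnm1E eqxx.
  rewrite [X in _ + X]big1 ?addr0; last first.
    by move=> j ja; rewrite mderivZ mderivX mnm1E (negPf ja) scale0r scaler0.
  rewrite (bigD1 c) //= [X in _ + X]big1 ?addr0; last first.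
    move=> j ja; rewrite /pd mderivX mnm1E eq_sym (negPf ja) scale0r comp_mpoly0.
    by rewrite scaler0.
  rewrite /pd mderivX mnm1E eqxx !scale1r; congr (_ *: _).
  have s0 k (i : 'I_k) : mnm_sub (mnm1 i) (mnm1 i) = mnm0.
    by apply/mnmP => l; rewrite mnmBE subnn mnm0E.
  by rewrite !s0 !mpolyX0 rmorph1.
suff QXm m : Q (mpolyX R m).
  elim/mpolyind: f => [|k m g _ _ IH].
    by rewrite /pull comp_mpoly0 mderiv0 big1 // => i _; rewrite /pd mderiv0 comp_mpoly0 scaler0.
  rewrite pullD {1}/pull comp_mpolyZ mderivD mderivZ IH (QXm m) scaler_sumr -big_split /=.
  apply: eq_bigr => c _.
  by rewrite /pd mderivD pullD mderivZ /pull comp_mpolyZ scalerDr !scalerA mulrC.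
rewrite mpolyXE_id; apply: big_ind => // c _.
by elim: (m c) => [|k IH]; rewrite ?expr0 // exprS; apply: QM.
Qed.
End Phi.

Section Avg.
Variable R : realType.

Definition edge_mx n d (p : 'I_n.+1 -> 'cV[R]_d) : 'M[R]_(d, n) :=
  \matrix_(i, j) (p (lift ord0 j) - p ord0) i 0.

Lemma bcoord_sum n (s : R) (y : 'cV[R]_n) : \sum_i bcoord s y i = s.
Proof.
rewrite big_ord_recl {1}/bcoord unlift_none.
have -> : \sum_(i < n) bcoord s y (lift ord0 i) = \sum_j y j 0.
  by apply: eq_bigr => i _; rewrite /bcoord liftK.
by rewrite subrK.
Qed.

Lemma edge_mx_bcoord n d (p : 'I_n.+1 -> 'cV[R]_d) y :
  p ord0 + edge_mx p *m y = \sum_j bcoord 1 y j *: p j.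
Proof.
apply/matrixP => i k; rewrite ord1 !mxE summxE big_ord_recl !mxE.
rewrite {1}/bcoord unlift_none mulrBl mul1r -addrA; congr (_ + _).
rewrite mulr_suml -sumrN -big_split /=; apply: eq_bigr => j _.
by rewrite /bcoord liftK !mxE; ring.
Qed.

Lemma simplex_int_bcoord n d (p : 'I_n.+1 -> 'cV[R]_d) (f : 'cV[R]_d -> R) :
  simplex_int n [seq p i | i : 'I_n.+1] f =
  Num.sqrt (\det ((edge_mx p)^T *m edge_mx p)) *
  std_int 1 (fun y : 'cV[R]_n => f (\sum_j bcoord 1 y j *: p j)).
Proof.
have nthE (i : 'I_n.+1) : [seq p i | i : 'I_n.+1]`_i = p i.
  by rewrite (nth_map ord0) ?size_enum_ord // nth_ord_enum.
have E : (\matrix_(i, j) ([seq p i | i : 'I_n.+1]`_j.+1 - [seq p i | i : 'I_n.+1]`_0) i 0)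
   = edge_mx p :> 'M[R]_(d, n).
  apply/matrixP => i j; rewrite !mxE.
  by rewrite -(nthE (lift ord0 j)) -(nthE ord0).
rewrite /simplex_int E; congr (_ * std_int _ _); apply/funext => y.
by rewrite -edge_mx_bcoord -(nthE ord0).
Qed.

Lemma simplex_intE n d (p : 'I_n.+1 -> 'cV[R]_d) f :
  simplex_int n [seq p i | i : 'I_n.+1] (fun x => ev x f) =
  Num.sqrt (\det ((edge_mx p)^T *m edge_mx p)) * avg p f.
Proof. by rewrite simplex_int_bcoord avgE. Qed.

Lemma avg_ext n d (p : 'I_n.+1 -> 'cV[R]_d) f g :
  (forall l, (forall i, 0 <= l i) -> \sum_i l i = 1 ->
     ev (\sum_i l i *: p i) f = ev (\sum_i l i *: p i) g) ->
  avg p f = avg p g.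
Proof.
move=> fg; rewrite !avgE; apply: eq_std_int => // y y0 ys.
apply: fg; last exact: bcoord_sum.
by move=> i; rewrite /bcoord; case: unliftP => [j _|_]; rewrite ?subr_ge0.
Qed.

Lemma avg_ge0 n d (p : 'I_n.+1 -> 'cV[R]_d) f :
  (forall l, (forall i, 0 <= l i) -> \sum_i l i = 1 ->
     0 <= ev (\sum_i l i *: p i) f) ->
  0 <= avg p f.
Proof.
move=> fg; rewrite !avgE; apply: std_int_ge0 => // y y0 ys.
apply: fg; last exact: bcoord_sum.
by move=> i; rewrite /bcoord; case: unliftP => [j _|_]; rewrite ?subr_ge0.
Qed.

(** Only the coordinate of index 0 has to be positive, because it is the slack 1 - sum y in
    [std_int_eq0]. *)
Lemma avg_eq0_interior n d (p : 'I_n.+1 -> 'cV[R]_d) f :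
  (forall l, (forall i, 0 <= l i) -> \sum_i l i = 1 ->
     0 <= ev (\sum_i l i *: p i) f) ->
  avg p f = 0 ->
  forall l, (forall i, 0 <= l i) -> 0 < l ord0 -> \sum_i l i = 1 ->
  ev (\sum_i l i *: p i) f = 0.
Proof.
move=> f0; rewrite /avg PhiE => I0 l l0 l00 l1.
pose P := pull p f.
have PE (y : 'cV[R]_n) : meval (bcoord 1 y) P = \sum_(m <- msupp P) mcoeff m P * \prod_i bcoord 1 y i ^+ m i.
  by rewrite mevalE.
have := @std_int_eq0 R n _ (msupp P) (fun m => mcoeff m P) (fun m i => m i) 1 ltr01.
have -> : l = bcoord 1 (\col_i l (lift ord0 i)).
  apply/funext => i; rewrite /bcoord; case: unliftP => [j ->|->]; first by rewrite mxE.
  under eq_bigr do rewrite mxE.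
  by rewrite -l1 big_ord_recl addrK.
rewrite -meval_pull -/P PE => H; apply: H.
- move=> y y0 ys; rewrite -PE /P meval_pull; apply: f0; last exact: bcoord_sum.
  by move=> i; rewrite /bcoord; case: unliftP => [j _|_]; rewrite ?subr_ge0.
- by rewrite -[RHS]I0; congr std_int; apply/funext => y; rewrite -PE.
- by move=> i; rewrite mxE.
- by under eq_bigr do rewrite mxE; rewrite -l1 big_ord_recl ltrDr.
Qed.

(** Induction on the number of variables: [P] is read as a univariate polynomial in variable 0 whose
    coefficients [Q k] are polynomials in the remaining ones. *)
Lemma mpoly_eq0_box n (P : mpoly.mpoly n R) (z : 'I_n -> R) (e : R) : 0 < e ->
  (forall y, (forall i, z i <= y i <= z i + e) -> meval y P = 0) -> P = 0.
Proof.
move=> e0; elim: n P z => [|n IH] P z Pz.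
  have PE := nvar0_mpolyC P; rewrite PE; have := Pz z; rewrite PE mevalC => ->.
    by rewrite mpolyC0 mcoeff0 mpolyC0.
  by case.
pose tl (m : multinom n.+1) : multinom n := Multinom (mktuple (fun i => m (lift ord0 i))).
pose Q k : mpoly.mpoly n R := \sum_(m <- msupp P | m ord0 == k) mcoeff m P *: mpolyX R (tl m).
pose K := (\max_(m <- msupp P) m ord0).+1.
have mK m : m \in msupp P -> (m ord0 < K)%N.
  by move=> mP; rewrite ltnS; apply: (@leq_bigmax_seq _ (msupp P) predT (fun m : multinom n.+1 => m ord0)).
have PQ u y : meval (fun i => if unlift ord0 i is Some j then y j else u) P =
    (\poly_(k < K) meval y (Q k)).[u].
  rewrite horner_poly mevalE (big_seq_cond predT) /=.
  rewrite (partition_big (fun m : multinom n.+1 => inord (m ord0) : 'I_K) predT) //=.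
  apply: eq_bigr => k _; rewrite /Q raddf_sum /= mulr_suml big_seq_cond.
  rewrite [RHS]big_seq_cond.
  apply: eq_big => [m|m /and3P[mP _ /eqP mk]].
    case mP: (m \in msupp P) => //=; rewrite -val_eqE /= inordK ?mK //.
  rewrite mevalZ mevalX big_ord_recl unlift_none.
  have -> : (k : nat) = m ord0.
    by rewrite -mk inordK // mK.
  rewrite -mulrA; congr (_ * _); rewrite mulrC; congr (_ * _).
  by apply: eq_bigr => i _; rewrite liftK mnmE.
have Q0 k : Q k = 0.
  have [kK|kK] := ltnP k K; last first.
    rewrite /Q big_seq_cond big1 // => m /andP[/mK mK' /eqP mk].
    by move: mK'; rewrite mk ltnNge kK.
  apply: (IH _ (fun i => z (lift ord0 i))) => y yz.
  (* The shift moves the interval to [0, e], the form required by [poly_eq0_itv]. *)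
  have p0 : (\poly_(k < K) meval y (Q k)) \Po ('X + (z ord0)%:P) = 0.
    apply: (poly_eq0_itv e0) => t /andP[t0 te].
    rewrite horner_comp hornerD hornerX hornerC -PQ; apply: Pz => i.
    case: unliftP => [j ->|->]; first exact: yz.
    by rewrite lerDr t0 addrC lerD2l.
  have /polyP/(_ k) : \poly_(k < K) meval y (Q k) = 0.
    apply/eqP; rewrite -size_poly_eq0 -(size_comp_poly2 _ (q := 'X + (z ord0)%:P)).
      by rewrite p0 size_poly0.
    by rewrite size_XaddC.
  by rewrite coef_poly kK coef0.
apply/mpolyP => m; rewrite mcoeff0; apply/eqP; apply: contraT.
rewrite -mcoeff_msupp => mP.
have := congr1 (mcoeff (tl m)) (Q0 (m ord0)); rewrite mcoeff0 /Q raddf_sum /=.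
rewrite big_mkcond (bigD1_seq m) ?msupp_uniq //= eqxx mcoeffZ mcoeffX eqxx mulr1.
rewrite big1 ?addr0 => [/eqP|]; first by rewrite mcoeff_eq0 mP.
move=> m' mm'; case: eqP => // m'0.
rewrite mcoeffZ mcoeffX; case: eqP => [tE|]; last by rewrite mulr0.
case/eqP: mm'; apply/mnmP => i; case: (unliftP ord0 i) => [j ->|->] //.
by have := congr1 (fun m : multinom n => m j) tE; rewrite !mnmE.
Qed.

End Avg.

(** * Barycentric coordinates *)

Section Bary.
Variables (R : realType) (d : nat) (p : 'I_d.+1 -> 'cV[R]_d).

Definition lam i (x : 'cV[R]_d) : R :=
  invmx (vertex_mx p) ord0 i + \sum_j x j 0 * gradbary p i j 0.

Lemma ev_bary i x : ev x (bary p i) = lam i x.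
Proof.
rewrite /ev /bary mevalD mevalC raddf_sum /=; congr (_ + _).
by apply: eq_bigr => j _; rewrite mevalZ mevalXU mulrC.
Qed.

Lemma pd_bary i j : pd j (bary p i) = mpolyC d (gradbary p i j 0).
Proof.
rewrite /pd /bary mderivD mderivC add0r raddf_sum /= (bigD1 j) //= big1 => [|k kj].
  rewrite addr0 mderivZ mderivX mnm1E eqxx scale1r -alg_mpolyC; congr (_ *: _).
  by rewrite -mpolyX0; congr mpolyX; apply/mnmP => l; rewrite mnmBE subnn mnm0E.
by rewrite mderivZ mderivX mnm1E (negPf kj) scale0r scaler0.
Qed.

Lemma vertex_mx0 i : vertex_mx p i ord0 = 1.
Proof.
rewrite mxE; have -> : ord0 = lshift d (0 : 'I_1) :> 'I_(1 + d) by apply: val_inj.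
by rewrite row_mxEl mxE.
Qed.

Lemma vertex_mxS i j : vertex_mx p i (lift ord0 j) = p i j 0.
Proof.
rewrite mxE; have -> : lift ord0 j = rshift 1 j :> 'I_(1 + d) by apply: val_inj.
by rewrite row_mxEr mxE.
Qed.

Lemma lam_affine (I : finType) (c : I -> R) (q : I -> 'cV[R]_d) i :
  \sum_k c k = 1 -> lam i (\sum_k c k *: q k) = \sum_k c k * lam i (q k).
Proof.
move=> c1; rewrite /lam.
under [RHS]eq_bigr do rewrite mulrDr.
rewrite big_split /= -mulr_suml c1 mul1r; congr (_ + _).
under [RHS]eq_bigr do rewrite mulr_sumr.
rewrite exchange_big /=; apply: eq_bigr => j _.
rewrite summxE mulr_suml; apply: eq_bigr => k _.
by rewrite !mxE mulrA.
Qed.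

Lemma lam_line i (x y : 'cV[R]_d) (t : R) :
  lam i ((1 - t) *: x + t *: y) = (1 - t) * lam i x + t * lam i y.
Proof.
rewrite /lam !mulrDr addrACA -!mulrDl subrK mul1r; congr (_ + _).
rewrite !mulr_sumr -big_split /=; apply: eq_bigr => j _.
by rewrite !mxE mulrDl !mulrA.
Qed.

Lemma lamB i (x y : 'cV[R]_d) :
  lam i x - lam i y = \sum_j (x j 0 - y j 0) * gradbary p i j 0.
Proof.
rewrite /lam opprD addrACA subrr add0r -sumrB; apply: eq_bigr => j _.
by rewrite mulrBl.
Qed.

Hypothesis pN : nondegenerate p.

Lemma lam_vertex i j : lam i (p j) = (j == i)%:R.
Proof.
have := congr1 (fun A : 'M[R]_d.+1 => A j i) (mulmxV pN).
rewrite !mxE big_ord_recl vertex_mx0 mul1r => <-; congr (_ + _).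
by apply: eq_bigr => k _; rewrite vertex_mxS mxE.
Qed.

(** Entries of V^-1 V = 1 for V = [vertex_mx p]: the column of ones of V gives this identity, the
    other columns give sum_i (grad lam_i) p_i^T = I in the next lemma. *)
Lemma gradbary_sum j : \sum_i gradbary p i j 0 = 0.
Proof.
have := congr1 (fun A : 'M[R]_d.+1 => A (lift ord0 j) ord0) (mulVmx pN).
rewrite !mxE /= mulr0n => e; rewrite -[RHS]e; apply: eq_bigr => i _.
by rewrite vertex_mx0 mulr1 mxE.
Qed.

Lemma gradbary_vertex_sum j k : \sum_i gradbary p i j 0 * p i k 0 = (j == k)%:R.
Proof.
have := congr1 (fun A : 'M[R]_d.+1 => A (lift ord0 j) (lift ord0 k)) (mulVmx pN).
rewrite !mxE (inj_eq (@lift_inj _ _)) => <-; apply: eq_bigr => i _.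
by rewrite vertex_mxS mxE.
Qed.

Lemma lam_sum x : \sum_i lam i x = 1.
Proof.
rewrite /lam big_split /= exchange_big /= [X in _ + X]big1 ?addr0.
  have := congr1 (fun A : 'M[R]_d.+1 => A ord0 ord0) (mulVmx pN).
  rewrite !mxE eqxx => e; rewrite -[RHS]e; apply: eq_bigr => i _.
  by rewrite vertex_mx0 mulr1.
by move=> j _; rewrite -mulr_sumr gradbary_sum mulr0.
Qed.

Lemma lam_sum_vertex x : \sum_i lam i x *: p i = x.
Proof.
apply/matrixP => k l; rewrite ord1 summxE.
under eq_bigr do rewrite mxE /lam mulrDl mulr_suml.
rewrite big_split /= exchange_big /=.
have -> : \sum_i invmx (vertex_mx p) ord0 i * p i k 0 = 0.
  have := congr1 (fun A : 'M[R]_d.+1 => A ord0 (lift ord0 k)) (mulVmx pN).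
  rewrite !mxE /= mulr0n => e; rewrite -[RHS]e; apply: eq_bigr => i _.
  by rewrite vertex_mxS.
rewrite add0r (bigD1 k) //= [X in _ + X = _]big1 => [|j jk].
  under eq_bigr do rewrite -mulrA.
  by rewrite -mulr_sumr gradbary_vertex_sum eqxx mulr1 addr0.
under eq_bigr do rewrite -mulrA.
by rewrite -mulr_sumr gradbary_vertex_sum (negPf jk) mulr0.
Qed.

Lemma lam_comb c : \sum_k c k = 1 -> forall i, lam i (\sum_k c k *: p k) = c i.
Proof.
move=> c1 i; rewrite lam_affine // (bigD1 i) //= lam_vertex eqxx mulr1.
by rewrite big1 ?addr0 // => k ki; rewrite lam_vertex (negPf ki) mulr0.
Qed.

Lemma vertex_inj : injective p.
Proof.
move=> i j pij; apply/eqP; have := lam_vertex i i.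
rewrite pij lam_vertex eqxx => /eqP; rewrite eqr_nat eq_sym [j == i]eq_sym.
by case: (i == j).
Qed.

Lemma gradbary_neq0 i : (0 < d)%N -> exists j, gradbary p i j 0 != 0.
Proof.
move=> d0.
have [j ji] : exists j : 'I_d.+1, j != i.
  have [->|i0] := eqVneq i ord0; last by exists ord0; rewrite eq_sym.
  by exists ord_max; rewrite -val_eqE /= -lt0n.
apply/existsP; apply: contraT; rewrite negb_exists => /forallP h.
have := lamB i (p j) (p i); rewrite !lam_vertex eqxx (negPf ji) big1 => [/eqP|k _].
  by rewrite sub0r oppr_eq0 oner_eq0.
by have := h k; rewrite negbK => /eqP ->; rewrite mulr0.
Qed.

(** [f] vanishes at the points of a small box in the interior of the simplex, hence as a
    polynomial. *)
Lemma avg_eq0 f :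
  (forall x, (forall i, 0 <= lam i x) -> 0 <= ev x f) -> avg p f = 0 -> f = 0.
Proof.
move=> f0 I0.
pose z : 'cV[R]_d := \sum_i (d.+1)%:R^-1 *: p i.
pose K := 1 + \sum_i \sum_j `|gradbary p i j 0|.
have K0 : 0 < K by rewrite ltr_pwDl // sumr_ge0 // => i _; apply: sumr_ge0.
(* Every barycentric coordinate equals 1/(d+1) at the barycentre [z], and moving each Cartesian
   coordinate by at most [e] changes it by less than that. *)
pose e := (d.+1)%:R^-1 / K.
have e0 : 0 < e by rewrite divr_gt0 // invr_gt0 ltr0n.
have c1 : \sum_(i < d.+1) (d.+1)%:R^-1 = 1 :> R.
  by rewrite sumr_const card_ord -[_ *+ _]mulr_natr mulVf // pnatr_eq0.
apply: (mpoly_eq0_box (z := fun j => z j 0) e0) => y yz.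
pose x : 'cV[R]_d := \col_j y j.
have -> : meval y f = ev x f by apply: meval_eq => j; rewrite mxE.
have lx i : 0 < lam i x.
  rewrite -[lam i x](subrK (lam i z)) lamB {2}/z lam_comb //.
  rewrite -ltrBlDr sub0r.
  apply: lt_le_trans (_ : - (e * \sum_j `|gradbary p i j 0|) <= _).
    rewrite ltrN2 /e -mulrA gtr_pMr ?invr_gt0 ?ltr0n // mulrC ltr_pdivrMr // mul1r.
    rewrite /K (bigD1 i) //= ltr_pwDl // lerDl.
    by apply: sumr_ge0 => k _; apply: sumr_ge0.
  rewrite mulr_sumr -sumrN; apply: ler_sum => j _.
  apply: le_trans (_ : - `|(x j 0 - z j 0) * gradbary p i j 0| <= _); last first.
    by rewrite lerNl -normrN ler_norm.
  rewrite lerN2 normrM ler_wpM2r // mxE.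
  have /andP[h1 h2] := yz j.
  by rewrite ger0_norm ?subr_ge0 // lerBlDl.
rewrite -(lam_sum_vertex x); apply: (avg_eq0_interior _ I0) => // [l l0 l1|i|].
- by apply: f0 => i; rewrite lam_comb.
- exact: ltW.
- exact: lam_sum.
Qed.

Lemma bary_neq0 i : bary p i != 0.
Proof.
apply/eqP => b0; have := ev_bary i (p i); rewrite b0 lam_vertex eqxx /ev meval0.
by move=> /esym /eqP; rewrite oner_eq0.
Qed.

End Bary.

(** Divergence theorem on a simplex. The components h_a = grad lam_a . v satisfy sum_a h_a = 0, and
    div v pulls back to sum_a d_a h_a. [Phi_deriv_Face] trades d_a for d_0 plus face terms, and the
    terms attached to index 0 cancel since the h_a sum to 0. The sign is negative because grad lam_a
    points inwards. *)
Lemma avg_div (R : realType) n (p : 'I_n.+2 -> 'cV[R]_n.+1) (v : 'cV[Poly R n.+1]_n.+1) :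
  nondegenerate p ->
  avg p (div_poly v) =
  - \sum_(a < n.+2) avg (fun j : 'I_n.+1 => p (lift a j)) (\sum_c gradbary p a c 0 *: v c 0).
Proof.
move=> pN.
pose h a := pull p (\sum_c gradbary p a c 0 *: v c 0).
have pull_sum (I : finType) (F : I -> Poly R n.+1) : pull p (\sum_c F c) = \sum_c pull p (F c).
  by rewrite /pull rmorph_sum.
have pullZ c (f : Poly R n.+1) : pull p (c *: f) = c *: pull p f by rewrite /pull comp_mpolyZ.
have h0 : \sum_a h a = 0.
  rewrite /h -pull_sum exchange_big /= /pull big1 ?comp_mpoly0 // => c _.
  by rewrite -scaler_suml gradbary_sum // scale0r.
transitivity (\sum_a Phi (mderiv a (h a))).
  rewrite /avg -Phi_sum; congr Phi; rewrite /h.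
  under [RHS]eq_bigr do rewrite mderiv_pull.
  rewrite exchange_big /= /div_poly pull_sum; apply: eq_bigr => c _.
  have E a : pull p (pd c (\sum_c0 gradbary p a c0 0 *: v c0 0)) =
       \sum_c0 gradbary p a c0 0 *: pull p (pd c (v c0 0)).
    rewrite /pd raddf_sum pull_sum; apply: eq_bigr => c0 _.
    by rewrite /= mderivZ pullZ.
  under eq_bigr do rewrite E scaler_sumr.
  rewrite exchange_big /= (bigD1 c) //= [X in _ = _ + X]big1 => [|c0 cc0].
    have e1 := gradbary_vertex_sum pN c c; rewrite eqxx in e1.
    rewrite addr0 -[LHS]scale1r -[1]e1 scaler_suml.
    by apply: eq_bigr => a _; rewrite scalerA mulrC.
  under eq_bigr do rewrite scalerA mulrC.
  by rewrite -scaler_suml gradbary_vertex_sum // (negPf cc0) scale0r.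
have E a : Phi (mderiv a (h a)) = Phi (mderiv ord0 (h a)) + Face ord0 (h a) - Face a (h a).
  by rewrite -(Phi_deriv_Face a) addrK.
under eq_bigr do rewrite E.
rewrite sumrB big_split /= -Phi_sum -raddf_sum /= h0 mderiv0 Phi0 add0r.
have -> : \sum_i Face ord0 (h i) = 0.
  by rewrite /Face -Phi_sum -raddf_sum /= h0 comp_mpoly0 Phi0.
by rewrite sub0r; congr (- _); apply: eq_bigr => a _; rewrite /h Face_pull.
Qed.

(** * Determinants as volumes *)

Section Det.
Variables (R : realType) (d : nat).
Implicit Types p : 'I_d.+1 -> 'cV[R]_d.

Lemma det_vertex_mx p : \det (vertex_mx p) = \det (edge_mx p).
Proof.
pose L : 'M[R]_(1 + d) := block_mx 1%:M 0 (const_mx 1) 1%:M.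
pose U : 'M[R]_(1 + d) := block_mx 1%:M (p ord0)^T 0 (edge_mx p)^T.
have -> : vertex_mx p = L *m U.
  rewrite mulmx_block ?mul1mx ?mul0mx ?mulmx0 ?mulmx1 ?addr0.
  apply/matrixP => i j; rewrite mxE.
  case: (@split_ordP 1 d i) => k ->; case: (@split_ordP 1 d j) => l ->.
  - by rewrite row_mxEl (@block_mxEul _ 1 d 1 d) !ord1.
  - rewrite row_mxEr (@block_mxEur _ 1 d 1 d) !mxE.
    by rewrite (ord1 k) (_ : lshift d 0 = ord0) //; apply: val_inj.
  - by rewrite row_mxEl (@block_mxEdl _ 1 d 1 d) !mxE ord1 eqxx.
  - rewrite row_mxEr (@block_mxEdr _ 1 d 1 d) !mxE big_ord1 !mxE mul1r addrC.
    by rewrite (_ : rshift 1 k = lift ord0 k) ?subrK //; apply: val_inj.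
by rewrite det_mulmx /L /U (@det_lblock _ 1 d) (@det_ublock _ 1 d) !det1 det_tr !mul1r.
Qed.

Lemma sqrt_gram_edge p :
  Num.sqrt (\det ((edge_mx p)^T *m edge_mx p)) = `|\det (vertex_mx p)|.
Proof. by rewrite det_mulmx det_tr -expr2 sqrtr_sqr det_vertex_mx. Qed.

Lemma vol_gt0 p : nondegenerate p -> 0 < `|\det (vertex_mx p)|.
Proof. by rewrite /nondegenerate unitmxE unitfE normr_gt0. Qed.

Lemma vertex_mx_perm p (s : {perm 'I_d.+1}) :
  vertex_mx (p \o s) = row_perm s (vertex_mx p).
Proof. by apply/matrixP => i j; rewrite !mxE. Qed.

Lemma det_vertex_mx_perm p (s : {perm 'I_d.+1}) :
  `|\det (vertex_mx (p \o s))| = `|\det (vertex_mx p)|.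
Proof.
rewrite vertex_mx_perm row_permE det_mulmx det_perm normrM.
by rewrite normrX normrN1 expr1n mul1r.
Qed.

Lemma lam_mulmx p q i j : lam p i (q j) = (vertex_mx q *m invmx (vertex_mx p)) j i.
Proof.
rewrite !mxE big_ord_recl vertex_mx0 mul1r; congr (_ + _).
by apply: eq_bigr => k _; rewrite vertex_mxS !mxE.
Qed.

(** The matrix V_q V_p^-1 is the identity except in row [i], so its determinant is the diagonal
    entry there, a barycentric coordinate of the replaced vertex. *)
Lemma det_vertex_mx_shared p q i : nondegenerate p ->
  (forall j, j != i -> q j = p j) ->
  \det (vertex_mx q) = lam p i (q i) * \det (vertex_mx p).
Proof.
move=> pN qp.
have -> : vertex_mx q = vertex_mx q *m invmx (vertex_mx p) *m vertex_mx p by rewrite mulmxKV.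
rewrite det_mulmx; congr (_ * _).
rewrite (expand_det_col _ i) (bigD1 i) //= big1 ?addr0 => [|j ji]; last first.
  by rewrite -lam_mulmx qp // lam_vertex // (negPf ji) mul0r.
rewrite -lam_mulmx /cofactor addnn -signr_odd odd_double expr0 mul1r.
rewrite (_ : row' _ _ = 1%:M) ?det1 ?mulr1 //.
apply/matrixP => k l; rewrite !mxE -[X in X = _]/(\sum_m _).
have := lam_mulmx p q (lift i l) (lift i k).
rewrite mxE => <-; rewrite qp 1?eq_sym ?neq_lift // lam_vertex //.
by rewrite (inj_eq (@lift_inj _ i)) eq_sym.
Qed.

End Det.

Lemma perm_of_codom (A : finType) m (f g : 'I_m -> A) :
  injective f -> injective g -> (forall j, exists k, f j = g k) ->
  exists s : {perm 'I_m}, forall j, f j = g (s j).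
Proof.
move=> fi gi fg.
have h j : {k | f j = g k} by apply: cid.
have hi : injective (fun j => sval (h j)).
  move=> j k e; apply: fi.
  by rewrite (svalP (h j)) e -(svalP (h k)).
by exists (perm hi) => j; rewrite permE; case: (h j).
Qed.

(** * Mesh geometry and the divergence theorem *)

Section Mesh.
Variables (R : realType) (d : nat) (M : mesh R d) (Omega : set 'cV[R]_d).
Hypothesis meshM : is_mesh M Omega.
Implicit Types (T : 'I_(ne M)).

Let vset_inj : injective (@vset _ _ M). Proof. by case: meshM => -[]. Qed.

Lemma mesh_nondegenerate T : nondegenerate (vert T).
Proof. by case: meshM => _ + _ _ _; apply. Qed.
Local Notation vN := mesh_nondegenerate.

Lemma elt_inj T : injective (elt T).
Proof. by move=> i j e; apply: (vertex_inj (vN T)); rewrite /vert e. Qed.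

Lemma card_vset T : #|vset T| = d.+1.
Proof. by rewrite /vset card_imset ?card_ord //; apply: elt_inj. Qed.

Lemma mem_vset T i : elt T i \in vset T.
Proof. exact: imset_f. Qed.

Lemma mem_fverts T i j : (elt T j \in fverts (T, i)) = (j != i).
Proof.
apply/imsetP/idP => [[k /= ki /elt_inj ->]|ji]; first by rewrite inE in ki.
by exists j => //; rewrite inE.
Qed.

Lemma fverts_sub T i : fverts (T, i) \subset vset T.
Proof. by apply/fintype.subsetP => _ /imsetP[k _ ->]; exact: mem_vset. Qed.

Lemma fvertsP T i v : reflect (exists j, v = elt T (lift i j)) (v \in fverts (T, i)).
Proof.
apply: (iffP imsetP) => [[k /= ki ->]|[j ->]].
  move: ki; rewrite inE => ki; case: (unliftP i k) ki => [j ->|->]; last by rewrite eqxx.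
  by exists j.
by exists (lift i j) => //; rewrite inE eq_sym neq_lift.
Qed.

Lemma card_fverts T i : #|fverts (T, i)| = d.
Proof.
have -> : fverts (T, i) = [set elt T (lift i j) | j : 'I_d]%SET.
  apply/setP => v; apply/fvertsP/imsetP => [[j ->]|[j _ ->]]; first by exists j.
  by exists j.
by rewrite card_imset ?card_ord // => j k /elt_inj /lift_inj.
Qed.

Lemma fverts_inj T : injective (fun i => fverts (T, i)).
Proof.
move=> i j /= e; apply/eqP; apply: contraT => ij.
by have := mem_fverts T i i; rewrite e mem_fverts ij eqxx.
Qed.

(** Convex coefficients supported on vertices of a nondegenerate simplex are its barycentric
    coordinates. *)
Lemma hull_lam (S : {set 'I_(nv M)}) T x : S \subset vset T -> hull (@vtx _ _ M) S x ->
  (forall i, 0 <= lam (vert T) i x) /\ (forall i, elt T i \notin S -> lam (vert T) i x = 0).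
Proof.
move=> ST [c [c0 cS c1 ->]].
have E i : lam (vert T) i (\sum_v c v *: vtx v) = c (elt T i).
  rewrite lam_affine // (bigD1 (elt T i)) //= -/(vert T i) lam_vertex // ?eqxx ?mulr1; last exact: vN.
  rewrite big1 ?addr0 // => v vi.
  have [vS|/cS ->] := boolP (v \in S); last by rewrite mul0r.
  have /imsetP[j _ vE] := fintype.subsetP ST _ vS.
  rewrite vE -/(vert T j) lam_vertex ?vN //.
  by case: eqP => [ji|]; rewrite ?mulr0 //; rewrite vE ji eqxx in vi.
by split=> i; rewrite E // => /cS.
Qed.

Lemma lam_hull (S : {set 'I_(nv M)}) T x :
  (forall i, 0 <= lam (vert T) i x) -> (forall i, elt T i \notin S -> lam (vert T) i x = 0) ->
  hull (@vtx _ _ M) S x.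
Proof.
move=> l0 lS; exists (fun v => \sum_(i | elt T i == v) lam (vert T) i x); split.
- by move=> v; apply: sumr_ge0.
- by move=> v vS; apply: big1 => i /eqP iv; apply: lS; rewrite iv.
- rewrite -(lam_sum (vN T) x) [RHS](partition_big (elt T) predT) //.
- rewrite -{1}(lam_sum_vertex (vN T) x) (partition_big (elt T) predT) //=.
  apply: eq_bigr => v _; rewrite scaler_suml; apply: eq_bigr => i /eqP <- //.
Qed.

Lemma simplexP T x : simplex T x <-> forall i, 0 <= lam (vert T) i x.
Proof.
split=> [/(hull_lam (subxx _))[]//|l0]; apply: lam_hull => // i.
by rewrite mem_vset.
Qed.

Lemma facetP T i x : facet (fverts (T, i)) x <->
  (forall j, 0 <= lam (vert T) j x) /\ lam (vert T) i x = 0.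
Proof.
split=> [/(hull_lam (fverts_sub _ _))[l0 ls]|[l0 li]].
  by split=> //; apply: ls; rewrite mem_fverts eqxx.
by apply: (lam_hull l0) => j; rewrite mem_fverts negbK => /eqP ->.
Qed.

Lemma fverts_perm T i T' i' : fverts (T, i) = fverts (T', i') ->
  exists s : {perm 'I_d}, forall j, elt T (lift i j) = elt T' (lift i' (s j)).
Proof.
move=> e; apply: (@perm_of_codom _ d (fun j : 'I_d => elt T (lift i j)) (fun j : 'I_d => elt T' (lift i' j))) => [j k /elt_inj /lift_inj|j k /elt_inj /lift_inj|j] //.
by apply/fvertsP; rewrite -e; apply/fvertsP; exists j.
Qed.

(** Two affine functions vanishing on the same facet are proportional; the factor is read off at the
    apex of T'. The same factor governs gradients and, in absolute value, volumes. *)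
Lemma lam_ratio T i T' i' : fverts (T, i) = fverts (T', i') ->
  forall x, lam (vert T) i x = lam (vert T) i (vert T' i') * lam (vert T') i' x.
Proof.
move=> e x; have [s sE] := fverts_perm (esym e).
rewrite -{1}(lam_sum_vertex (vN T') x) lam_affine ?lam_sum ?vN //.
rewrite (bigD1 i') //= big1 ?addr0 => [|j ji]; first by rewrite mulrC.
case: (unliftP i' j) ji => [k ->|->]; last by rewrite eqxx.
move=> _; rewrite /vert sE -/(vert T _) lam_vertex ?vN //.
by rewrite eq_sym (negPf (neq_lift _ _)) mulr0.
Qed.

Lemma gradbary_ratio T i T' i' : fverts (T, i) = fverts (T', i') ->
  forall j, gradbary (vert T) i j 0 =
            lam (vert T) i (vert T' i') * gradbary (vert T') i' j 0.
Proof.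
move=> e j.
have gE T0 k : gradbary (vert T0) k j 0 = lam (vert T0) k (delta_mx j 0) - lam (vert T0) k 0.
  rewrite lamB (bigD1 j) //= !mxE !eqxx subr0 mul1r big1 ?addr0 // => l lj.
  by rewrite !mxE (negPf lj) /= subr0 mul0r.
by rewrite !gE (lam_ratio e) [X in _ - X](lam_ratio e) mulrBr.
Qed.

Lemma vol_ratio T i T' i' : fverts (T, i) = fverts (T', i') ->
  `|\det (vertex_mx (vert T'))| =
  `|lam (vert T) i (vert T' i')| * `|\det (vertex_mx (vert T))|.
Proof.
move=> e; have [s sE] := fverts_perm e.
rewrite -(det_vertex_mx_perm _ (lift_perm i i' s)).
rewrite (@det_vertex_mx_shared _ _ (vert T) _ i) ?vN //.
  by rewrite normrM /= lift_perm_id.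
move=> j; case: (unliftP i j) => [k ->|->]; last by rewrite eqxx.
by rewrite /= lift_perm_lift /vert sE.
Qed.

(* Otherwise a point near the barycentre of the facet, pushed towards the other
   apex, would lie in both elements but not in the facet. *)
Lemma lam_opposite T i T' i' : (0 < d)%N -> T != T' -> fverts (T, i) = fverts (T', i') ->
  lam (vert T) i (vert T' i') < 0.
Proof.
move=> d0 TT' e; set r := lam _ _ _.
have r0 : r != 0.
  have := vol_gt0 (vN T'); rewrite (vol_ratio e) -/r.
  by apply: contraTneq => ->; rewrite normr0 mul0r ltxx.
rewrite lt_neqAle r0 /= leNgt; apply/negP => rgt0.
pose b : 'cV[R]_d := \sum_(j < d) d%:R^-1 *: vert T (lift i j).
have c1 : \sum_(j < d) d%:R^-1 = 1 :> R.
  by rewrite sumr_const card_ord -[_ *+ _]mulr_natr mulVf // pnatr_eq0 -lt0n.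
have lb j : lam (vert T) j b = if j == i then 0 else d%:R^-1.
  rewrite lam_affine //.
  case: (unliftP i j) => [k ->|->].
    rewrite eq_sym (negPf (neq_lift _ _)) (bigD1 k) //= lam_vertex ?vN // eqxx mulr1.
    rewrite big1 ?addr0 // => l lk; rewrite lam_vertex ?vN //.
    by rewrite (inj_eq (@lift_inj _ i)) (negPf lk) mulr0.
  rewrite eqxx big1 // => k _; rewrite lam_vertex ?vN //.
  by rewrite eq_sym (negPf (neq_lift _ _)) mulr0.
have lb' j : 0 <= lam (vert T') j b.
  have [s sE] := fverts_perm e.
  rewrite lam_affine //; apply: sumr_ge0 => k _.
  by rewrite /vert sE -/(vert T' _) lam_vertex ?vN // mulr_ge0 ?invr_ge0 ?ler0n.
pose S := \sum_j `|lam (vert T) j (vert T' i')|.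
have S0 : 0 <= S by apply: sumr_ge0.
(* Largest value with t S <= (1 - t)/d: the step towards the apex cannot make any coordinate
   negative that equals 1/d at the barycentre of the facet. *)
pose t := (1 + d%:R * S)^-1.
have dS0 : 0 < 1 + d%:R * S by rewrite ltr_pwDl // mulr_ge0 ?ler0n.
have t0 : 0 < t by rewrite invr_gt0.
have t1 : t <= 1 by rewrite invf_le1 // lerDl mulr_ge0 ?ler0n.
pose x := (1 - t) *: b + t *: vert T' i'.
have xT' : simplex T' x.
  apply/simplexP => j; rewrite lam_line addr_ge0 ?mulr_ge0 ?subr_ge0 ?(ltW t0) //.
  by rewrite lam_vertex ?vN ?ler0n.
have xT : simplex T x.
  apply/simplexP => j; rewrite lam_line lb; case: eqP => [->|_].
    by rewrite mulr0 add0r mulr_ge0 ?ltW.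
  rewrite -lerBlDr sub0r.
  apply: le_trans (_ : t * S <= _).
    rewrite -mulrN; apply: ler_wpM2l; [exact: ltW|apply: le_trans (ler_norm _) _].
    rewrite normrN /S (bigD1 j) //=.
    by rewrite lerDl sumr_ge0.
  rewrite -ler_pdivrMr ?invr_gt0 ?ltr0n // invrK lerBrDr -mulrA -[X in _ + X]mulr1 -mulrDr.
  by rewrite addrC [S * _]mulrC mulVf // gt_eqF.
have : (simplex T `&` simplex T') x by [].
case: meshM => _ _ -> _ _ /(hull_lam (subsetIl _ _))[_ /(_ i)].
rewrite lam_line lb eqxx mulr0 add0r -/r => H.
have /H/eqP : elt T i \notin vset T :&: vset T'.
  rewrite inE mem_vset /=; apply: contra TT' => iT'.
  suff /vset_inj -> : vset T = vset T' by [].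
  apply/eqP; rewrite eqEcard !card_vset leqnn andbT; apply/fintype.subsetP => _ /imsetP[j _ ->].
  case: (unliftP i j) => [k ->|->] //.
  apply: (fintype.subsetP (fverts_sub T' i')); rewrite -e.
  by apply/fvertsP; exists k.
by rewrite mulf_eq0 (negPf r0) orbF gt_eqF.
Qed.

End Mesh.

Section Ev.
Variables (R : realType) (d : nat).
Implicit Types (x : 'cV[R]_d) (p q : Poly R d).

Lemma dotE x y : dot x y = \sum_j x j 0 * y j 0.
Proof. by rewrite /dot mxE; apply: eq_bigr => j _; rewrite mxE. Qed.

Lemma dotC x y : dot x y = dot y x.
Proof. by rewrite !dotE; apply: eq_bigr => j _; rewrite mulrC. Qed.

Lemma dotZr k x y : dot x (k *: y) = k * dot x y.
Proof. by rewrite !dotE mulr_sumr; apply: eq_bigr => c _; rewrite mxE mulrCA. Qed.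

Lemma dotZl k x y : dot (k *: x) y = k * dot x y.
Proof. by rewrite dotC dotZr dotC. Qed.

Lemma dotDl x y z : dot (x + y) z = dot x z + dot y z.
Proof. by rewrite !dotE -big_split; apply: eq_bigr => c _; rewrite mxE mulrDl. Qed.

Lemma dotBl x y z : dot (x - y) z = dot x z - dot y z.
Proof. by rewrite -scaleN1r dotDl dotZl mulN1r. Qed.

Lemma evD x p q : ev x (p + q) = ev x p + ev x q. Proof. exact: mevalD. Qed.
Lemma evN x p : ev x (- p) = - ev x p. Proof. exact: mevalN. Qed.
Lemma evB x p q : ev x (p - q) = ev x p - ev x q. Proof. exact: mevalB. Qed.
Lemma evM x p q : ev x (p * q) = ev x p * ev x q. Proof. exact: mevalM. Qed.
Lemma evZ x c p : ev x (c *: p) = c * ev x p. Proof. exact: mevalZ. Qed.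
Lemma evC x c : ev x (mpolyC d c) = c. Proof. exact: mevalC. Qed.
Lemma ev0 x : ev x 0 = 0. Proof. exact: meval0. Qed.
Lemma evX x i : ev x (mpolyX R (mnm1 i)) = x i 0. Proof. exact: mevalXU. Qed.
Lemma ev_sum x (I : Type) (r : seq I) (P : pred I) (F : I -> Poly R d) :
  ev x (\sum_(i <- r | P i) F i) = \sum_(i <- r | P i) ev x (F i).
Proof. exact: raddf_sum. Qed.

Lemma dot_gt0 x j : x j 0 != 0 -> 0 < dot x x.
Proof.
move=> xj; rewrite dotE (bigD1 j) //= ltr_wpDr //.
  by apply: sumr_ge0 => k _; rewrite -expr2 sqr_ge0.
by rewrite lt_neqAle -expr2 sqr_ge0 eq_sym sqrf_eq0 xj.
Qed.

End Ev.

Section MeshFacets.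
Variables (R : realType) (n : nat).
Local Notation d := n.+1.
Variables (M : mesh R d) (Omega : set 'cV[R]_d).
Hypothesis meshM : is_mesh M Omega.
Implicit Types (T : 'I_(ne M)) (F : {set 'I_(nv M)}).
Local Notation vN := (mesh_nondegenerate meshM).

Lemma fverts_facets p : fverts p \in facets M.
Proof. by apply/imsetP; exists p. Qed.

Lemma ori_fverts F : F \in facets M -> fverts (plus F, (ori F).2) = F.
Proof. by case: meshM => _ _ _ _ h /h; rewrite /plus -surjective_pairing. Qed.

Lemma neighboursP F T : F \in facets M ->
  reflect (exists i, fverts (T, i) = F) (T \in neighbours F).
Proof.
move=> FF; have cF : #|F| = d by case/imsetP: FF => -[T0 i0] _ ->; exact: (card_fverts meshM).
rewrite inE; apply: (iffP idP) => [FT|[i <-]]; last exact: fverts_sub.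
have [i iF] : exists i, elt T i \notin F.
  apply/existsP; apply: contraT; rewrite negb_exists => /forallP h.
  have /subset_leq_card : vset T \subset F.
    by apply/fintype.subsetP => _ /imsetP[i _ ->]; have := h i; rewrite negbK.
  by rewrite cF (card_vset meshM) ltnn.
exists i; apply/esym/eqP; rewrite eqEcard cF (card_fverts meshM) leqnn andbT.
apply/fintype.subsetP => v vF.
have /imsetP[j _ vE] := fintype.subsetP FT _ vF.
rewrite vE (mem_fverts meshM); apply: contraNneq iF => <-.
by rewrite -vE.
Qed.

(** Sign argument: with three elements on one facet, the coordinate of the third apex in T would be
    a product of two negative ratios, yet it has to be negative. *)
Lemma shared_facet_uniq T i T' i' T'' i'' :
  fverts (T, i) = fverts (T', i') -> fverts (T, i) = fverts (T'', i'') ->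
  T != T' -> T != T'' -> T' = T''.
Proof.
move=> e e' TT' TT''; apply/eqP; apply: contraT => TN.
have h1 := lam_opposite meshM (ltn0Sn _) TT' e.
have h2 := lam_opposite meshM (ltn0Sn _) TT'' e'.
have h3 := lam_opposite meshM (ltn0Sn _) TN (etrans (esym e) e').
have := lam_ratio meshM e (vert T'' i'').
by move: h2 => /[swap] ->; rewrite ltNge mulr_le0 // ltW.
Qed.

Variant minus_spec F : option 'I_(ne M) -> Prop :=
| MinusSome T i of T != plus F & fverts (T, i) = F &
    (forall T0 i0, fverts (T0, i0) = F -> T0 = plus F \/ T0 = T) :
    minus_spec F (Some T)
| MinusNone of (forall T i, fverts (T, i) = F -> T = plus F) : minus_spec F None.

Lemma minusP F : F \in facets M -> minus_spec F (minus F).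
Proof.
move=> FF; rewrite /minus; case: pickP => [T /andP[/(neighboursP _ FF)[i iE] TF]|h].
  apply: (MinusSome (i := i)) => // T0 i0 E0.
  have [->|T0F] := eqVneq T0 (plus F); [by left|right].
  by apply: (@shared_facet_uniq (plus F) (ori F).2 T0 i0 T i); rewrite ?ori_fverts // eq_sym.
constructor => T i TiF; apply/eqP; have := h T; rewrite (introT (neighboursP _ FF)) /=.
  by move/negbT; rewrite negbK.
by exists i.
Qed.

Lemma int_facetsP F : F \in facets M -> (F \in int_facets M) = (minus F != None).
Proof.
move=> FF; rewrite inE FF /=.
have pF : plus F \in neighbours F by apply/neighboursP => //; exists (ori F).2; exact: ori_fverts.
case: (minusP FF) => [T i TF TiF h|h].
  have -> : neighbours F = [set plus F; T]%SET.
    apply/setP => T0; apply/(neighboursP _ FF)/set2P => [[i0 /h]//|[->//|->]].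
      by exists (ori F).2; exact: ori_fverts.
    by exists i.
  by rewrite cards2 [plus F == T]eq_sym TF.
have -> : neighbours F = [set plus F]%SET.
  apply/setP => T0; apply/idP/set1P => [/(neighboursP _ FF)[i /h]//|->//].
by rewrite cards1.
Qed.

Lemma gradbary_dot_gt0 T i : 0 < dot (gradbary (vert T) i) (gradbary (vert T) i).
Proof. by have [j /dot_gt0] := gradbary_neq0 (vN T) i (ltn0Sn _). Qed.

Lemma normal_unit F : dot (normal F) (normal F) = 1.
Proof.
rewrite /normal /enorm; set g := gradbary _ _.
have g0 : 0 < dot g g by exact: gradbary_dot_gt0.
rewrite dotZl dotZr mulrA mulrNN -invfM -expr2 sqr_sqrtr ?ltW // mulVf //.
exact: lt0r_neq0.
Qed.

(** The normal is defined from T^+ only; this expresses it through either neighbour, with an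
    unspecified sign. *)
Lemma normal_gradbary F T i : F \in facets M -> fverts (T, i) = F ->
  exists2 k : R, k != 0 & normal F = k *: gradbary (vert T) i.
Proof.
move=> FF TiF.
have [k0 [k00 E]] : exists k : R, k != 0 /\ normal F = k *: gradbary (vert (plus F)) (ori F).2.
  exists (- (enorm (gradbary (vert (plus F)) (ori F).2))^-1); split => //.
  by rewrite oppr_eq0 invr_eq0 /enorm sqrtr_eq0 -ltNge gradbary_dot_gt0.
have e : fverts (plus F, (ori F).2) = fverts (T, i) by rewrite ori_fverts.
have r0 : lam (vert (plus F)) (ori F).2 (vert T i) != 0.
  have := vol_gt0 (vN T); rewrite (vol_ratio meshM e).
  by apply: contraTneq => ->; rewrite normr0 mul0r ltxx.
exists (k0 * lam (vert (plus F)) (ori F).2 (vert T i)); first by rewrite mulf_neq0.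
rewrite E -scalerA; congr (_ *: _); apply/matrixP => j l.
by rewrite (ord1 l) (gradbary_ratio meshM e) [RHS]mxE.
Qed.

Lemma face_facet T i (l : 'I_d -> R) : (forall j, 0 <= l j) -> \sum_j l j = 1 ->
  facet (fverts (T, i)) (\sum_j l j *: vert T (lift i j)).
Proof.
move=> l0 l1; apply/(facetP meshM); split=> [j|].
  rewrite lam_affine //; apply: sumr_ge0 => k _.
  by rewrite (lam_vertex (vN _)) mulr_ge0 ?ler0n.
rewrite lam_affine // big1 // => j _.
by rewrite (lam_vertex (vN _)) eq_sym (negPf (neq_lift _ _)) mulr0.
Qed.

Definition vol T : R := `|\det (vertex_mx (vert T))|.

Lemma avg_face_perm T i T' i' f : fverts (T, i) = fverts (T', i') ->
  avg (fun j : 'I_d => vert T (lift i j)) f = avg (fun j : 'I_d => vert T' (lift i' j)) f.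
Proof.
move=> e; have [s sE] := fverts_perm meshM e.
rewrite -[RHS](avg_perm s); congr avg; apply/funext => j /=.
by rewrite /vert sE.
Qed.

Lemma elt_intE T (f : Poly R d) :
  elt_int T (fun x => ev x f) = vol T * avg (vert T) f.
Proof. by rewrite /elt_int simplex_intE sqrt_gram_edge. Qed.

(** Global divergence theorem for fields with no normal jump. Across a facet, gradients scale by a
    ratio r < 0 and volumes by |r|, so the two one-sided contributions cancel without any
    computation of facet areas. *)
Lemma sum_div_eq0 (v : 'I_(ne M) -> 'cV[Poly R d]_d) :
  (forall F, F \in facets M -> forall x, facet F x ->
     jump F (fun T => dot (map_mx (ev x) (v T)) (normal F)) = 0) ->
  \sum_T vol T * avg (vert T) (div_poly (v T)) = 0.
Proof.
move=> jv.
pose gv (g : 'cV[R]_d) T : Poly R d := \sum_c g c 0 *: v T c 0.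
pose w (q : 'I_(ne M) * 'I_d.+1) :=
  vol q.1 * avg (fun j : 'I_d => vert q.1 (lift q.2 j)) (gv (gradbary (vert q.1) q.2) q.1).
transitivity (- \sum_q w q).
  rewrite -(pair_bigA _ (fun T i => w (T, i))) /= -sumrN; apply: eq_bigr => T _.
  by rewrite (avg_div _ (vN T)) mulrN mulr_sumr.
apply/eqP; rewrite oppr_eq0; apply/eqP.
rewrite (partition_big (@fverts _ _ M) (mem (facets M))) /=; last by move=> q _; exact: fverts_facets.
apply: big1 => F FF.
have gvE g T x : ev x (gv g T) = dot (map_mx (ev x) (v T)) g.
  by rewrite ev_sum dotE; apply: eq_bigr => c _; rewrite evZ mxE mulrC.
have eF := ori_fverts FF.
have oF : ori F = (plus F, (ori F).2) by rewrite -surjective_pairing.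
have jF := jv F FF; rewrite /jump in jF.
move: jF; case: (minusP FF) => [T' i' T'F eF' h|h] jF.
  have eT : fverts (plus F, (ori F).2) = fverts (T', i') by rewrite eF.
  rewrite (bigD1 (ori F)) /=; last by rewrite oF eF.
  rewrite (big_pred1 (T', i')) => [|[T0 i0] /=]; last first.
    apply/andP/eqP => [[/eqP E0 N0]|[-> ->]].
      have [T0F|T0T] := h _ _ E0; last first.
        by rewrite T0T in E0 *; congr (_, _); apply: (@fverts_inj _ _ _ _ meshM T'); rewrite E0 eF'.
      case/eqP: N0; rewrite oF T0F; congr (_, _).
      by apply: (@fverts_inj _ _ _ _ meshM (plus F)); rewrite eF -T0F.
    by rewrite eF' eqxx oF xpair_eqE (negPf T'F).
  rewrite oF /w /=.
  set r := lam (vert (plus F)) (ori F).2 (vert T' i').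
  have r0 : r < 0 by apply: (lam_opposite meshM) => //; rewrite eq_sym.
  set g' := gradbary (vert T') i'.
  have gE : gradbary (vert (plus F)) (ori F).2 = r *: g'.
    by apply/matrixP => j l; rewrite (ord1 l) (gradbary_ratio meshM eT) [RHS]mxE.
  have -> : gv (gradbary (vert (plus F)) (ori F).2) (plus F) = r *: gv g' (plus F).
    by rewrite gE /gv scaler_sumr; apply: eq_bigr => c _; rewrite mxE scalerA.
  rewrite {2}/vol (vol_ratio meshM eT) -/r -/(vol _) ltr0_norm //.
  have -> : avg (fun j => vert (plus F) (lift (ori F).2 j)) (r *: gv g' (plus F)) =
            r * avg (fun j => vert T' (lift i' j)) (gv g' T').
    rewrite -[_ *: _]addr0 avg_lin avg0 addr0 (avg_face_perm _ eT); congr (_ * _).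
    apply: avg_ext => l l0 l1; rewrite !gvE.
    have := face_facet T' i' l0 l1; rewrite eF' => /jF /eqP.
    have [k k0 ->] := normal_gradbary FF eF'.
    rewrite subr_eq0 !dotZr => /eqP /(mulfI k0) //.
  by rewrite mulrCA mulrA mulNr mulNr subrr.
rewrite (big_pred1 (ori F)) => [|[T0 i0] /=]; last first.
  apply/eqP/eqP => [E0|E0]; last by rewrite E0 oF eF.
  have T0F := h _ _ E0; rewrite oF T0F; congr (_, _).
  by apply: (@fverts_inj _ _ _ _ meshM (plus F)); rewrite eF -T0F.
rewrite oF /w /=.
rewrite (@avg_ext _ _ _ _ _ 0) ?avg0 ?mulr0 // => l l0 l1.
rewrite gvE ev0; have := face_facet (plus F) (ori F).2 l0 l1; rewrite eF => /jF /eqP.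
have [k k0 ->] := normal_gradbary FF eF.
by rewrite subr0 dotZr mulf_eq0 (negPf k0) => /eqP.
Qed.

End MeshFacets.

(** * Facet-connectedness of the mesh *)

Section Topology.
Variable R : realType.

Lemma open_box n (O : set 'cV[R]_n) x : open O -> O x ->
  exists2 e : R, 0 < e & forall y : 'cV[R]_n, (forall i, `|y i 0 - x i 0| < e) -> O y.
Proof.
move=> oO Ox; have /nbhs_ballP[e /= e0 He] : nbhs x O by exact: open_nbhs_nbhs.
exists e => // y yx; apply: He.
by split=> // i j; rewrite (ord1 j) /ball /= distrC.
Qed.

Lemma lam_continuous n (p : 'I_n.+1 -> 'cV[R]_n) i : continuous (lam p i).
Proof.
move=> x; rewrite /lam.
apply: (@cvgD _ _ _ (nbhs x) _ (fun=> invmx (vertex_mx p) ord0 i)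
  (fun y : 'cV[R]_n => \sum_j y j 0 * gradbary p i j 0)); first exact: cvg_cst.
apply: (cvg_big (op := +%R)); first exact: add_continuous.
move=> j _; apply: cvgM; last exact: cvg_cst.
exact: coord_continuous.
Qed.

(** A common Lipschitz constant of the barycentric coordinates for the maximum norm; the summand 1
    makes it positive. *)
Definition grad_bound n (p : 'I_n.+1 -> 'cV[R]_n) : R :=
  1 + \sum_i \sum_j `|gradbary p i j 0|.

Lemma grad_bound_gt0 n (p : 'I_n.+1 -> 'cV[R]_n) : 0 < grad_bound p.
Proof. by rewrite ltr_pwDl // sumr_ge0 // => i _; apply: sumr_ge0. Qed.

Lemma lam_lipschitz n (p : 'I_n.+1 -> 'cV[R]_n) (x y : 'cV[R]_n) (e : R) i : 0 < e ->
  (forall j, `|y j 0 - x j 0| <= e) -> lam p i x - e * grad_bound p <= lam p i y.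
Proof.
move=> e0 yx; rewrite lerBlDr -lerBlDl lamB (le_trans (ler_norm _)) //.
apply: le_trans (ler_norm_sum _ _ _) _.
apply: (@le_trans _ _ (\sum_j e * `|gradbary p i j 0|)).
  by apply: ler_sum => j _; rewrite normrM ler_wpM2r // distrC.
rewrite -mulr_sumr; apply: ler_wpM2l; first exact: ltW.
rewrite /grad_bound (bigD1 i) //= addrCA lerDl.
by rewrite addr_ge0 // sumr_ge0 // => k _; apply: sumr_ge0.
Qed.

Lemma poly_nonzero_near n (P : Poly R n) (x : 'cV[R]_n) (e : R) : 0 < e -> P != 0 ->
  exists2 y : 'cV[R]_n, (forall i, `|y i 0 - x i 0| <= e) & ev y P != 0.
Proof.
move=> e0 P0; apply: contrapT => H; case/eqP: P0.
apply: (mpoly_eq0_box (z := fun i => x i 0) e0) => y yx.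
apply/eqP; apply: contraT => yP; exfalso; apply: H.
exists (\col_i y i).
  move=> i; rewrite mxE; have /andP[h1 h2] := yx i.
  by rewrite ger0_norm ?subr_ge0 // lerBlDl.
by rewrite /ev; under eq_fun do rewrite mxE.
Qed.

End Topology.

Section MeshConnected.
Variables (R : realType) (n : nat).
Local Notation d := n.+1.
Variables (M : mesh R d) (Omega : set 'cV[R]_d).
Hypothesis meshM : is_mesh M Omega.
Hypothesis domOmega : polyhedral_domain Omega.
Implicit Types (T : 'I_(ne M)) (F : {set 'I_(nv M)}).
Local Notation vN := (mesh_nondegenerate meshM).

Let oOmega : open Omega. Proof. by case: domOmega. Qed.

Lemma Omega_cover x : Omega x -> exists T, simplex T x.
Proof.
case: meshM => _ _ _ cl _ Ox.
have : closure Omega x by exact: subset_closure.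
by rewrite cl => -[T _ Tx]; exists T.
Qed.

Lemma mesh_inhabited : inhabited 'I_(ne M).
Proof. by case: domOmega => _ _ [x Ox] _ _; have [T _] := Omega_cover Ox; constructor. Qed.

Lemma vset_neq T T' : T != T' -> exists i, elt T i \notin vset T'.
Proof.
move=> TT'; apply/existsP; apply: contraT; rewrite negb_exists => /forallP h.
case/eqP: TT'; case: meshM => -[_ +] _ _ _ _; apply.
apply/eqP; rewrite eqEcard !(card_vset meshM) leqnn andbT.
by apply/fintype.subsetP => _ /imsetP[i _ ->]; have := h i; rewrite negbK.
Qed.

Lemma simplexI_lam0 T T' i x : simplex T x -> simplex T' x -> elt T i \notin vset T' ->
  lam (vert T) i x = 0.
Proof.
move=> xT xT' iT'; have : (simplex T `&` simplex T') x by [].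
case: meshM => _ _ -> _ _ /(hull_lam meshM (subsetIl _ _))[_]; apply.
by rewrite inE (negPf iT') andbF.
Qed.

Lemma interior_uniq T T' x : (forall i, 0 < lam (vert T) i x) -> simplex T' x -> T = T'.
Proof.
move=> xT xT'; apply/eqP; apply: contraT => /vset_neq[i iT'].
have xT0 : simplex T x by apply/(simplexP meshM) => j; exact: ltW.
by have := xT i; rewrite (simplexI_lam0 xT0 xT' iT') ltxx.
Qed.

(** Facet-connectedness is expressed without paths: every function of the elements that agrees
    across common facets is constant. It is later used with the constant values of q and with the
    polynomials v. *)
Variables (A : Type) (z : 'I_(ne M) -> A).
Hypothesis z_facet : forall T i T' i', fverts (T, i) = fverts (T', i') -> z T = z T'.

(** If all vertices of T but one belonged to T', the two elements would share a facet and [z] would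
    agree. Hence they meet in codimension at least 2. *)
Lemma two_private_vertices T T' : z T <> z T' ->
  exists i j, [/\ i != j, elt T i \notin vset T' & elt T j \notin vset T'].
Proof.
move=> zTT'; have TT' : T != T' by apply/eqP => e; apply: zTT'; rewrite e.
have [i iT'] := vset_neq TT'.
apply: contrapT => H; apply: zTT'.
have FF := fverts_facets (T, i).
suff /(neighboursP meshM _ FF)[i' e] : T' \in neighbours (fverts (T, i)) by apply: z_facet (esym e).
rewrite inE; apply/fintype.subsetP => v /fvertsP[j ->].
apply: contraT => jT'; exfalso; apply: H; exists i, (lift i j); split => //.
exact: neq_lift.
Qed.

(** The intersection lies in lam_i = lam_j = 0, and some nontrivial combination of these two affine
    functions also vanishes at the given point [y]. *)
Lemma separating_poly T T' y : z T <> z T' ->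
  exists P : Poly R d, [/\ P != 0, ev y P = 0,
    forall x, simplex T x -> simplex T' x -> ev x P = 0 &
    forall x x' t, ev ((1 - t) *: x + t *: x') P = (1 - t) * ev x P + t * ev x' P].
Proof.
move=> /two_private_vertices[i [j [ij iT' jT']]].
have [yi0|yi0] := eqVneq (lam (vert T) i y) 0.
  exists (bary (vert T) i); split.
  - exact: (bary_neq0 (vN T)).
  - by rewrite ev_bary.
  - by move=> x xT xT'; rewrite ev_bary (simplexI_lam0 xT xT').
  - by move=> x x' t; rewrite !ev_bary lam_line.
exists (lam (vert T) i y *: bary (vert T) j - lam (vert T) j y *: bary (vert T) i); split.
- apply/eqP => /(congr1 (ev (vert T j))).
  rewrite evB !evZ !ev_bary !(lam_vertex (vN T)) eqxx eq_sym (negPf ij) ev0 mulr1 mulr0 subr0.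
  by move/eqP; rewrite (negPf yi0).
- by rewrite evB !evZ !ev_bary mulrC subrr.
- by move=> x xT xT'; rewrite evB !evZ !ev_bary !(simplexI_lam0 xT xT') // !mulr0 subrr.
- by move=> x x' t; rewrite !evB !evZ !ev_bary !lam_line; ring.
Qed.

Lemma interior_point_near x T (e : R) : 0 < e -> simplex T x ->
  exists y, (forall i, 0 < lam (vert T) i y) /\ forall i, `|y i 0 - x i 0| < e.
Proof.
move=> e0 /(simplexP meshM) xT.
pose b : 'cV[R]_d := \sum_i (d.+1)%:R^-1 *: vert T i.
have lb i : lam (vert T) i b = (d.+1)%:R^-1.
  rewrite (lam_comb (vN T)) //.
  by rewrite sumr_const card_ord -[_ *+ _]mulr_natr mulVf // pnatr_eq0.
pose K := \sum_i `|b i 0 - x i 0|.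
have K0 : 0 <= K by apply: sumr_ge0.
have D0 : 0 < e + K + 1 by rewrite ltr_wpDl // addr_ge0 // ltW.
pose s := e / (e + K + 1).
have s0 : 0 < s by rewrite divr_gt0.
have s1 : s <= 1 by rewrite ler_pdivrMr // mul1r -addrA lerDl addr_ge0.
exists ((1 - s) *: x + s *: b); split=> i.
  rewrite lam_line ltr_wpDl ?mulr_ge0 ?subr_ge0 // lb mulr_gt0 // invr_gt0 ltr0n //.
have -> : ((1 - s) *: x + s *: b) i 0 - x i 0 = s * (b i 0 - x i 0).
  by rewrite !mxE; ring.
rewrite normrM ger0_norm ?ltW // /s mulrAC ltr_pdivrMr // ltr_pM2l //.
apply: (@le_lt_trans _ _ K); first by rewrite /K (bigD1 i) //= lerDl sumr_ge0.
by rewrite addrAC -addrA ltr_pwDl ?lerDr.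
Qed.

Lemma closed_elements (S : set 'I_(ne M)) : closed (\bigcup_(T in S) simplex T).
Proof.
apply: closed_bigcup => [|T _]; first exact: finite_finset.
have -> : simplex T = \bigcap_(i in [set: 'I_d.+1]) (lam (vert T) i @^-1` [set t | 0 <= t]).
  apply/seteqP; split=> x; first by move/(simplexP meshM) => h i _; exact: h.
  by move=> h; apply/(simplexP meshM) => i; exact: h.
apply: closed_bigI => i _; apply: closed_comp; last exact: closed_ge.
by move=> x _; exact: lam_continuous.
Qed.

(* The star of a point of Omega is facet-connected: two elements of different
   value would meet only in faces of codimension >= 2, which a generic segment
   in a ball around the point avoids. *)
Lemma local_constant x T T' : Omega x -> simplex T x -> simplex T' x -> z T = z T'.
Proof.
move=> Ox xT xT'; apply: contrapT => zTT'.
have [e e0 He] := open_box oOmega Ox.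
have [y1 [y1T y1x]] := interior_point_near e0 xT.
have e20 : 0 < e / 2 by rewrite divr_gt0.
have [y2 [y2T y2x]] := interior_point_near e20 xT'.
(* For each pair of elements with different values, an affine function vanishing on their
   intersection and at [y1]. A point where the product over all pairs is nonzero avoids all these
   hyperplanes at once. *)
pose Q (q : 'I_(ne M) * 'I_(ne M)) (P : Poly R d) := P != 0 /\ (z q.1 <> z q.2 ->
  [/\ ev y1 P = 0, forall x, simplex q.1 x -> simplex q.2 x -> ev x P = 0 &
    forall x x' t, ev ((1 - t) *: x + t *: x') P = (1 - t) * ev x P + t * ev x' P]).
have [P PQ] : {P : 'I_(ne M) * 'I_(ne M) -> Poly R d & forall q, Q q (P q)}.
  apply: boolp.choice => q; have [zq|zq] := pselect (z q.1 <> z q.2).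
    by have [P [h1 h2 h3 h4]] := separating_poly y1 zq; exists P.
  by exists 1; split; [exact: oner_neq0|].
have PP0 : \prod_q P q != 0 by apply/prodf_neq0 => q _; case: (PQ q).
pose lm := \big[Num.min/1]_i lam (vert T') i y2.
have lm0 : 0 < lm by apply/bigmin_gtP; split.
have lmi i : lm <= lam (vert T') i y2 by rewrite /lm; apply: bigmin_le_cond.
pose K := grad_bound (vert T').
have K0 : 0 < K by exact: grad_bound_gt0.
(* The first bound keeps [y] in the ball around [x] contained in Omega, the second one keeps it in
   the interior of T'. *)
pose e' := Num.min (e / 2) (lm / (2 * K)).
have e'0 : 0 < e' by rewrite lt_min e20 divr_gt0 // mulr_gt0.
have [y y_near yP] := poly_nonzero_near y2 e'0 PP0.
have yT' i : 0 < lam (vert T') i y.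
  apply: lt_le_trans (lam_lipschitz _ i e'0 y_near).
  rewrite subr_gt0; apply: le_lt_trans (_ : lm / 2 < _); last first.
    by apply: lt_le_trans (lmi i); rewrite ltr_pdivrMr // ltr_pMr // ltr1n.
  rewrite -ler_pdivlMr // -mulrA -invfM ge_min lexx orbT //.
have yx i : `|y i 0 - x i 0| < e.
  rewrite -(subrKA (y2 i 0)) (le_lt_trans (ler_normD _ _)) // [ltRHS](splitr e).
  apply: ler_ltD => //; apply: le_trans (y_near i) _.
  by rewrite ge_min lexx.
pose g (t : R) : 'cV[R]_d := (1 - t) *: y1 + t *: y.
have gO t : 0 <= t <= 1 -> Omega (g t).
  move=> /andP[t0 t1]; apply: He => i.
  have -> : g t i 0 - x i 0 = (1 - t) * (y1 i 0 - x i 0) + t * (y i 0 - x i 0).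
    by rewrite !mxE; ring.
  have h1 := y1x i; have h2 := yx i.
  apply: le_lt_trans (ler_normD _ _) _.
  rewrite !normrM (ger0_norm t0) ger0_norm ?subr_ge0 //.
  have [->|tn0] := eqVneq t 0; first by rewrite subr0 mul1r mul0r addr0.
  have -> : e = (1 - t) * e + t * e by ring.
  apply: ler_ltD; first by apply: ler_wpM2l; rewrite ?subr_ge0 // ltW.
  by rewrite ltr_pM2l // lt_neqAle eq_sym tn0 t0.
pose C (S : set 'I_(ne M)) := [set t : R | (\bigcup_(T0 in S) simplex T0) (g t)].
have gc : continuous g.
  move=> t; apply: cvgD; apply: cvgZl; [apply: cvgB; [exact: cvg_cst|exact: cvg_id]|exact: cvg_id].
have cC S : closed (C S).
  by apply: closed_comp; [move=> t _; exact: gc|exact: closed_elements].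
pose S1 := [set T0 | z T0 = z T]; pose S2 := [set T0 | z T0 <> z T].
have cover t : 0 <= t <= 1 -> C S1 t \/ C S2 t.
  move=> /gO /Omega_cover[T0 T0g].
  by have [h|h] := pselect (z T0 = z T); [left|right]; exists T0.
have disj t : 0 <= t <= 1 -> C S1 t -> C S2 t -> False.
  move=> _ [T1 /= z1 g1] [T2 /= z2 g2].
  have z12 : z T1 <> z T2 by rewrite z1; exact/nesym.
  have [P0 /(_ z12) /= [Py1 PT Pl]] := PQ (T1, T2).
  (* Since P vanishes at [y1], its value at [g t] is t P(y) with P(y) nonzero. So t = 0, but [y1] is
     interior to T and lies in no other element. *)
  have := PT _ g1 g2; rewrite Pl Py1 mulr0 add0r => /eqP; rewrite mulf_eq0 => /orP[/eqP t0|].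
    move: g2; rewrite /g t0 subr0 scale1r scale0r addr0 => /(interior_uniq y1T) TT2.
    by apply: z2; rewrite TT2.
  move: yP; rewrite (bigD1 (T1, T2)) //= evM mulf_eq0 negb_or => /andP[/negPf ->] //.
pose I01 : set R := [set` `[0, 1]].
(* On [0,1] the sets [C S1] and [C S2] are closed, disjoint and cover, so connectedness leaves only
   the one containing 0. *)
have E : I01 `&` C S1 = I01.
  apply: (@segment_connected R 0 1).
  - exists 0; split; first by rewrite /I01 /= in_itv /= lexx ler01.
    exists T => //; rewrite /g subr0 scale1r scale0r addr0.
    by apply/(simplexP meshM) => i; exact: ltW.
  - exists (~` C S2); first by rewrite openC.
    apply/seteqP; split=> t [h1 h2]; split=> //; have h1' := h1; rewrite /I01 /= in_itv /= in h1'.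
      by move=> h3; apply: (disj t).
    by case: (cover t h1').
  - by exists (C S1).
have : (I01 `&` C S1) 1 by rewrite E /I01 /= in_itv /= lexx ler01.
case=> _ [T1 /= z1]; rewrite /g subrr scale0r add0r scale1r => /(interior_uniq yT') T1E.
by apply: zTT'; rewrite -z1 T1E.
Qed.

(** By [local_constant], the elements with value [z T] and the others cover Omega by two relatively
    closed sets that are disjoint there. Every element meets Omega, because its barycentre lies in
    the closure and points near the barycentre stay in the element. *)
Lemma mesh_constant T T' : z T = z T'.
Proof.
have meet T0 : exists2 x, Omega x & simplex T0 x.
  pose b : 'cV[R]_d := \sum_i (d.+1)%:R^-1 *: vert T0 i.
  have lb i : lam (vert T0) i b = (d.+1)%:R^-1.
    rewrite (lam_comb (vN T0)) //.
    by rewrite sumr_const card_ord -[_ *+ _]mulr_natr mulVf // pnatr_eq0.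
  have : closure Omega b.
    case: meshM => _ _ _ -> _; exists T0 => //; apply/(simplexP meshM) => i.
    by rewrite lb invr_ge0.
  pose K := grad_bound (vert T0); have K0 : 0 < K by exact: grad_bound_gt0.
  pose e := (d.+1)%:R^-1 / K.
  have e0 : 0 < e by rewrite divr_gt0 // invr_gt0 ltr0n.
  move=> /(_ (ball b e) (nbhsx_ballx b e e0)) [x [Ox [_ xb]]].
  exists x => //; apply/(simplexP meshM) => i.
  apply: le_trans (lam_lipschitz _ i e0 _); last first.
    by move=> j; rewrite distrC ltW //; exact: (xb j 0).
  by rewrite lb /e divfK ?subrr // lt0r_neq0.
have [x Ox xT] := meet T.
pose CS (S : set 'I_(ne M)) := \bigcup_(T0 in S) simplex T0.
pose S1 := [set T0 | z T0 = z T]; pose S2 := [set T0 | z T0 <> z T].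
have disj y : Omega y -> CS S1 y -> CS S2 y -> False.
  move=> Oy [T1 /= z1 g1] [T2 /= z2 g2].
  by apply: z2; rewrite -z1; apply: local_constant g2 g1.
have E : Omega `&` CS S1 = Omega.
  case: domOmega => _ cO _ _ _; apply: cO.
  - by exists x; split=> //; exists T.
  - exists (~` CS S2); first by rewrite openC; exact: closed_elements.
    apply/seteqP; split=> y /= [h1 h2]; split=> //.
      by move=> h3; apply: (disj y).
    have [T0 yT0] := Omega_cover h1.
    have [h|h] := pselect (z T0 = z T); first by exists T0.
    by exfalso; apply: h2; exists T0.
  - by exists (CS S1) => //; exact: closed_elements.
have [x' Ox' xT'] := meet T'.
have : (Omega `&` CS S1) x' by rewrite E.
case=> _ [T1 /= z1 g1]; rewrite -z1; exact: (local_constant Ox').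
Qed.

End MeshConnected.

(** * Degrees and derivatives of polynomials *)

Section Degree.
Variables (R : realType) (d : nat).
Implicit Types (p q : Poly R d) (k : nat).

Lemma PkP k p : Pk k p <-> forall m, (k < mdeg m)%N -> mcoeff m p = 0.
Proof.
split=> [pk m km|h]; first by apply/eqP; rewrite mcoeff_eq0; apply: msize_mdeg_ge; apply: leq_trans pk _.
rewrite /Pk msizeE; apply/bigmax_leqP_seq => m mp _; rewrite ltnS leqNgt.
by apply/negP => /h/eqP; rewrite mcoeff_eq0 mp.
Qed.

Lemma Pk0 k : Pk k (0 : Poly R d). Proof. by apply/PkP => m _; rewrite mcoeff0. Qed.

Lemma PkD k p q : Pk k p -> Pk k q -> Pk k (p + q).
Proof. by move=> /PkP hp /PkP hq; apply/PkP => m km; rewrite mcoeffD hp // hq // addr0. Qed.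

Lemma PkN k p : Pk k p -> Pk k (- p).
Proof. by move=> /PkP hp; apply/PkP => m km; rewrite mcoeffN hp // oppr0. Qed.

Lemma PkB k p q : Pk k p -> Pk k q -> Pk k (p - q).
Proof. by move=> hp hq; apply: PkD => //; apply: PkN. Qed.

Lemma PkZ k c p : Pk k p -> Pk k (c *: p).
Proof. by move=> /PkP hp; apply/PkP => m km; rewrite mcoeffZ hp // mulr0. Qed.

Lemma Pk_sum k (I : Type) (r : seq I) (P : pred I) (F : I -> Poly R d) :
  (forall i, Pk k (F i)) -> Pk k (\sum_(i <- r | P i) F i).
Proof. by move=> h; apply: big_ind => //; [exact: Pk0|move=> p q; exact: PkD]. Qed.

Lemma Pk_le k l p : (k <= l)%N -> Pk k p -> Pk l p.
Proof. by move=> kl; rewrite /Pk => h; apply: leq_trans h _. Qed.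

Lemma Pk_mul k l p q : Pk k p -> Pk l q -> Pk (k + l) (p * q).
Proof.
rewrite /Pk => hp hq.
have [->|p0] := eqVneq p 0; first by rewrite mul0r; exact: Pk0.
have [->|q0] := eqVneq q 0; first by rewrite mulr0; exact: Pk0.
rewrite msizeM // -ltnS; apply: leq_trans (_ : msize p + msize q <= _)%N.
  by rewrite prednK // addn_gt0 lt0n msize_poly_eq0 p0.
by rewrite -addSn -addnS leq_add.
Qed.

Lemma PkC k c : Pk k (mpolyC d c : Poly R d).
Proof. by rewrite /Pk msizeC; case: (c != 0). Qed.

Lemma PkX i : Pk 1 (mpolyX R (mnm1 i) : Poly R d).
Proof. by rewrite /Pk msizeX mdeg1. Qed.

Lemma pdD i p q : pd i (p + q) = pd i p + pd i q. Proof. exact: mderivD. Qed.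
Lemma pdN i p : pd i (- p) = - pd i p. Proof. exact: mderivN. Qed.
Lemma pdB i p q : pd i (p - q) = pd i p - pd i q. Proof. exact: mderivB. Qed.
Lemma pdM i p q : pd i (p * q) = pd i p * q + p * pd i q. Proof. exact: mderivM. Qed.
Lemma pdZ i c p : pd i (c *: p) = c *: pd i p. Proof. exact: mderivZ. Qed.
Lemma pdC i c : pd i (mpolyC d c : Poly R d) = 0. Proof. exact: mderivC. Qed.
Lemma pd0 i : pd i (0 : Poly R d) = 0. Proof. exact: mderiv0. Qed.
Lemma pdXE i j : pd i (mpolyX R (mnm1 j) : Poly R d) = (i == j)%:R.
Proof.
rewrite /pd mderivX mnm1E eq_sym; case: eqP => [->|_]; last by rewrite scale0r.
have -> : mnm_sub (mnm1 j) (mnm1 j) = mnm0 by apply/mnmP => l; rewrite mnmBE subnn mnm0E.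
by rewrite mpolyX0 scale1r.
Qed.
Lemma pd_sum i (I : Type) (r : seq I) (P : pred I) (F : I -> Poly R d) :
  pd i (\sum_(j <- r | P j) F j) = \sum_(j <- r | P j) pd i (F j).
Proof. exact: raddf_sum. Qed.
Lemma pd_comm i j p : pd i (pd j p) = pd j (pd i p). Proof. exact: mderiv_comm. Qed.

Lemma Pk_pd k i p : Pk k p -> Pk k.-1 (pd i p).
Proof.
move=> /PkP hp; apply/PkP => m km; rewrite mcoeff_deriv hp ?mul0rn //.
by rewrite mdegD mdeg1 addn1; case: k km {hp}.
Qed.

Lemma pd_eq0 i p : Pk 0 p -> pd i p = 0.
Proof.
move=> /PkP hp; apply/mpolyP => m; rewrite mcoeff_deriv hp ?mul0rn ?mcoeff0 //.
by rewrite mdegD mdeg1 addn1.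
Qed.

Lemma grad0_const p : (forall i, pd i p = 0) -> p = mpolyC d (mcoeff mnm0 p).
Proof.
move=> h; apply/mpolyP => m; rewrite mcoeffC.
have [->|m0] := eqVneq m mnm0; first by rewrite mulr1.
rewrite mulr0.
have [i mi] : exists i, m i != 0%N.
  apply/existsP; apply: contraT; rewrite negb_exists => /forallP h'.
  case/eqP: m0; apply/mnmP => i; rewrite mnm0E; apply/eqP.
  by have := h' i; rewrite negbK.
have := congr1 (mcoeff (mnm_sub m (mnm1 i))) (h i).
rewrite mcoeff_deriv submK ?lep1mP // mcoeff0 => /eqP.
by rewrite mulrn_eq0 /= => /eqP.
Qed.

Lemma grad_const_affine p (g : 'I_d -> R) : (forall i, pd i p = mpolyC d (g i)) ->
  forall x y, ev x p - ev y p = \sum_i g i * (x i 0 - y i 0).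
Proof.
move=> h x y.
pose q := p - \sum_i g i *: mpolyX R (mnm1 i).
have q0 i : pd i q = 0.
  rewrite pdB h pd_sum (bigD1 i) //= big1 => [|j ji].
    by rewrite pdZ pdXE eqxx addr0 -alg_mpolyC subrr.
  by rewrite pdZ pdXE eq_sym (negPf ji) scaler0.
have pE : p = mpolyC d (mcoeff mnm0 q) + \sum_i g i *: mpolyX R (mnm1 i).
  by rewrite -(grad0_const q0) /q subrK.
rewrite pE !evD !evC opprD addrACA subrr add0r !ev_sum -sumrB.
by apply: eq_bigr => i _; rewrite !evZ !evX mulrBr.
Qed.

End Degree.

Lemma Pk_bary (R : realType) d (p : 'I_d.+1 -> 'cV[R]_d) i : Pk 1 (bary p i).
Proof.
apply: PkD; first exact: PkC.
by apply: Pk_sum => j; apply: PkZ; exact: PkX.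
Qed.

Lemma avgD (R : realType) n d (p : 'I_n.+1 -> 'cV[R]_d) f g : avg p (f + g) = avg p f + avg p g.
Proof. by rewrite -[f in LHS]scale1r avg_lin mul1r. Qed.

Lemma avgN (R : realType) n d (p : 'I_n.+1 -> 'cV[R]_d) f : avg p (- f) = - avg p f.
Proof. by rewrite -scaleN1r -[_ *: f]addr0 avg_lin avg0 addr0 mulN1r. Qed.

Lemma avg_sum (R : realType) n d (p : 'I_n.+1 -> 'cV[R]_d) (I : Type) (r : seq I) (P : pred I) F :
  avg p (\sum_(i <- r | P i) F i) = \sum_(i <- r | P i) avg p (F i).
Proof. by apply: (big_morph (avg p)); [exact: avgD|exact: avg0]. Qed.

Lemma avg_div_face0 (R : realType) n (p : 'I_n.+2 -> 'cV[R]_n.+1) (v : 'cV[Poly R n.+1]_n.+1) :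
  nondegenerate p ->
  (forall l x, lam p l x = 0 -> \sum_c gradbary p l c 0 * ev x (v c 0) = 0) ->
  avg p (div_poly v) = 0.
Proof.
move=> pN h; rewrite avg_div // big1 ?oppr0 // => a _.
rewrite (@avg_ext _ _ _ _ _ 0) ?avg0 // => l l0 l1.
rewrite ev0 ev_sum -[RHS](h a (\sum_i l i *: p (lift a i))).
  by apply: eq_bigr => c _; rewrite evZ.
rewrite lam_affine // big1 // => j _.
by rewrite (lam_vertex pN) eq_sym (negPf (neq_lift _ _)) mulr0.
Qed.

(** The common last step of the injectivity arguments: each summand is nonnegative on the simplex,
    so each has integral 0 and is the zero polynomial, and its weight can be cancelled. *)
Lemma avg_weighted_squares (R : realType) d (p : 'I_d.+1 -> 'cV[R]_d) (I : finType)
    (b q : I -> Poly R d) : nondegenerate p ->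
  (forall i, b i != 0) ->
  (forall i x, (forall j, 0 <= lam p j x) -> 0 <= ev x (b i)) ->
  avg p (\sum_i b i * q i ^+ 2) = 0 -> forall i, q i = 0.
Proof.
move=> pN b0 bge0 h i.
have ge0 k x : (forall j, 0 <= lam p j x) -> 0 <= ev x (b k * q k ^+ 2).
  by move=> xp; rewrite evM mulr_ge0 ?bge0 // /ev rmorphXn sqr_ge0.
have age0 k : 0 <= avg p (b k * q k ^+ 2).
  apply: avg_ge0 => l l0 l1; apply: ge0 => j.
  by rewrite (lam_comb pN).
have : avg p (b i * q i ^+ 2) = 0.
  by move: h; rewrite avg_sum => /eqP; rewrite psumr_eq0 // => /allP/(_ i (mem_index_enum i))/eqP.
move/(avg_eq0 pN (ge0 i))/eqP; rewrite mulf_eq0 (negPf (b0 i)) /=.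
by rewrite sqrf_eq0 => /eqP.
Qed.

(** * Curl-curl bubbles *)

Section Frob.
Variables (R : realType) (d : nat).
Implicit Types t s : 'M[Poly R d]_d.

Lemma frobDl t t' s : frob (t + t') s = frob t s + frob t' s.
Proof.
rewrite /frob -big_split; apply: eq_bigr => i _ /=; rewrite -big_split; apply: eq_bigr => j _ /=.
by rewrite mxE mulrDl.
Qed.

Lemma frobC t s : frob t s = frob s t.
Proof. by apply: eq_bigr => i _; apply: eq_bigr => j _; rewrite mulrC. Qed.

Lemma frobDr t s s' : frob t (s + s') = frob t s + frob t s'.
Proof. by rewrite frobC frobDl !(frobC t). Qed.

Lemma frobZl c t s : frob (c *: t) s = c * frob t s.
Proof.
rewrite /frob mulr_sumr; apply: eq_bigr => i _ /=; rewrite mulr_sumr; apply: eq_bigr => j _ /=.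
by rewrite mxE mulrA.
Qed.

Lemma frobZr c t s : frob t (c *: s) = c * frob t s.
Proof. by rewrite frobC frobZl frobC. Qed.

Lemma frob_scalar c s : frob c%:M s = c * \tr s.
Proof.
rewrite /frob /mxtrace mulr_sumr; apply: eq_bigr => i _.
rewrite (bigD1 i) //= big1 => [|j ji]; first by rewrite mxE eqxx addr0 mulr1n.
by rewrite mxE eq_sym (negPf ji) mulr0n mul0r.
Qed.

Lemma frob_dev t s : \tr s = 0 -> frob (dev t) s = frob t s.
Proof.
move=> s0; rewrite /dev frobDl -[- _]scaleN1r frobZl frob_scalar s0.
by rewrite !mulr0 addr0.
Qed.

Lemma tr_dev t : (0 < d)%N -> \tr (dev t) = 0.
Proof.
move=> d0; rewrite /dev raddfB /= mxtrace_scalar -scaler_nat scalerA.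
by rewrite mulfV ?scale1r ?subrr // pnatr_eq0 -lt0n.
Qed.

Lemma dev_id t : \tr t = 0 -> dev t = t.
Proof. by move=> t0; rewrite /dev t0 scaler0 raddf0 subr0. Qed.

Lemma devD t s : dev (t + s) = dev t + dev s.
Proof. by rewrite /dev raddfD /= scalerDr raddfD /= opprD addrACA. Qed.

Lemma PkM_dev (k : nat) t : PkM k t -> PkM k (dev t).
Proof.
move=> h i j; rewrite mxE; apply: PkD => //; rewrite !mxE; apply: PkN.
case: eqP => _; last by rewrite mulr0n; exact: Pk0.
rewrite mulr1n; apply: PkZ; apply: Pk_sum => l; exact: h.
Qed.

(** [dev] subtracts a multiple of the identity, whose nt-part is zero. *)
Lemma nt_dev (nn : 'cV[R]_d) x t : dot nn nn = 1 ->
  map_mx (ev x) t *m nn = 0 -> nt nn (map_mx (ev x) (dev t)) = 0.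
Proof.
move=> n1 h.
have -> : map_mx (ev x) (dev t) = map_mx (ev x) t - (ev x (d%:R^-1 *: \tr t))%:M.
  apply/matrixP => i j; rewrite !mxE evB; congr (_ - _).
  by case: eqP => _; rewrite ?mulr1n ?mulr0n ?ev0.
rewrite /nt mulmxBl h sub0r mul_scalar_mx -scaleNr dotZr n1 mulr1 subrr //.
Qed.

End Frob.

Section Curl3.
Variables (R : realType) (p : 'I_4 -> 'cV[R]_3).
Hypothesis pN : nondegenerate p.
Local Notation P3 := (Poly R 3).

Lemma sum3 (V : nmodType) (f : 'I_3 -> V) : \sum_i f i = f 0 + f 1 + f 2.
Proof.
rewrite !big_ord_recl big_ord0 addr0 addrA.
by congr (f _ + f _ + f _); apply: val_inj.
Qed.

Lemma ord3E : (((0 + 1)%R = 1%R :> 'I_3) * ((0 + 2)%R = 2%R :> 'I_3) *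
   ((1 + 1)%R = 2%R :> 'I_3) * ((1 + 2)%R = 0%R :> 'I_3) *
   ((2 + 1)%R = 0%R :> 'I_3) * ((2 + 2)%R = 1%R :> 'I_3))%type.
Proof. by do ![split]; apply: val_inj. Qed.

(** The identity curl y . w = y . curl w + div (y x w). *)
Lemma curl3_ibp (y w : 'cV[P3]_3) :
  \sum_j (pd (j + 1) (y (j + 2) 0) - pd (j + 2) (y (j + 1) 0)) * w j 0 =
  \sum_j y j 0 * (pd (j + 1) (w (j + 2) 0) - pd (j + 2) (w (j + 1) 0)) +
  \sum_j pd j (y (j + 1) 0 * w (j + 2) 0 - y (j + 2) 0 * w (j + 1) 0).
Proof.
rewrite !sum3 !ord3E !pdB !pdM; ring.
Qed.

Lemma frob_curl3 (Y D : 'M[P3]_3) :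
  frob (curl3 Y) D = frob Y (curl3 D) +
  div_poly (\col_j \sum_a (Y a (j + 1) * D a (j + 2) - Y a (j + 2) * D a (j + 1))).
Proof.
rewrite /div_poly.
under [X in _ = _ + X]eq_bigr do rewrite mxE pd_sum.
rewrite exchange_big /= /frob -big_split; apply: eq_bigr => a _ /=.
transitivity (\sum_j (pd (j + 1) ((\col_k Y a k) (j + 2) 0) -
     pd (j + 2) ((\col_k Y a k) (j + 1) 0)) * (\col_k D a k) j 0).
  by apply: eq_bigr => j _; rewrite !mxE.
by rewrite curl3_ibp; congr (_ + _); apply: eq_bigr => j _; rewrite !mxE.
Qed.

Definition bub3 (i : 'I_4) : P3 := bary p (i - 3) * bary p (i - 2) * bary p (i - 1).

(** Modulo 4 the indices i-3, i-2, i-1 are exactly those different from i. *)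
Lemma bub3_factor i l : i != l -> exists z, bub3 i = bary p l * z.
Proof.
move=> il; rewrite /bub3.
have : [|| l == i - 3, l == i - 2 | l == i - 1].
  by move: i l il => [[|[|[|[|]]]] //= ?] [[|[|[|[|]]]] //= ?].
case/or3P => /eqP ->.
- by exists (bary p (i - 2) * bary p (i - 1)); rewrite mulrA.
- by exists (bary p (i - 3) * bary p (i - 1)); rewrite mulrCA mulrA.
- by exists (bary p (i - 3) * bary p (i - 2)); rewrite mulrC.
Qed.

Lemma bub3_neq0 i : bub3 i != 0.
Proof. by rewrite /bub3 !mulf_neq0 // (bary_neq0 pN). Qed.

Lemma bub3_ge0 i x : (forall j, 0 <= lam p j x) -> 0 <= ev x (bub3 i).
Proof. by move=> h; rewrite /bub3 !evM !ev_bary !mulr_ge0. Qed.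

Definition coef3 (W : 'M[P3]_3) a i : P3 := \sum_e W a e * mpolyC 3 (gradbary p i e 0).

Lemma mul_bubble3 (W : 'M[P3]_3) a c :
  (W *m bubble3 p) a c = \sum_i (bub3 i * coef3 W a i) * mpolyC 3 (gradbary p i c 0).
Proof.
rewrite mxE /bubble3; under eq_bigr do rewrite summxE mulr_sumr.
rewrite exchange_big /=; apply: eq_bigr => i _.
rewrite /coef3 mulr_sumr mulr_suml; apply: eq_bigr => e _.
rewrite [X in _ * X]mxE [X in _ * (_ * X)]mxE.
have -> : (gradbary p i *m (gradbary p i)^T) e c = gradbary p i e 0 * gradbary p i c 0.
  by rewrite mxE big_ord1 [X in _ * X]mxE.
rewrite mpolyCM -/(bub3 i); ring.
Qed.

(** B = sum_i b_i g_i g_i^T is a weighted sum of squares: (W B) : W = sum_i b_i |W g_i|^2, with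
    [coef3 W a i] the a-th entry of W g_i. *)
Lemma frob_bubble3 (W : 'M[P3]_3) :
  frob (W *m bubble3 p) W = \sum_ai bub3 ai.2 * coef3 W ai.1 ai.2 ^+ 2.
Proof.
rewrite -(pair_bigA _ (fun a i => bub3 i * coef3 W a i ^+ 2)) /=; apply: eq_bigr => a _.
transitivity (\sum_c \sum_i bub3 i * coef3 W a i * mpolyC 3 (gradbary p i c 0) * W a c).
  by apply: eq_bigr => c _; rewrite mul_bubble3 mulr_suml.
rewrite exchange_big /=; apply: eq_bigr => i _.
rewrite expr2 mulrA {3}/coef3 mulr_sumr; apply: eq_bigr => c _.
by rewrite -mulrA; congr (_ * _); rewrite mulrC.
Qed.

Lemma coef3_eq0 (W : 'M[P3]_3) : (forall a i, coef3 W a i = 0) -> W = 0.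
Proof.
move=> h; apply/matrixP => a c; rewrite [RHS]mxE.
transitivity (\sum_i coef3 W a i * mpolyC 3 (p i c 0)); last first.
  by apply: big1 => i _; rewrite h mul0r.
under eq_bigr do rewrite mulr_suml.
rewrite exchange_big /= (bigD1 c) //= [X in _ = _ + X]big1 => [|e ec].
  under eq_bigr do rewrite -mulrA -mpolyCM.
  by rewrite -mulr_sumr -raddf_sum /= (gradbary_vertex_sum pN) eqxx mpolyC1 mulr1 addr0.
under eq_bigr do rewrite -mulrA -mpolyCM.
by rewrite -mulr_sumr -raddf_sum /= (gradbary_vertex_sum pN) (negPf ec) mpolyC0 mulr0.
Qed.

(* On the face opposite to the l-th vertex only the l-th summand of B survives, and
   its rows are normal to that face. *)
Lemma curl3_bubble3_normal (W : 'M[P3]_3) l x : lam p l x = 0 ->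
  map_mx (ev x) (curl3 (W *m bubble3 p)) *m gradbary p l = 0.
Proof.
move=> lx; apply/matrixP => a b; rewrite (ord1 b) [RHS]mxE mxE.
have pdE j c : ev x (pd j ((W *m bubble3 p) a c)) =
   \sum_i ev x (pd j (bub3 i * coef3 W a i)) * gradbary p i c 0.
  rewrite mul_bubble3 pd_sum ev_sum; apply: eq_bigr => i _.
  by rewrite pdM pdC mulr0 addr0 evM evC.
transitivity (\sum_j (\sum_i (ev x (pd (j + 1) (bub3 i * coef3 W a i)) * gradbary p i (j + 2) 0 -
     ev x (pd (j + 2) (bub3 i * coef3 W a i)) * gradbary p i (j + 1) 0)) * gradbary p l j 0).
  apply: eq_bigr => j _; congr (_ * _); rewrite mxE [curl3 _ _ _]mxE evB !pdE -sumrB.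
  by [].
under eq_bigr do rewrite mulr_suml.
rewrite exchange_big /= big1 // => i _.
(* For i = l the summand is (grad f x g_l) . g_l = 0. For i <> l the function contains lam_l, so its
   gradient on the face is parallel to g_l, and (g_l x g_i) . g_l = 0. *)
have [->|il] := eqVneq i l; first by rewrite sum3 !ord3E; ring.
have [z ->] := bub3_factor il.
have E j : ev x (pd j (bary p l * z * coef3 W a i)) =
   gradbary p l j 0 * ev x (z * coef3 W a i).
  by rewrite -mulrA pdM pd_bary evD !evM evC ev_bary lx mul0r addr0.
under eq_bigr do rewrite !E.
rewrite sum3 !ord3E; ring.
Qed.

(** The boundary term of the integration by parts is g_l . (Y x D) row by row; on face l the rows of
    Y = W B are parallel to g_l, so it vanishes. *)
Lemma avg_curl3_bubble3 (W D : 'M[P3]_3) :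
  avg p (frob (curl3 (W *m bubble3 p)) D) = avg p (frob (W *m bubble3 p) (curl3 D)).
Proof.
rewrite frob_curl3 avgD [X in _ + X]avg_div_face0 ?addr0 // => l x lx.
have YE a c : ev x ((W *m bubble3 p) a c) =
    ev x (bub3 l * coef3 W a l) * gradbary p l c 0.
  rewrite mul_bubble3 ev_sum (bigD1 l) //= big1 ?addr0 => [|i il]; first by rewrite !evM evC.
  by have [z ->] := bub3_factor il; rewrite !evM ev_bary lx !mul0r.
transitivity (\sum_a \sum_c gradbary p l c 0 *
  (ev x (bub3 l * coef3 W a l) * gradbary p l (c + 1) 0 * ev x (D a (c + 2)) -
   ev x (bub3 l * coef3 W a l) * gradbary p l (c + 2) 0 * ev x (D a (c + 1)))).
  rewrite exchange_big /=; apply: eq_bigr => c _; rewrite [X in _ * ev x X]mxE ev_sum mulr_sumr.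
  by apply: eq_bigr => a _; rewrite evB [ev x (_ * D _ _)]evM [in X in _ - X]evM !YE.
rewrite big1 // => a _; rewrite sum3 !ord3E; ring.
Qed.

Lemma curl3_grad_vec (v : 'cV[P3]_3) : curl3 (grad_vec v) = 0.
Proof. by apply/matrixP => i j; rewrite !mxE pd_comm subrr. Qed.

Lemma curl3D (s t : 'M[P3]_3) : curl3 (s + t) = curl3 s + curl3 t.
Proof. by apply/matrixP => i j; rewrite !mxE !pdD; ring. Qed.

Lemma curl3B (s t : 'M[P3]_3) : curl3 (s - t) = curl3 s - curl3 t.
Proof. by apply/matrixP => i j; rewrite !mxE !pdB; ring. Qed.

(** A skew matrix has three free entries, hence nine derivatives. The off-diagonal entries of the
    curl are, up to sign, six of them; the diagonal entries combine the remaining three in pairs. *)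
Lemma curl3_skew_eq0 (g : 'M[P3]_3) : g^T = - g -> curl3 g = 0 ->
  forall c i j, pd c (g i j) = 0.
Proof.
move=> gT g0.
have sk i j : g i j = - g j i.
  by have := congr1 (fun m : 'M[P3]_3 => m j i) gT; rewrite !mxE.
have two0 (q : P3) : q = - q -> q = 0.
  move=> e; have : (2%:R : R) *: q == 0 by rewrite scaler_nat mulr2n {1}e addNr.
  by rewrite mscalerI pnatr_eq0 => /eqP.
have dg i : g i i = 0 by exact: two0.
have W i j := congr1 (fun m : 'M[P3]_3 => m i j) g0.
have W00 := W 0 0; have W01 := W 0 1; have W02 := W 0 2.
have W10 := W 1 0; have W11 := W 1 1; have W12 := W 1 2.
have W20 := W 2 0; have W21 := W 2 1; have W22 := W 2 2.
rewrite !mxE !ord3E ?dg ?pd0 in W00 W01 W02 W10 W11 W12 W20 W21 W22.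
rewrite ?(sk 1 0) ?(sk 2 0) ?(sk 2 1) ?pdN in W00 W01 W02 W10 W11 W12 W20 W21 W22.
(* The combination - W00 - W11 + W22 of the diagonal entries is twice this derivative. *)
have a2 : pd 2 (g 0 1) = 0.
  apply: two0; apply/eqP; rewrite -subr_eq0.
  have -> : pd 2 (g 0 1) - - pd 2 (g 0 1) =
    - (pd 1 (g 0 2) - pd 2 (g 0 1)) - (- pd 2 (g 0 1) - pd 0 (g 1 2)) +
    (- pd 0 (g 1 2) - - pd 1 (g 0 2)) by ring.
  by rewrite W00 W11 W22 !oppr0 !addr0.
have b1 : pd 1 (g 0 2) = 0 by move: W00; rewrite a2 subr0.
have c0 : pd 0 (g 1 2) = 0.
  by move: W11; rewrite a2 oppr0 sub0r => /eqP; rewrite oppr_eq0 => /eqP.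
have a0 : pd 0 (g 0 1) = 0 by move: W02; rewrite subr0.
have a1 : pd 1 (g 0 1) = 0 by move: W12; rewrite sub0r opprK.
have b0 : pd 0 (g 0 2) = 0.
  by move: W01; rewrite sub0r => /eqP; rewrite oppr_eq0 => /eqP.
have b2 : pd 2 (g 0 2) = 0.
  by move: W21; rewrite subr0 => /eqP; rewrite oppr_eq0 => /eqP.
have c1 : pd 1 (g 1 2) = 0 by move: W10; rewrite subr0.
have c2 : pd 2 (g 1 2) = 0 by move: W20; rewrite sub0r opprK.
have all3 (Q : 'I_3 -> Prop) : Q 0 -> Q 1 -> Q 2 -> forall i, Q i.
  move=> q0 q1 q2 [[|[|[|//]]] ip].
  - by have -> : Ordinal ip = 0 by apply: val_inj.
  - by have -> : Ordinal ip = 1 by apply: val_inj.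
  - by have -> : Ordinal ip = 2 by apply: val_inj.
by do 3![apply: (all3)]; rewrite ?(sk 1 0) ?(sk 2 0) ?(sk 2 1) ?dg ?pdN ?pd0
  ?a0 ?a1 ?a2 ?b0 ?b1 ?b2 ?c0 ?c1 ?c2 ?oppr0.
Qed.

End Curl3.

Section Curl2.
Variables (R : realType) (p : 'I_3 -> 'cV[R]_2).
Hypothesis pN : nondegenerate p.
Local Notation P2 := (Poly R 2).

Lemma sum2 (V : nmodType) (f : 'I_2 -> V) : \sum_i f i = f 0 + f 1.
Proof.
rewrite !big_ord_recl big_ord0 addr0.
by congr (f _ + f _); apply: val_inj.
Qed.

Lemma frob_curl2 (w : 'cV[P2]_2) (D : 'M[P2]_2) :
  frob (curl2_vec w) D = \sum_a w a 0 * curl2_mx D a 0 +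
  div_poly (\col_j if j == 0 then - \sum_a w a 0 * D a 1 else \sum_a w a 0 * D a 0).
Proof.
rewrite /frob /div_poly !sum2 !mxE /= ?sum2 ?mxE /= !pdN !pdD !pdM; ring.
Qed.

Lemma bubble2_factor l : exists z, bubble2 p = bary p l * z.
Proof.
rewrite /bubble2.
have : [|| l == 0, l == 1 | l == 2] by case: l => [[|[|[|]]]].
case/or3P => /eqP ->.
- by exists (bary p 1 * bary p 2); rewrite mulrA.
- by exists (bary p 0 * bary p 2); rewrite mulrCA mulrA.
- by exists (bary p 0 * bary p 1); rewrite mulrC.
Qed.

Lemma bubble2_neq0 : bubble2 p != 0.
Proof. by rewrite /bubble2 !mulf_neq0 // (bary_neq0 pN). Qed.

Lemma bubble2_ge0 x : (forall j, 0 <= lam p j x) -> 0 <= ev x (bubble2 p).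
Proof. by move=> h; rewrite /bubble2 !evM !ev_bary !mulr_ge0. Qed.

Lemma curl2_bubble2_normal (w : 'cV[P2]_2) l x : lam p l x = 0 ->
  map_mx (ev x) (curl2_vec (bubble2 p *: w)) *m gradbary p l = 0.
Proof.
move=> lx; apply/matrixP => a b; rewrite (ord1 b) [RHS]mxE mxE sum2.
have [z zE] := bubble2_factor l.
have E j : ev x (pd j ((bubble2 p *: w) a 0)) = gradbary p l j 0 * ev x (z * w a 0).
  have -> : (bubble2 p *: w) a 0 = bubble2 p * w a 0 by rewrite mxE.
  by rewrite zE -mulrA pdM pd_bary evD !evM evC ev_bary lx mul0r addr0.
rewrite ![map_mx _ _ _ _]mxE ![curl2_vec _ _ _]mxE /= evN !E; ring.
Qed.

Lemma avg_curl2_bubble2 (w : 'cV[P2]_2) (D : 'M[P2]_2) :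
  avg p (frob (curl2_vec (bubble2 p *: w)) D) =
  avg p (bubble2 p * \sum_a w a 0 * curl2_mx D a 0).
Proof.
rewrite frob_curl2 avgD [X in _ + X]avg_div_face0 ?addr0 // => [|l x lx].
  by congr avg; rewrite mulr_sumr; apply: eq_bigr => a _; rewrite mxE mulrA.
have [z zE] := bubble2_factor l.
have E a : ev x ((bubble2 p *: w) a 0) = 0.
  by rewrite mxE zE !evM ev_bary lx !mul0r.
rewrite big1 // => c _; rewrite [X in _ * ev x X]mxE.
by case: eqP => _; rewrite ?evN ev_sum big1 ?oppr0 ?mulr0 // => a _; rewrite evM E mul0r.
Qed.

Lemma curl2_grad_vec (v : 'cV[P2]_2) : curl2_mx (grad_vec v) = 0.
Proof. by apply/matrixP => i j; rewrite !mxE pd_comm subrr. Qed.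

Lemma curl2D (s t : 'M[P2]_2) : curl2_mx (s + t) = curl2_mx s + curl2_mx t.
Proof. by apply/matrixP => i j; rewrite !mxE !pdD; ring. Qed.

Lemma curl2_vecD (s t : 'cV[P2]_2) : curl2_vec (s + t) = curl2_vec s + curl2_vec t.
Proof. by apply/matrixP => i j; rewrite !mxE; case: eqP => _; rewrite pdD ?opprD. Qed.

Lemma curl2B (s t : 'M[P2]_2) : curl2_mx (s - t) = curl2_mx s - curl2_mx t.
Proof. by apply/matrixP => i j; rewrite !mxE !pdB; ring. Qed.

Lemma curl2_skew_eq0 (g : 'M[P2]_2) : g^T = - g -> curl2_mx g = 0 ->
  forall c i j, pd c (g i j) = 0.
Proof.
move=> gT g0.
have sk i j : g i j = - g j i.
  by have := congr1 (fun m : 'M[P2]_2 => m j i) gT; rewrite !mxE.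
have two0 (q : P2) : q = - q -> q = 0.
  move=> e; have : (2%:R : R) *: q == 0 by rewrite scaler_nat mulr2n {1}e addNr.
  by rewrite mscalerI pnatr_eq0 => /eqP.
have dg i : g i i = 0 by exact: two0.
have W i := congr1 (fun m : 'cV[P2]_2 => m i 0) g0.
have W0 := W 0; have W1 := W 1.
rewrite !mxE ?dg ?pd0 in W0 W1; rewrite ?(sk 1 0) ?pdN in W0 W1.
have a0 : pd 0 (g 0 1) = 0 by move: W0; rewrite subr0.
have a1 : pd 1 (g 0 1) = 0 by move: W1; rewrite sub0r opprK.
have all2 (Q : 'I_2 -> Prop) : Q 0 -> Q 1 -> forall i, Q i.
  move=> q0 q1 [[|[|//]] ip].
  - by have -> : Ordinal ip = 0 by apply: val_inj.
  - by have -> : Ordinal ip = 1 by apply: val_inj.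
by do 3![apply: (all2)]; rewrite ?(sk 1 0) ?dg ?pdN ?pd0 ?a0 ?a1 ?oppr0.
Qed.

End Curl2.

Section DevCurlCurl.
Variables (R : realType) (n : nat).
Local Notation d := n.+1.
Hypothesis d23 : d = 2%N \/ d = 3%N.
Variable p : 'I_d.+1 -> 'cV[R]_d.
Hypothesis pN : nondegenerate p.
Implicit Types r s : 'M[Poly R d]_d.

Lemma tr_dev_curl_curl r : \tr (dev_curl_curl p r) = 0.
Proof.
move: d23 p r; case: n => [|[|[|m]]] // h q r; last by case: h.
- by case: h.
- exact: tr_dev.
- exact: tr_dev.
Qed.

Lemma dev_curl_curlD r s :
  dev_curl_curl p (r + s) = dev_curl_curl p r + dev_curl_curl p s.
Proof.
move: d23 p r s; case: n => [|[|[|m]]] // h q r s; rewrite /= ?addr0 // -devD; congr dev.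
  by rewrite curl2D scalerDr curl2_vecD.
by rewrite curl3D mulmxDl curl3D.
Qed.

Lemma dev_curl_curl_degree k r : PkM k r -> PkM k.+1 (dev_curl_curl p r).
Proof.
move=> hr.
move: d23 p r hr; case: n => [|[|[|m]]] // h q r hr; [by case: h| | |by case: h].
- apply: PkM_dev => i j.
  have wP a : Pk k.-1 (curl2_mx r a 0) by rewrite mxE; apply: PkB; apply: Pk_pd.
  have bP : Pk 3 (bubble2 q).
    by apply: (@Pk_mul _ _ 2 1); [apply: (@Pk_mul _ _ 1 1)|]; exact: Pk_bary.
  have cP c a : Pk k.+1 (pd c ((bubble2 q *: curl2_mx r) a 0)).
    have -> : (bubble2 q *: curl2_mx r) a 0 = bubble2 q * curl2_mx r a 0 by rewrite mxE.
    (* Two derivatives and a cubic bubble raise the degree by one, but for k = 0 the truncated k - 1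
       would count one too many; there the curl is zero. *)
    case: k hr wP => [|k'] hr wP.
      have -> : curl2_mx r a 0 = 0.
        by rewrite mxE !pd_eq0 ?subrr //; exact: hr.
      by rewrite mulr0 pd0; exact: Pk0.
    have /Pk_pd : Pk (3 + k') (bubble2 q * curl2_mx r a 0) by apply: Pk_mul.
    exact.
  rewrite mxE; case: eqP => _; [exact: cP|apply: PkN; exact: cP].
- apply: PkM_dev => i j.
  have wP a b : Pk k.-1 (curl3 r a b) by rewrite mxE; apply: PkB; apply: Pk_pd.
  have bP a : Pk 3 (bub3 q a).
    by apply: (@Pk_mul _ _ 2 1); [apply: (@Pk_mul _ _ 1 1)|]; exact: Pk_bary.
  have cP c a b : Pk k.+1 (pd c ((curl3 r *m bubble3 q) a b)).
    rewrite mul_bubble3; case: k hr wP => [|k'] hr wP.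
      rewrite big1 ?pd0 => [|l _]; first exact: Pk0.
      rewrite /coef3 big1 ?mulr0 ?mul0r // => e _.
      rewrite [curl3 _ _ _]mxE !pd_eq0 ?subrr ?mul0r //; exact: hr.
    have /Pk_pd : Pk (3 + k') (\sum_i bub3 q i * coef3 q (curl3 r) a i * mpolyC 3 (gradbary q i b 0)).
      apply: Pk_sum => l; rewrite -[(3 + k')%N]addn0; apply: Pk_mul; last exact: PkC.
      apply: Pk_mul => //; apply: Pk_sum => e; rewrite -[k']addn0; apply: Pk_mul; last exact: PkC.
      exact: wP.
    exact.
  by rewrite mxE; apply: PkB; exact: cP.
Qed.

Lemma nt_dev_curl_curl r l x (c : R) : lam p l x = 0 ->
  dot (c *: gradbary p l) (c *: gradbary p l) = 1 ->
  nt (c *: gradbary p l) (map_mx (ev x) (dev_curl_curl p r)) = 0.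
Proof.
move=> + c1; move: d23 p pN r l x c1; case: n => [|[|[|m]]] // h q qN r l x c1 lx; [by case: h| | |by case: h].
- by apply: nt_dev => //; rewrite -scalemxAr curl2_bubble2_normal ?scaler0.
- by apply: nt_dev => //; rewrite -scalemxAr curl3_bubble3_normal ?scaler0.
Qed.

(** The trace condition removes [dev], integration by parts moves the outer curl onto grad v - g,
    and curl grad v = 0. What remains is minus the bubble-weighted square of curl g. *)
Lemma dev_curl_curl_test (v : 'cV[Poly R d]_d) (g : 'M[Poly R d]_d) :
  g^T = - g -> \tr (grad_vec v - g) = 0 ->
  avg p (frob (dev_curl_curl p g) (grad_vec v - g)) = 0 ->
  forall c i j, pd c (g i j) = 0.
Proof.
move: d23 p pN v g; case: n => [|[|[|m]]] // h q qN v g gT tr0; [by case: h| | |by case: h].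
- rewrite /= frob_dev // avg_curl2_bubble2 // curl2B curl2_grad_vec sub0r => h0.
  apply: (curl2_skew_eq0 gT).
  apply/matrixP => a b; rewrite (ord1 b) [RHS]mxE.
  apply: (avg_weighted_squares (b := fun=> bubble2 q) (q := fun a => curl2_mx g a 0) qN).
  + by move=> _; exact: bubble2_neq0.
  + by move=> _ x; exact: bubble2_ge0.
  + move: h0; set s := \sum_a _ => /eqP h0.
    apply/eqP; rewrite -oppr_eq0 -avgN; move: h0; congr (avg q _ == 0).
    rewrite /s mulr_sumr -sumrN; apply: eq_bigr => c _.
    have -> : (- curl2_mx g) c 0 = - curl2_mx g c 0 by rewrite mxE.
    by rewrite mulrN mulrN expr2.
- rewrite /= frob_dev // avg_curl3_bubble3 // curl3B curl3_grad_vec sub0r => h0.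
  apply: (curl3_skew_eq0 gT); apply: (coef3_eq0 qN) => a i.
  apply: (avg_weighted_squares (b := fun ai : 'I_3 * 'I_4 => bub3 q ai.2)
    (q := fun ai => coef3 q (curl3 g) ai.1 ai.2) qN _ _ _ (a, i)).
  + by move=> ?; exact: bub3_neq0.
  + by move=> ? x; exact: bub3_ge0.
  + rewrite -frob_bubble3; apply/eqP; rewrite -oppr_eq0 -avgN.
    by move: h0; rewrite -[- curl3 g]scaleN1r frobZr mulN1r => ->.
Qed.

End DevCurlCurl.

(** * Local test fields *)

Section Local.
Variables (R : realType) (d : nat).
Implicit Types (f g : Poly R d).

Lemma ev_inj f g : (forall x, ev x f = ev x g) -> f = g.
Proof.
move=> fg; apply/eqP; rewrite -subr_eq0; apply/eqP.
apply: (mpoly_eq0_box (z := fun=> 0) (ltr01 : 0 < 1 :> R)) => y _.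
have := fg (\col_i y i); rewrite /ev.
under eq_fun do rewrite mxE.
by rewrite mevalB => ->; rewrite subrr.
Qed.

Variable p : 'I_d.+1 -> 'cV[R]_d.
Hypothesis pN : nondegenerate p.

Lemma bary_sum : \sum_i bary p i = 1.
Proof.
apply: ev_inj => x; rewrite ev_sum /ev meval1 -(lam_sum pN x).
by apply: eq_bigr => i _; rewrite -ev_bary.
Qed.

Lemma bary_sum_vertex c : \sum_i p i c 0 *: bary p i = mpolyX R (mnm1 c).
Proof.
apply: ev_inj => x; rewrite ev_sum evX -{2}(lam_sum_vertex pN x) summxE.
by apply: eq_bigr => i _; rewrite evZ ev_bary mxE mulrC.
Qed.

Lemma gradbary_dot_vertex i j k :
  \sum_c gradbary p i c 0 * (p j c 0 - p k c 0) = (j == i)%:R - (k == i)%:R.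
Proof.
rewrite -!(lam_vertex pN) lamB; apply: eq_bigr => c _; exact: mulrC.
Qed.

(** The field x - p_i of lowest-order Raviart-Thomas type: its normal component vanishes on every
    face through p_i and is constant on the opposite one. *)
Definition conical (i : 'I_d.+1) : 'cV[Poly R d]_d :=
  \col_c (mpolyX R (mnm1 c) - mpolyC d (p i c 0)).

Lemma ev_conical l i x : \sum_c gradbary p l c 0 * ev x (conical i c 0) =
  lam p l x - (i == l)%:R.
Proof.
rewrite -(lam_vertex pN) lamB; apply: eq_bigr => c _.
by rewrite [conical _ _ _]mxE evB evX evC mulrC.
Qed.

Lemma div_conical i : div_poly (conical i) = d%:R.
Proof.
rewrite /div_poly; transitivity (\sum_(c < d) 1 : Poly R d).
  by apply: eq_bigr => c _; rewrite mxE pdB pdC pdXE eqxx subr0.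
by rewrite sumr_const card_ord.
Qed.

Lemma RTk_conical k (a : 'I_d.+1 -> Poly R d) : (forall i, Pk k (a i)) ->
  RTk k (\col_c \sum_i a i * conical i c 0).
Proof.
move=> ak; exists (\col_c - \sum_i p i c 0 *: a i), (\sum_i a i); split.
- by move=> c; rewrite mxE; apply: PkN; apply: Pk_sum => i; exact: PkZ.
- exact: Pk_sum.
- move=> c; rewrite [LHS]mxE [X in _ = X + _]mxE addrC mulr_sumr -sumrB.
  apply: eq_bigr => i _; rewrite mxE mulrBr mulrC; congr (_ - _).
  by rewrite mulrC mul_mpolyC.
Qed.

Definition gradX f : Poly R d := \sum_e mpolyX R (mnm1 e) * pd e f.
Definition grad_at i f : Poly R d := \sum_e p i e 0 *: pd e f.

Definition rt_bubble f : 'cV[Poly R d]_d :=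
  \col_c \sum_i (bary p i * grad_at i f) * conical i c 0.

Lemma RTk_rt_bubble k f : (0 < k)%N -> Pk k f -> RTk k (rt_bubble f).
Proof.
move=> k0 fk; apply: RTk_conical => i; rewrite -(prednK k0) -add1n.
apply: Pk_mul; first exact: Pk_bary.
by apply: Pk_sum => e; apply: PkZ; apply: Pk_pd.
Qed.

Lemma rt_bubble_face f l x : lam p l x = 0 ->
  \sum_c gradbary p l c 0 * ev x (rt_bubble f c 0) = 0.
Proof.
move=> lx.
transitivity (\sum_i ev x (bary p i * grad_at i f) * (lam p l x - (i == l)%:R)).
  under [RHS]eq_bigr do rewrite -ev_conical mulr_sumr.
  rewrite exchange_big /=; apply: eq_bigr => c _.
  rewrite [X in ev x X]mxE ev_sum mulr_sumr; apply: eq_bigr => i _.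
  by rewrite evM mulrCA.
apply: big1 => i _; have [->|il] := eqVneq i l; last by rewrite lx subrr mulr0.
by rewrite evM ev_bary lx mul0r mul0r.
Qed.

(** A variance identity: with weights lam_i, the numbers p_i . grad f have mean x . grad f, so sum_i
    lam_i a_i (m - a_i) = - sum_i lam_i (m - a_i)^2. *)
Lemma grad_rt_bubble f :
  \sum_c pd c f * rt_bubble f c 0 = - \sum_i bary p i * (gradX f - grad_at i f) ^+ 2.
Proof.
have E i : \sum_c pd c f * conical i c 0 = gradX f - grad_at i f.
  rewrite -sumrB; apply: eq_bigr => c _; rewrite mxE mulrBr mulrC; congr (_ - _).
  by rewrite mulrC mul_mpolyC.
have S1 : \sum_i bary p i * grad_at i f = gradX f.
  under eq_bigr do rewrite mulr_sumr.
  rewrite exchange_big /=; apply: eq_bigr => e _.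
  rewrite -bary_sum_vertex mulr_suml; apply: eq_bigr => i _.
  by rewrite -scalerAr -scalerAl.
transitivity (\sum_i bary p i * grad_at i f * (gradX f - grad_at i f)).
  under [RHS]eq_bigr do rewrite -E mulr_sumr.
  rewrite exchange_big /=; apply: eq_bigr => c _.
  by rewrite mxE mulr_sumr; apply: eq_bigr => i _; rewrite mulrCA.
have S2 : \sum_i bary p i * (gradX f - grad_at i f) = 0.
  under eq_bigr do rewrite mulrBr.
  by rewrite sumrB -mulr_suml bary_sum mul1r S1 subrr.
apply/eqP; rewrite -subr_eq0 opprK -big_split /=; apply/eqP.
transitivity (\sum_i gradX f * (bary p i * (gradX f - grad_at i f))).
  by apply: eq_bigr => i _; ring.
by rewrite -mulr_sumr S2 mulr0.
Qed.

End Local.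

(* Integrating by parts, the hypothesis says that [sum_i lam_i (w . (x - x_i))^2] has
   integral 0, where [w = grad f]. *)
Lemma rt_bubble_grad0 (R : realType) n (p : 'I_n.+2 -> 'cV[R]_n.+1) f :
  nondegenerate p ->
  avg p (f * div_poly (rt_bubble p f)) = 0 -> forall c, pd c f = 0.
Proof.
move=> pN h.
have E : f * div_poly (rt_bubble p f) =
   div_poly (\col_c (f * rt_bubble p f c 0)) +
   \sum_i bary p i * (gradX f - grad_at p i f) ^+ 2.
  rewrite -[X in _ = _ + X]opprK -grad_rt_bubble // /div_poly mulr_sumr -sumrB.
  by apply: eq_bigr => c _; rewrite [X in _ = pd c X - _]mxE pdM; ring.
have fz : avg p (div_poly (\col_c (f * rt_bubble p f c 0))) = 0.
  apply: avg_div_face0 => // l x lx.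
  transitivity (ev x f * \sum_c gradbary p l c 0 * ev x (rt_bubble p f c 0)).
    by rewrite mulr_sumr; apply: eq_bigr => c _; rewrite [X in ev x X]mxE evM mulrCA.
  by rewrite rt_bubble_face // mulr0.
rewrite E avgD fz add0r in h.
have z := avg_weighted_squares pN (bary_neq0 pN) _ h.
(* Hence all p_i . grad f coincide, and grad f = sum_i g_i (p_i . grad f) = 0 because the g_i sum to
   0. *)
have gi i : gradX f = grad_at p i f.
  apply/eqP; rewrite -subr_eq0; apply/eqP; apply: z => {i} i x xp.
  by rewrite ev_bary.
move=> c; transitivity (\sum_i gradbary p i c 0 *: grad_at p i f); last first.
  under eq_bigr do rewrite -gi.
  by rewrite -scaler_suml gradbary_sum // scale0r.
under eq_bigr do rewrite scaler_sumr.
rewrite exchange_big /= (bigD1 c) //= [X in _ = _ + X]big1 => [|e ec].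
  under eq_bigr do rewrite scalerA.
  by rewrite -scaler_suml gradbary_vertex_sum // eqxx scale1r addr0.
under eq_bigr do rewrite scalerA.
by rewrite -scaler_suml gradbary_vertex_sum // eq_sym (negPf ec) scale0r.
Qed.

(** * Trace-free test stresses and rigid motions *)

Section Stress.
Variables (R : realType) (d : nat) (p : 'I_d.+1 -> 'cV[R]_d).
Hypothesis pN : nondegenerate p.
Implicit Types D : 'M[Poly R d]_d.

(* Combinations of the matrices g_j (x_j - x_i)^T, j <> i, map g_l to a multiple of
   itself for l <> i, so that their nt-trace vanishes on the faces l <> i. *)
Definition edge_stress (i : 'I_d.+1) (m : 'I_d.+1 -> Poly R d) : 'M[Poly R d]_d :=
  \matrix_(a, b) \sum_j (gradbary p j a 0 * (p j b 0 - p i b 0)) *: m j.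

Lemma tr_edge_stress i m : \tr (edge_stress i m) = \sum_(j | j != i) m j.
Proof.
transitivity (\sum_j ((j == j)%:R - (i == j)%:R : R) *: m j).
  rewrite /mxtrace; under eq_bigr do rewrite mxE.
  rewrite exchange_big /=; apply: eq_bigr => j _.
  by rewrite -scaler_suml gradbary_dot_vertex.
rewrite [RHS]big_mkcond; apply: eq_bigr => j _; rewrite eqxx [i == j]eq_sym.
by case: eqP; rewrite ?subrr ?scale0r ?subr0 ?scale1r.
Qed.

Lemma edge_stress_gradbary i m l x a :
  \sum_b ev x (edge_stress i m a b) * gradbary p l b 0 =
  \sum_j ev x (m j) * gradbary p j a 0 * ((j == l)%:R - (i == l)%:R).
Proof.
under eq_bigr do rewrite [edge_stress _ _ _ _]mxE ev_sum mulr_suml.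
rewrite exchange_big /=; apply: eq_bigr => j _.
rewrite -(gradbary_dot_vertex pN) mulr_sumr; apply: eq_bigr => b _.
rewrite evZ; ring.
Qed.

Lemma edge_stress_eigen i m l x : l != i ->
  map_mx (ev x) (edge_stress i m) *m gradbary p l = ev x (m l) *: gradbary p l.
Proof.
move=> li; apply/matrixP => a c; rewrite (ord1 c) [LHS]mxE.
under eq_bigr do rewrite [map_mx _ _ _ _]mxE.
rewrite edge_stress_gradbary (bigD1 l) //= big1 ?addr0 => [|j jl].
  by rewrite [i == l]eq_sym (negPf li) eqxx subr0 mulr1 [RHS]mxE.
by rewrite [i == l]eq_sym (negPf li) (negPf jl) subr0 mulr0.
Qed.

Lemma edge_stress_apex i m x :
  map_mx (ev x) (edge_stress i m) *m gradbary p i =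
  - \sum_(j | j != i) ev x (m j) *: gradbary p j.
Proof.
apply/matrixP => a c; rewrite (ord1 c) [LHS]mxE.
under eq_bigr do rewrite [map_mx _ _ _ _]mxE.
rewrite edge_stress_gradbary eqxx [RHS]mxE summxE -sumrN [RHS]big_mkcond.
apply: eq_bigr => j _; case: eqP => _ /=; first by rewrite subrr mulr0.
by rewrite sub0r mulrN1 [X in _ = - X]mxE.
Qed.

Lemma PkM_edge_stress k i m : (forall j, Pk k (m j)) -> PkM k (edge_stress i m).
Proof. by move=> mk a b; rewrite mxE; apply: Pk_sum => j; exact: PkZ. Qed.

Definition edge_comp D (i j : 'I_d.+1) : Poly R d :=
  \sum_a \sum_b (gradbary p j a 0 * (p j b 0 - p i b 0)) *: D a b.

Lemma frob_edge_stress i m D : frob (edge_stress i m) D = \sum_j m j * edge_comp D i j.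
Proof.
rewrite /frob; under eq_bigr => a _ do under eq_bigr => b _ do rewrite mxE mulr_suml.
under eq_bigr => a _ do rewrite exchange_big.
rewrite exchange_big /=; apply: eq_bigr => j _.
rewrite mulr_sumr; apply: eq_bigr => a _; rewrite mulr_sumr; apply: eq_bigr => b _.
by rewrite -scalerAl -scalerAr.
Qed.

Lemma edge_comp_diag D i : edge_comp D i i = 0.
Proof. by apply: big1 => a _; apply: big1 => b _; rewrite subrr mulr0 scale0r. Qed.

Lemma edge_comp_sum D i : \sum_j edge_comp D i j = \tr D.
Proof.
rewrite /edge_comp exchange_big /=; apply: eq_bigr => a _.
rewrite exchange_big /= (bigD1 a) //= [X in _ + X]big1 ?addr0 => [|b ba].
  under eq_bigr do rewrite mulrBr.
  by rewrite -scaler_suml sumrB -mulr_suml gradbary_vertex_sum // gradbary_sum // eqxx mul0r subr0 scale1r.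
under eq_bigr do rewrite mulrBr.
rewrite -scaler_suml sumrB -mulr_suml gradbary_vertex_sum // gradbary_sum //.
by rewrite eq_sym (negPf ba) mul0r subr0 scale0r.
Qed.

(** For fixed j, the vector D^T g_j is orthogonal to all x_j - x_i, which span; so D^T g_j = 0 for
    every j, and the g_j span as well. *)
Lemma edge_comp_eq0 D : (forall i j, edge_comp D i j = 0) -> D = 0.
Proof.
move=> h.
pose rho j b : Poly R d := \sum_a gradbary p j a 0 *: D a b.
have r0 i j : \sum_b (p j b 0 - p i b 0) *: rho j b = 0.
  rewrite -[RHS](h i j) /edge_comp exchange_big; apply: eq_bigr => b _ /=.
  by rewrite scaler_sumr; apply: eq_bigr => a _; rewrite scalerA mulrC.
have r00 j b : rho j b = 0.
  transitivity (\sum_i gradbary p i b 0 *: \sum_c p i c 0 *: rho j c).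
    under eq_bigr do rewrite scaler_sumr.
    rewrite exchange_big /= (bigD1 b) //= [X in _ = _ + X]big1 => [|c cb].
      under eq_bigr do rewrite scalerA.
      by rewrite -scaler_suml gradbary_vertex_sum // eqxx scale1r addr0.
    under eq_bigr do rewrite scalerA.
    by rewrite -scaler_suml gradbary_vertex_sum // eq_sym (negPf cb) scale0r.
  transitivity (\sum_i gradbary p i b 0 *: \sum_c p j c 0 *: rho j c).
    apply: eq_bigr => i _; congr (_ *: _); apply/eqP; rewrite eq_sym -subr_eq0 -sumrB.
    by apply/eqP; rewrite -[RHS](r0 i j); apply: eq_bigr => c _; rewrite scalerBl.
  by rewrite -scaler_suml gradbary_sum // scale0r.
apply/matrixP => a b; rewrite [RHS]mxE.
transitivity (\sum_j p j a 0 *: rho j b); last by apply: big1 => j _; rewrite r00 scaler0.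
under eq_bigr do rewrite scaler_sumr.
rewrite exchange_big /= (bigD1 a) //= [X in _ = _ + X]big1 => [|c ca].
  under eq_bigr do rewrite scalerA mulrC.
  by rewrite -scaler_suml gradbary_vertex_sum // eqxx scale1r addr0.
under eq_bigr do rewrite scalerA mulrC.
by rewrite -scaler_suml gradbary_vertex_sum // (negPf ca) scale0r.
Qed.

(** The factor lam_i kills the trace on face i, the only face not covered by the eigenvector
    property. Using the components of D itself as coefficients gives squares when tested with D, and
    trace lam_i tr D. *)
Definition stress_bubble D i := edge_stress i (fun j => bary p i * edge_comp D i j).

Lemma tr_stress_bubble D i : \tr D = 0 -> \tr (stress_bubble D i) = 0.
Proof.
move=> trD; rewrite tr_edge_stress -mulr_sumr.
have := edge_comp_sum D i; rewrite (bigD1 i) //= edge_comp_diag add0r trD => ->.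
by rewrite mulr0.
Qed.

Lemma nt_eigen (nn : 'cV[R]_d) (t : 'M[R]_d) c : dot nn nn = 1 -> t *m nn = c *: nn ->
  nt nn t = 0.
Proof. by move=> n1 tn; rewrite /nt tn dotZr n1 mulr1 subrr. Qed.

Lemma nt_stress_bubble D i l x c : lam p l x = 0 ->
  dot (c *: gradbary p l) (c *: gradbary p l) = 1 ->
  nt (c *: gradbary p l) (map_mx (ev x) (stress_bubble D i)) = 0.
Proof.
move=> lx c1; have [li|li] := eqVneq l i.
  apply: (nt_eigen (c := 0)) => //; rewrite -scalemxAr li edge_stress_apex big1 ?oppr0 ?scaler0 ?scale0r // => j _.
  by rewrite evM ev_bary -li lx mul0r scale0r.
apply: (nt_eigen (c := ev x (bary p i * edge_comp D i l))) => //.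
by rewrite -scalemxAr edge_stress_eigen // !scalerA mulrC.
Qed.

Lemma PkM_stress_bubble k D i : (0 < k)%N -> PkM k.-1 D -> PkM k (stress_bubble D i).
Proof.
move=> k0 Dk; apply: PkM_edge_stress => j; rewrite -(prednK k0) -add1n.
apply: Pk_mul; first exact: Pk_bary.
by apply: Pk_sum => a; apply: Pk_sum => b; apply: PkZ.
Qed.

Lemma stress_bubble_test D :
  (forall i, avg p (frob (stress_bubble D i) D) = 0) -> D = 0.
Proof.
move=> h; apply: edge_comp_eq0 => i j.
have := h i; rewrite frob_edge_stress.
under eq_bigr do rewrite -mulrA -expr2.
move=> hi; apply: (avg_weighted_squares pN _ _ hi j).
- by move=> _; exact: bary_neq0.
- by move=> _ x; rewrite ev_bary.
Qed.

(** The coefficients solve S (k g_i) = W modulo g_i: since S g_i = - sum_{j<>i} m_j g_j, the choice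
    m_j = - x_j . W / k works by sum_j g_j x_j^T = I. Adding the mean of the face vertices makes S
    trace-free and changes S g_i only by a multiple of g_i. *)
Definition facet_stress (i : 'I_d.+1) (k : R) (W : 'cV[Poly R d]_d) : 'M[Poly R d]_d :=
  edge_stress i (fun j => k^-1 *: \sum_c
    (d%:R^-1 * (\sum_(l | l != i) p l c 0) - p j c 0) *: W c 0).

Lemma tr_facet_stress i k W : (0 < d)%N -> \tr (facet_stress i k W) = 0.
Proof.
move=> d0; rewrite tr_edge_stress -scaler_sumr exchange_big /= big1 ?scaler0 // => c _.
rewrite -scaler_suml sumrB sumr_const.
have -> : #|(fun l : 'I_d.+1 => l != i)| = d by rewrite cardC1 card_ord.
rewrite -[X in X - _]mulr_natl mulrA mulfV ?mul1r ?subrr ?scale0r //.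
by rewrite pnatr_eq0 -lt0n.
Qed.

Lemma PkM_facet_stress (m : nat) i k (W : 'cV_d) : (forall c, Pk m (W c 0)) -> PkM m (facet_stress i k W).
Proof.
by move=> Wm; apply: PkM_edge_stress => j; apply: PkZ; apply: Pk_sum => c; apply: PkZ.
Qed.

Lemma nt_facet_stress_other i k W l x c : l != i ->
  dot (c *: gradbary p l) (c *: gradbary p l) = 1 ->
  nt (c *: gradbary p l) (map_mx (ev x) (facet_stress i k W)) = 0.
Proof.
move=> li c1; rewrite /facet_stress; set m := fun j => _.
apply: (nt_eigen (c := ev x (m l))) => //.
by rewrite -scalemxAr edge_stress_eigen // !scalerA mulrC.
Qed.

Lemma nt_facet_stress i k W x : k != 0 ->
  dot (k *: gradbary p i) (k *: gradbary p i) = 1 ->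
  dot (k *: gradbary p i) (map_mx (ev x) W) = 0 ->
  nt (k *: gradbary p i) (map_mx (ev x) (facet_stress i k W)) = map_mx (ev x) W.
Proof.
move=> k0 n1 nW; set nn := k *: _ in n1 nW *.
pose w := map_mx (ev x) W.
pose pbar c := d%:R^-1 * (\sum_(l | l != i) p l c 0).
pose m j := k^-1 * \sum_c (pbar c - p j c 0) * w c 0.
have mE j : ev x (k^-1 *: \sum_c (d%:R^-1 * (\sum_(l | l != i) p l c 0) - p j c 0) *: W c 0) = m j.
  rewrite evZ ev_sum; congr (_ * _); apply: eq_bigr => c _.
  by rewrite evZ /w mxE.
have [b Sn] : exists b, map_mx (ev x) (facet_stress i k W) *m nn = w + b *: nn.
  exists (m i); rewrite /nn -scalemxAr edge_stress_apex.
  under eq_bigr do rewrite mE.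
  have -> : \sum_(j | j != i) m j *: gradbary p j =
     \sum_j m j *: gradbary p j - m i *: gradbary p i.
    by rewrite [in RHS](bigD1 i) //= addrAC subrr add0r.
  rewrite opprB scalerDr scalerA mulrC -scalerA addrC; congr (_ + _).
    apply/matrixP => a z; rewrite (ord1 z) [LHS]mxE [X in k * X]mxE summxE.
    have -> : \sum_j (m j *: gradbary p j) a 0 = - k^-1 * w a 0.
      transitivity (\sum_c (\sum_j k^-1 * ((pbar c - p j c 0) * w c 0) * gradbary p j a 0)).
        rewrite exchange_big /=; apply: eq_bigr => j _.
        by rewrite [LHS]mxE /m mulr_sumr mulr_suml.
      rewrite (bigD1 a) //= [X in _ + X]big1 ?addr0 => [|c ca].
        transitivity (k^-1 * w a 0 * (pbar a * \sum_j gradbary p j a 0 - \sum_j gradbary p j a 0 * p j a 0)).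
          by rewrite mulr_sumr -sumrB mulr_sumr; apply: eq_bigr => j _; ring.
        by rewrite gradbary_sum // gradbary_vertex_sum // eqxx /= ?mulr1n; ring.
      transitivity (k^-1 * w c 0 * (pbar c * \sum_j gradbary p j a 0 - \sum_j gradbary p j a 0 * p j c 0)).
        by rewrite mulr_sumr -sumrB mulr_sumr; apply: eq_bigr => j _; ring.
      by rewrite gradbary_sum // gradbary_vertex_sum // eq_sym (negPf ca) /= ?mulr0n; ring.
    by rewrite -mulNr opprK mulrA mulfV // mul1r.
  by rewrite !scalerA /m mulrA.
have nD y z : dot nn (y + z) = dot nn y + dot nn z by rewrite dotC dotDl !(dotC nn).
by rewrite /nt Sn nD nW add0r dotZr n1 mulr1 addrK.
Qed.

(** An affine field vanishing at the vertices of face i has a gradient of rank at most one, of the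
    form al g_i^T; a skew matrix of this form is zero. *)
Lemma rigid_face_eq0 (i : 'I_d.+1) (v : 'cV[Poly R d]_d) (G : 'M[R]_d) : (0 < d)%N ->
  G^T = - G -> (forall a b, pd b (v a 0) = mpolyC d (G a b)) ->
  (forall j a, j != i -> ev (p j) (v a 0) = 0) -> v = 0.
Proof.
move=> d0 GT dv v0.
have aff a x y : ev x (v a 0) - ev y (v a 0) = \sum_b G a b * (x b 0 - y b 0).
  exact: grad_const_affine.
have [j0 j0i] : exists j : 'I_d.+1, j != i.
  have [->|i0] := eqVneq i ord0; last by exists ord0; rewrite eq_sym.
  by exists ord_max; rewrite -val_eqE /= -lt0n.
pose al a := \sum_b G a b * (p i b 0 - p j0 b 0).
have GE a b : G a b = al a * gradbary p i b 0.
  transitivity (\sum_j gradbary p j b 0 * \sum_c G a c * (p j c 0 - p j0 c 0)); last first.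
    have z0 j : j != i -> gradbary p j b 0 * \sum_c G a c * (p j c 0 - p j0 c 0) = 0.
      by move=> ji; rewrite -aff !v0 // subrr mulr0.
    by rewrite (bigD1 i) //= [X in _ + X = _]big1 // addr0 mulrC.
  under eq_bigr do rewrite mulr_sumr.
  rewrite exchange_big /= (bigD1 b) //= [X in _ = _ + X]big1 => [|c cb].
    transitivity (G a b * (\sum_j gradbary p j b 0 * p j b 0 - (\sum_j gradbary p j b 0) * p j0 b 0)).
      by rewrite gradbary_vertex_sum // gradbary_sum // eqxx /= ?mulr1n; ring.
    by rewrite addr0 mulr_suml -sumrB mulr_sumr; apply: eq_bigr => j _; ring.
  transitivity (G a c * (\sum_j gradbary p j b 0 * p j c 0 - (\sum_j gradbary p j b 0) * p j0 c 0)).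
    by rewrite mulr_suml -sumrB mulr_sumr; apply: eq_bigr => j _; ring.
  by rewrite gradbary_vertex_sum // gradbary_sum // eq_sym (negPf cb) /= ?mulr0n; ring.
have sk a b : G a b = - G b a.
  by have := congr1 (fun m : 'M[R]_d => m b a) GT; rewrite !mxE.
have [b0 gb0] := gradbary_neq0 pN i d0.
have Gd a : G a a = 0.
  by apply/eqP; have /eqP := sk a a; rewrite -addr_eq0 -mulr2n mulrn_eq0.
have alb0 : al b0 = 0.
  by have /eqP := Gd b0; rewrite GE mulf_eq0 (negPf gb0) orbF => /eqP.
have al0 a : al a = 0.
  have /eqP := sk a b0; rewrite !GE alb0 mul0r oppr0 mulf_eq0 (negPf gb0) orbF.
  by move/eqP.
apply/matrixP => a c; rewrite (ord1 c) [RHS]mxE; apply: ev_inj => x.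
rewrite ev0; have := aff a x (p j0); rewrite v0 // subr0 => ->; apply: big1 => b _.
by rewrite GE al0 !mul0r.
Qed.

End Stress.

(** In degree k the divergence of a + x q has coefficients (k + d) q_m, because a contributes only
    lower degrees; so q has degree below k. *)
Lemma RT_div_eq0 (R : realType) d k (v : 'cV[Poly R d]_d) : (0 < d)%N ->
  RTk k v -> div_poly v = 0 -> forall i, Pk k (v i 0).
Proof.
move=> d0 [a [q [ak qk vE]]] dv.
have cXq i m : mcoeff (mnm_add m (mnm1 i)) (mpolyX R (mnm1 i) * q) = mcoeff m q.
  by rewrite mulrC addmC mcoeffMX.
have qk' m : mdeg m = k -> mcoeff m q = 0.
  move=> mk; have := congr1 (mcoeff m) dv; rewrite mcoeff0 /div_poly raddf_sum /=.
  have E i : mcoeff m (pd i (v i 0)) = mcoeff m q *+ (m i).+1.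
    rewrite mcoeff_deriv vE mcoeffD cXq; congr (_ *+ _).
    by move/PkP: (ak i) => ->; rewrite ?add0r // mdegD mdeg1 mk addn1.
  under eq_bigr do rewrite E.
  under eq_bigr do rewrite -mulr_natr.
  rewrite -mulr_sumr -natr_sum => /eqP; rewrite mulf_eq0 pnatr_eq0 => /orP[/eqP//|].
  by rewrite sum_nat_eq0 => /forallP/(_ (Ordinal d0)).
move=> i; apply/PkP => m km; rewrite vE mcoeffD.
move/PkP: (ak i) => -> //; rewrite add0r.
have [mi|mi] := eqVneq (m i) 0%N.
  rewrite mulrC; apply/eqP; rewrite mcoeff_eq0; apply/negP.
  rewrite (perm_mem (msuppMX q (mnm1 i))) => /mapP[m' _ mE].
  by move: mi; rewrite mE mnmDE mnm1E eqxx.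
rewrite -(submK (m' := m) (m := mnm1 i)) ?lep1mP // cXq.
have dm : (mdeg (mnm_sub m (mnm1 i))).+1 = mdeg m.
  by rewrite -[in RHS](submK (m' := m) (m := mnm1 i)) ?lep1mP // mdegD mdeg1 addn1.
have [mk|mk] := eqVneq (mdeg (mnm_sub m (mnm1 i))) k; first exact: qk'.
by move/PkP: qk; apply; rewrite ltn_neqAle eq_sym mk /= -ltnS dm.
Qed.

Lemma avgZ (R : realType) n d (p : 'I_n.+1 -> 'cV[R]_d) c f : avg p (c *: f) = c * avg p f.
Proof. by rewrite -[_ *: f]addr0 avg_lin avg0 addr0. Qed.

(** * Injectivity of the discrete operators *)

Section Global.
Variables (R : realType) (n : nat).
Local Notation d := n.+1.
Variables (M : mesh R d) (Omega : set 'cV[R]_d).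
Hypothesis meshM : is_mesh M Omega.
Implicit Types (T : 'I_(ne M)) (F : {set 'I_(nv M)}).
Local Notation vN := (mesh_nondegenerate meshM).

Lemma vol_mesh_gt0 T : 0 < vol T.
Proof. exact: (vol_gt0 (vN T)). Qed.

Lemma omega_intE (q : 'I_(ne M) -> Poly R d) :
  omega_int q = \sum_T vol T * avg (vert T) (q T).
Proof. by apply: eq_bigr => T _; rewrite elt_intE. Qed.

Lemma omega_int_lin c (q r : 'I_(ne M) -> Poly R d) :
  omega_int (fun T => mpolyC d c * q T + r T) = c * omega_int q + omega_int r.
Proof.
rewrite !omega_intE mulr_sumr -big_split; apply: eq_bigr => T _ /=.
by rewrite mul_mpolyC avg_lin mulrDr mulrCA.
Qed.

Definition single (V : zmodType) T (x : V) : {ffun 'I_(ne M) -> V} :=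
  [ffun T0 => if T0 == T then x else 0].

Lemma single_ind (V : zmodType) T (x : V) (P : V -> Prop) T0 :
  P x -> P 0 -> P (single T x T0).
Proof. by move=> Px P0; rewrite ffunE; case: ifP. Qed.

Lemma single_id (V : zmodType) T (x : V) : single T x T = x.
Proof. by rewrite ffunE eqxx. Qed.

Lemma single_neq (V : zmodType) T (x : V) T0 : T0 != T -> single T x T0 = 0.
Proof. by move=> T0T; rewrite ffunE (negPf T0T). Qed.

Lemma omega_int_single T (f : Poly R d) (q : 'I_(ne M) -> Poly R d) :
  q T = f -> (forall T0, T0 != T -> q T0 = 0) -> omega_int q = vol T * avg (vert T) f.
Proof.
move=> qT q0; rewrite omega_intE (bigD1 T) //= qT big1 ?addr0 // => T0 T0T.
by rewrite q0 // avg0 mulr0.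
Qed.

Lemma omega_int_sq_eq0 (I : finType) (q : 'I_(ne M) -> I -> Poly R d) :
  omega_int (fun T => \sum_i q T i ^+ 2) = 0 -> forall T i, q T i = 0.
Proof.
rewrite omega_intE => /eqP.
have g0 T : 0 <= avg (vert T) (\sum_i q T i ^+ 2).
  apply: avg_ge0 => l _ _; rewrite ev_sum; apply: sumr_ge0 => i _.
  by rewrite /ev rmorphXn sqr_ge0.
rewrite psumr_eq0 => [|T _]; last by rewrite mulr_ge0 // ltW // vol_mesh_gt0.
move=> /allP h T; have := h T (mem_index_enum T).
rewrite /= mulf_eq0 gt_eqF ?vol_mesh_gt0 //= => /eqP h0.
apply: (avg_weighted_squares (b := fun=> 1) (vN T)).
- by move=> _; exact: oner_neq0.
- by move=> _ x _; rewrite /ev meval1.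
- by rewrite -[RHS]h0; congr avg; apply: eq_bigr => i _; rewrite mul1r.
Qed.

Lemma facet_lam0 T i F x : fverts (T, i) = F -> facet F x -> lam (vert T) i x = 0.
Proof. by move=> <- /(facetP meshM)[]. Qed.

Lemma jump_eq0 (V : zmodType) F (z : 'I_(ne M) -> V) : F \in facets M ->
  (forall T i, fverts (T, i) = F -> z T = 0) -> jump F z = 0.
Proof.
move=> FF h; rewrite /jump (h _ _ (ori_fverts meshM FF)).
by case: (minusP meshM FF) => [T i _ /h ->|]; rewrite subr0.
Qed.

Lemma jump_const (V : zmodType) F (z : 'I_(ne M) -> V) w : F \in facets M -> minus F != None ->
  (forall T i, fverts (T, i) = F -> z T = w) -> jump F z = 0.
Proof.
move=> FF mF h; rewrite /jump (h _ _ (ori_fverts meshM FF)).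
by case: (minusP meshM FF) mF => [T i _ /h ->|//]; rewrite subrr.
Qed.

Lemma dot_normal F T i k (v : 'cV[Poly R d]_d) x : normal F = k *: gradbary (vert T) i ->
  dot (map_mx (ev x) v) (normal F) = k * \sum_c gradbary (vert T) i c 0 * ev x (v c 0).
Proof.
move=> ->; rewrite dotZr dotE; congr (_ * _); apply: eq_bigr => c _.
by rewrite mxE mulrC.
Qed.

Lemma RTk0 k : RTk k (0 : 'cV[Poly R d]_d).
Proof.
exists 0, 0; split=> [i||i]; rewrite ?mxE; [exact: Pk0|exact: Pk0|].
by rewrite mulr0 addr0.
Qed.

Lemma V_h_local k (v : vec_field M) : (forall T, RTk k (v T)) ->
  (forall T l x, lam (vert T) l x = 0 ->
     \sum_c gradbary (vert T) l c 0 * ev x (v T c 0) = 0) ->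
  V_h k v.
Proof.
move=> vk v0; split=> // F FF x Fx; apply: jump_eq0 => // T i TF.
have [c c0 nE] := normal_gradbary meshM FF TF.
by rewrite (dot_normal _ _ nE) v0 ?mulr0 //; apply: facet_lam0 TF Fx.
Qed.

Lemma W_h0 k : W_h k (0 : mx_field M).
Proof.
move=> T; rewrite ffunE; split; last by rewrite trmx0 oppr0.
by move=> i j; rewrite mxE; exact: Pk0.
Qed.

Lemma V_h_div_eq0 k (v : vec_field M) : V_h k v -> omega_int (fun T => div_poly (v T)) = 0.
Proof.
move=> [_ vj]; rewrite omega_intE.
by apply: (sum_div_eq0 meshM (v := fun T => v T)) => F FF x Fx; exact: vj.
Qed.

Lemma avg1_gt0 T : 0 < avg (vert T) (1 : Poly R d).
Proof.
rewrite lt_neqAle avg_ge0 => [|l _ _]; last by rewrite /ev meval1.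
rewrite andbT eq_sym; apply/eqP => /(avg_eq0 (vN T)) h.
have : 1 = 0 :> Poly R d by apply: h => x _; rewrite /ev meval1.
by move/eqP; rewrite oner_eq0.
Qed.

Lemma RTk_conical1 k T i c : RTk k (mpolyC d c *: conical (vert T) i).
Proof.
exists (\col_e mpolyC d (- c * vert T i e 0)), (mpolyC d c); split.
- by move=> e; rewrite mxE; exact: PkC.
- exact: PkC.
- move=> e; rewrite !mxE mpolyCM mpolyCN; ring.
Qed.

Lemma avg_div_conical T i c :
  avg (vert T) (div_poly (mpolyC d c *: conical (vert T) i)) = (c * d%:R) * avg (vert T) 1.
Proof.
have -> : div_poly (mpolyC d c *: conical (vert T) i) = (c * d%:R) *: 1.
  transitivity (mpolyC d c * div_poly (conical (vert T) i)).
    rewrite /div_poly mulr_sumr; apply: eq_bigr => e _.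
    by rewrite [X in pd e X]mxE pdM pdC mul0r add0r.
  by rewrite div_conical mul_mpolyC -[d%:R]scaler_nat scalerA.
exact: avgZ.
Qed.

(** The lowest-order Raviart-Thomas function of the facet: x - x_i on T and r^-1 (x - x_i') on T',
    where r is the ratio of the two gradients, so that both normal components on the facet are
    equal. *)
Lemma facet_fields_compatible k T i T' i' : T != T' -> fverts (T, i) = fverts (T', i') ->
  exists v : vec_field M, [/\ V_h k v,
    forall T0, T0 != T -> T0 != T' -> v T0 = 0 &
    exists c c', [/\ c != 0, v T = mpolyC d c *: conical (vert T) i &
                     v T' = mpolyC d c' *: conical (vert T') i']].
Proof.
move=> TT' e; set r := lam (vert T) i (vert T' i').
have r0 : r < 0 by apply: (lam_opposite meshM).
pose v : vec_field M := [ffun T0 => if T0 == T then mpolyC d 1 *: conical (vert T) i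
  else if T0 == T' then mpolyC d r^-1 *: conical (vert T') i' else 0].
have vT : v T = mpolyC d 1 *: conical (vert T) i by rewrite ffunE eqxx.
have vT' : v T' = mpolyC d r^-1 *: conical (vert T') i'.
  by rewrite ffunE eqxx eq_sym (negPf TT').
exists v; split; last by exists 1, r^-1; split=> //; exact: oner_neq0.
  2: by move=> T0 T0T T0T'; rewrite ffunE (negPf T0T) (negPf T0T').
split=> [T0|F FF x Fx].
  by rewrite ffunE; do 2?[case: ifP => _]; [exact: RTk_conical1|exact: RTk_conical1|exact: RTk0].
have cE T0 i0 l c : \sum_e gradbary (vert T0) l e 0 * ev x ((mpolyC d c *: conical (vert T0) i0) e 0) =
    c * (lam (vert T0) l x - (i0 == l)%:R).
  rewrite -(ev_conical (vN T0)) mulr_sumr; apply: eq_bigr => a _.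
  by rewrite [X in ev x X]mxE evM evC mulrCA.
have [FE|FN] := eqVneq F (fverts (T, i)).
  have FE' : F = fverts (T', i') by rewrite FE.
  have [k0 k00 nE] := normal_gradbary meshM FF (esym FE).
  have mF : minus F != None.
    case: (minusP meshM FF) => // h; move: TT'.
    by rewrite (h _ _ (esym FE)) (h _ _ (esym FE')) eqxx.
  apply: (@jump_const _ _ _ (- k0)) => // T0 i0 T0F.
  have vTx : dot (map_mx (ev x) (v T)) (normal F) = - k0.
    rewrite (dot_normal _ _ nE) vT cE (facet_lam0 (esym FE) Fx) eqxx.
    by rewrite sub0r mulrN1 mulrN mulr1.
  have [->//|T0T] := eqVneq T0 T.
  have -> : T0 = T'.
    by apply: (@shared_facet_uniq _ _ _ _ meshM T i T0 i0 T' i'); rewrite ?T0F // eq_sym.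
  have nE' : normal F = (k0 * r) *: gradbary (vert T') i'.
    rewrite nE -scalerA; congr (_ *: _); apply/matrixP => a b.
    by rewrite (ord1 b) (gradbary_ratio meshM e) [RHS]mxE.
  rewrite (dot_normal _ _ nE') vT' cE (facet_lam0 (esym FE') Fx) eqxx sub0r mulrN1.
  by rewrite mulrN -mulrA mulfV ?mulr1 // ltr0_neq0.
apply: jump_eq0 => // T0 i0 T0F.
have [k0 k00 nE] := normal_gradbary meshM FF T0F.
rewrite (dot_normal _ _ nE).
have [T0T|T0T] := eqVneq T0 T.
  rewrite T0T in T0F nE *; rewrite vT cE (facet_lam0 T0F Fx).
  have -> : (i == i0) = false by apply/negP => /eqP ii; case/eqP: FN; rewrite ii.
  by rewrite subrr !mulr0.
have [T0T'|T0T'] := eqVneq T0 T'.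
  rewrite T0T' in T0F nE *; rewrite vT' cE (facet_lam0 T0F Fx).
  have -> : (i' == i0) = false by apply/negP => /eqP ii; case/eqP: FN; rewrite e ii.
  by rewrite subrr !mulr0.
rewrite ffunE (negPf T0T) (negPf T0T') big1 ?mulr0 // => c _.
by rewrite [X in ev x X]mxE ev0 mulr0.
Qed.

Hypothesis domOmega : polyhedral_domain Omega.

Lemma b1_inj k (q : sc_field M) : (0 < k)%N -> Q_h k q ->
  (forall u : vec_field M * mx_field M, U_h k u -> form_b1 u q = 0) -> q = 0.
Proof.
move=> k0 [qk q0] h.
have gq T c : pd c (q T : Poly R d) = 0.
  pose v : vec_field M := single T (rt_bubble (vert T) (q T)).
  have Uv : U_h k (v, 0 : mx_field M).
    split; last exact: W_h0.
    apply: V_h_local => [T0|T0 l x].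
      by apply: (@single_ind _ T _ (RTk k)); [exact: RTk_rt_bubble|exact: RTk0].
    have [->|T0T] := eqVneq T0 T => lx; first by rewrite /= single_id; exact: (rt_bubble_face (vN T)).
    by apply: big1 => a _; rewrite /= single_neq // [X in ev x X]mxE ev0 mulr0.
  have := h _ Uv; rewrite /form_b1 (omega_int_single (T := T) (f := (q T : Poly R d) * div_poly (rt_bubble (vert T) (q T)))) /=.
  - move/eqP; rewrite mulf_eq0 gt_eqF ?vol_mesh_gt0 //= => /eqP z.
    exact: (rt_bubble_grad0 (vN T) z).
  - by rewrite ffunE eqxx.
  - move=> T0 T0T; rewrite ffunE (negPf T0T) /div_poly big1 ?mulr0 // => a _.
    by rewrite mxE pd0.
pose cq T := mcoeff mnm0 (q T : Poly R d).
have qE T : q T = mpolyC d (cq T) :> Poly R d by apply: grad0_const => c; exact: gq.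
have cqc T i T' i' : fverts (T, i) = fverts (T', i') -> cq T = cq T'.
  move=> e; have [->//|TT'] := eqVneq T T'.
  have [v [Vv v0 [c [c' [c0 vT vT']]]]] := facet_fields_compatible k TT' e.
  have Uv : U_h k (v, 0 : mx_field M) by split=> //; exact: W_h0.
  have two (w : 'I_(ne M) -> Poly R d) : omega_int (fun T0 => w T0 * div_poly (v T0)) =
     vol T * avg (vert T) (w T * div_poly (v T)) + vol T' * avg (vert T') (w T' * div_poly (v T')).
    rewrite omega_intE (bigD1 T) //= (bigD1 T') /=; last by rewrite eq_sym.
    rewrite [X in _ + (_ + X)]big1 ?addr0 // => T0 /andP[T0T T0T'].
    rewrite v0 // /div_poly big1 ?mulr0 ?avg0 ?mulr0 // => a _.
    by rewrite mxE pd0.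
  have h1 := h _ Uv; rewrite /form_b1 two !qE !mul_mpolyC !avgZ vT vT' !avg_div_conical in h1.
  have h2 := V_h_div_eq0 Vv.
  have := two (fun=> 1); rewrite !mul1r vT vT' !avg_div_conical => h3.
  have {}h3 : vol T * (c * d%:R * avg (vert T) 1) + vol T' * (c' * d%:R * avg (vert T') 1) = 0.
    rewrite -h3 -[RHS]h2 !omega_intE; apply: eq_bigr => T0 _; by rewrite mul1r.
  (* The two integrals of div v are opposite, so orthogonality of q to div v leaves the difference
     of the constants times a nonzero factor. *)
  have : (cq T - cq T') * (vol T * (c * d%:R * avg (vert T) 1)) = 0.
    transitivity (0 - cq T' * 0 : R); last by rewrite mulr0 subrr.
    by rewrite -[X in _ = X - _]h1 -[X in _ = _ - _ * X]h3; ring.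
  move/eqP; rewrite !mulf_eq0 (negPf c0) (gt_eqF (vol_mesh_gt0 T)) (gt_eqF (avg1_gt0 T)).
  by rewrite pnatr_eq0 /= !orbF subr_eq0 => /eqP.
have cst := mesh_constant meshM domOmega cqc.
have [T1] := mesh_inhabited meshM domOmega.
have c0 : cq T1 = 0.
  move: q0; rewrite omega_intE.
  under eq_bigr do rewrite qE (cst _ T1) -[mpolyC _ _]mulr1 mul_mpolyC avgZ mulrCA.
  rewrite -mulr_sumr => /eqP; rewrite mulf_eq0 => /orP[/eqP//|].
  rewrite (bigD1 T1) //= gt_eqF // ltr_pwDl ?mulr_gt0 ?vol_mesh_gt0 ?avg1_gt0 //.
  by apply: sumr_ge0 => T _; rewrite mulr_ge0 // ltW ?vol_mesh_gt0 ?avg1_gt0.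
by apply/ffunP => T; rewrite qE (cst _ T1) c0 mpolyC0 ffunE.
Qed.

(** Without boundary facets the field x would have no jumps at all, so the integral of its
    divergence d would be 0. *)
Lemma boundary_facet : exists2 F, F \in facets M & minus F = None.
Proof.
apply: contrapT => H.
have mF F : F \in facets M -> minus F != None.
  by move=> FF; apply/eqP => m0; apply: H; exists F.
have [T1] := mesh_inhabited meshM domOmega.
have := sum_div_eq0 meshM (v := fun=> \col_c mpolyX R (mnm1 c)).
have -> : div_poly (\col_c mpolyX R (mnm1 c)) = d%:R *: 1 :> Poly R d.
  rewrite /div_poly scaler_nat -[X in _ *+ X]card_ord -sumr_const.
  by apply: eq_bigr => c _; rewrite mxE pdXE eqxx.
have -> : \sum_(T < ne M) vol T * avg (vert T) (d%:R *: (1 : Poly R d)) =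
   d%:R * \sum_(T < ne M) vol T * avg (vert T) 1.
  by rewrite mulr_sumr; apply: eq_bigr => T _; rewrite avgZ mulrCA.
move=> h; have /eqP : d%:R * \sum_(T < ne M) vol T * avg (vert T) (1 : Poly R d) = 0.
  apply: h => F FF x Fx.
  by apply: (@jump_const _ _ _ (dot (map_mx (ev x) (\col_c mpolyX R (mnm1 c))) (normal F))) => //; exact: mF.
rewrite mulf_eq0 pnatr_eq0 /= (bigD1 T1) //= gt_eqF // ltr_pwDl ?mulr_gt0 ?vol_mesh_gt0 ?avg1_gt0 //.
by apply: sumr_ge0 => T _; rewrite mulr_ge0 // ltW ?vol_mesh_gt0 ?avg1_gt0.
Qed.

End Global.

(** * Projections onto lower degree and Gram determinants of facets *)

Section Projection.
Variables (R : realType) (n d : nat).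
Implicit Types f g s : Poly R d.

(** [avg_eq0_interior] includes vertex 0, since only that coordinate has to be positive; a
    transposition brings vertex j there. *)
Lemma avg_eq0_vertex (p : 'I_n.+1 -> 'cV[R]_d) f :
  (forall l, (forall i, 0 <= l i) -> \sum_i l i = 1 -> 0 <= ev (\sum_i l i *: p i) f) ->
  avg p f = 0 -> forall j, ev (p j) f = 0.
Proof.
move=> f0 I0 j; pose s : {perm 'I_n.+1} := tperm ord0 j.
pose l (i : 'I_n.+1) : R := (i == ord0)%:R.
have <- : \sum_i l i *: p (s i) = p j.
  rewrite (bigD1 ord0) //= big1 => [|i /negPf i0]; last by rewrite /l i0 scale0r.
  by rewrite /l eqxx scale1r addr0 tpermL.
have l1 : \sum_i l i = 1.
  by rewrite (bigD1 ord0) //= big1 => [|i /negPf i0]; rewrite /l ?i0 // eqxx addr0.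
apply: avg_eq0_interior => //.
- move=> m m0 m1; have -> : \sum_i m i *: p (s i) = \sum_i m ((s^-1)%g i) *: p i.
    by rewrite [RHS](reindex_inj (@perm_inj _ s)); apply: eq_bigr => i _; rewrite permK.
  by apply: f0 => //; rewrite -m1 [RHS](reindex_inj (@perm_inj _ (s^-1)%g)).
- by rewrite -[RHS]I0 (avg_perm s).
Qed.

End Projection.

Section L2Projection.
Variables (R : realType) (d : nat) (p : 'I_d.+1 -> 'cV[R]_d).
Hypothesis pN : nondegenerate p.
Implicit Types f g : Poly R d.

(* The Gram system is solvable since the kernel of the Gram matrix annihilates
   the right-hand side. *)
Lemma L2_projection l f : exists g, Pk l g /\ forall s, Pk l s -> avg p ((f - g) * s) = 0.
Proof.
pose I := bmultinom d l.+1; pose e (m : I) : Poly R d := mpolyX R (bmnm m).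
pose N := #|{: I}|; pose ei (i : 'I_N) := e (enum_val i).
pose G : 'M[R]_N := \matrix_(i, j) avg p (ei i * ei j).
pose b : 'rV[R]_N := \row_j avg p (f * ei j).
have sub : (b <= G)%MS.
  rewrite submxE; apply/eqP/matrixP => a j; rewrite [RHS]mxE (ord1 a).
  pose K := cokermx G; pose z := \sum_i K i j *: ei i.
  have bz (h : Poly R d) : avg p (h * z) = \sum_i avg p (h * ei i) * K i j.
    rewrite /z mulr_sumr avg_sum; apply: eq_bigr => i _.
    by rewrite -scalerAr avgZ mulrC.
  have ez i : avg p (ei i * z) = 0.
    have := congr1 (fun X : 'M[R]_N => X i j) (mulmx_coker G); rewrite !mxE => <-.
    by rewrite bz; apply: eq_bigr => i' _; rewrite [G _ _]mxE.
  have z0 : z = 0.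
    have zz : avg p (\sum_(i < 1) 1 * z ^+ 2) = 0.
      rewrite big_ord1 mul1r expr2 {1}/z mulr_suml avg_sum big1 // => i _.
      by rewrite -scalerAl avgZ ez mulr0.
    apply: (avg_weighted_squares (b := fun=> 1) pN _ _ zz ord0).
      by move=> _; exact: oner_neq0.
    by move=> _ x _; rewrite /ev meval1.
  rewrite mxE; transitivity (avg p (f * z)); last by rewrite z0 mulr0 avg0.
  by rewrite bz; apply: eq_bigr => i _; rewrite [b _ _]mxE.
have /submxP[c cG] := sub.
pose g := \sum_i c 0 i *: ei i.
have eP m : Pk l (e m : Poly R d) by rewrite /Pk msizeX; exact: bmdeg.
exists g; split; first by apply: Pk_sum => i; apply: PkZ; exact: eP.
have ge j : avg p ((f - g) * ei j) = 0.
  rewrite mulrBl avgD avgN; apply/eqP; rewrite subr_eq0; apply/eqP.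
  have := congr1 (fun X : 'rV[R]_N => X 0 j) cG; rewrite !mxE => ->.
  rewrite /g mulr_suml avg_sum; apply: eq_bigr => i _.
  by rewrite -scalerAl avgZ mxE.
move=> s sl; rewrite (mpolywE sl) mulr_sumr avg_sum big1 // => m _.
by rewrite -scalerAr avgZ -[m]enum_rankK -/(e _) (ge (enum_rank m)) mulr0.
Qed.

Lemma skew_projection l (g : 'M[Poly R d]_d) : g^T = - g ->
  exists2 g0 : 'M[Poly R d]_d, PkK l g0 & forall s, PkM l s -> avg p (frob (g - g0) s) = 0.
Proof.
move=> gT.
have [h hP] := choice (fun ij : 'I_d * 'I_d => L2_projection l (g ij.1 ij.2)).
(* The entrywise projections come from an existence statement, so skewness is enforced by
   antisymmetrizing. *)
pose g0 : 'M[Poly R d]_d := \matrix_(i, j) (2^-1 *: (h (i, j) - h (j, i))).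
exists g0.
  split; first by move=> i j; rewrite mxE; apply: PkZ; apply: PkB; exact: (hP (_, _)).1.
  by apply/matrixP => i j; rewrite !mxE -scalerN opprB.
move=> s sl; rewrite /frob avg_sum big1 // => i _; rewrite avg_sum big1 // => j _.
have gji : g j i = - g i j.
  by have := congr1 (fun X : 'M[Poly R d]_d => X i j) gT; rewrite !mxE.
have -> : (g - g0) i j = 2^-1 *: ((g i j - h (i, j)) - (g j i - h (j, i))).
  rewrite [LHS]mxE [X in _ + X = _]mxE [X in _ - X = _]mxE gji.
  have {1}-> : g i j = 2^-1 *: (g i j + g i j).
    rewrite scalerDr -scalerDl (_ : 2^-1 + 2^-1 = 1 :> R) ?scale1r //; lra.
  rewrite -scalerBr; congr (_ *: _); ring.
rewrite -scalerAl avgZ mulrBl avgD avgN.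
have [_ h1] := hP (i, j); have [_ h2] := hP (j, i).
by rewrite h1 // h2 // subrr mulr0.
Qed.

End L2Projection.

Section FaceGram.
Variables (R : realType) (n : nat) (p : 'I_n.+2 -> 'cV[R]_n.+1).
Hypothesis pN : nondegenerate p.
Variable i : 'I_n.+2.
Local Notation J := (edge_mx (fun j : 'I_n.+1 => p (lift i j))).

(* Append the normal direction to [J] to get a square matrix. *)
Lemma face_gram_gt0 : 0 < \det (J^T *m J).
Proof.
pose g := gradbary p i.
have gg0 : 0 < dot g g.
  by have [b gb] := gradbary_neq0 pN i (ltn0Sn n); exact: (dot_gt0 gb).
have gJ : g^T *m J = 0.
  apply/matrixP => a j; rewrite [LHS]mxE [RHS]mxE.
  have := gradbary_dot_vertex pN i (lift i (lift ord0 j)) (lift i ord0).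
  rewrite ![_ == i]eq_sym !(negPf (neq_lift _ _)) subrr => E0; rewrite -[RHS]E0.
  by apply: eq_bigr => c _; rewrite (ord1 a) [X in X * _]mxE [X in _ * X]mxE [X in _ * X]mxE [X in _ * (_ + X)]mxE.
have Jg : J^T *m g = 0 by rewrite -[g]trmxK -trmx_mul gJ trmx0.
pose B : 'M[R]_(n.+1, 1 + n) := row_mx g J.
have BB : B^T *m B = block_mx (g^T *m g) 0 0 (J^T *m J).
  by rewrite /B tr_row_mx mul_col_row gJ Jg.
have E : \det B ^+ 2 = dot g g * \det (J^T *m J).
  have := congr1 determinant BB; rewrite det_mulmx det_tr -expr2 => ->.
  by rewrite det_ublock [in LHS]det_mx11.
have ge0 : 0 <= \det (J^T *m J) by rewrite -(pmulr_rge0 _ gg0) -E sqr_ge0.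
rewrite lt_neqAle ge0 andbT eq_sym; apply/det0P => -[u u0 uJ].
case/eqP: u0.
have JJ0 : dot (J *m u^T) (J *m u^T) = 0.
  by rewrite /dot trmx_mul trmxK -mulmxA [J^T *m _]mulmxA [_ *m (_ *m u^T)]mulmxA uJ mul0mx mxE.
have Ju : J *m u^T = 0.
  apply/matrixP => a b; rewrite [RHS]mxE (ord1 b); apply/eqP; apply: contraT => Ja.
  by have := dot_gt0 Ja; rewrite JJ0 ltxx.
apply/matrixP => a j; rewrite (ord1 a) [RHS]mxE.
(* The gradient belonging to the far end of edge j is dual to the edges of the face, so pairing it
   with J u returns the coordinate u_j. *)
transitivity (\sum_c gradbary p (lift i (lift ord0 j)) c 0 * (J *m u^T) c 0); last first.
  by rewrite Ju big1 // => c _; rewrite [X in _ * X]mxE mulr0.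
under eq_bigr do rewrite [X in _ * X]mxE mulr_sumr.
rewrite exchange_big /=.
transitivity (\sum_k u 0 k * ((k == j)%:R - 0)).
  rewrite (bigD1 j) //= big1 ?addr0 ?eqxx ?subr0 ?mulr1 // => k /negPf ->.
  by rewrite subrr mulr0.
apply: eq_bigr => k _.
have <- : (lift i (lift ord0 k) == lift i (lift ord0 j))%:R - (lift i ord0 == lift i (lift ord0 j))%:R
   = (k == j)%:R - 0 :> R.
  by rewrite !(inj_eq lift_inj) (negPf (neq_lift _ _)).
rewrite -(gradbary_dot_vertex pN) mulr_sumr; apply: eq_bigr => c _.
by rewrite [edge_mx _ _ _]mxE [u^T _ _]mxE [X in _ * (X * _)]mxE [X in _ * ((_ + X) * _)]mxE mulrA mulrC.
Qed.

End FaceGram.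

(** * Injectivity on velocities and rotations *)

Section Injectivity.
Variables (R : realType) (n : nat).
Local Notation d := n.+1.
Variables (M : mesh R d) (Omega : set 'cV[R]_d).
Hypothesis meshM : is_mesh M Omega.
Implicit Types (T : 'I_(ne M)) (F : {set 'I_(nv M)}) (x : 'cV[R]_d).
Local Notation vN := (mesh_nondegenerate meshM).

Definition face_pts F (j : 'I_d) : 'cV[R]_d := vert (plus F) (lift (ori F).2 j).
Definition area F : R := Num.sqrt (\det ((edge_mx (face_pts F))^T *m edge_mx (face_pts F))).

Lemma area_gt0 F : 0 < area F.
Proof. by rewrite sqrtr_gt0; apply: face_gram_gt0; exact: vN. Qed.

Lemma facet_intE F (f : Poly R d) :
  facet_int F (fun x => ev x f) = area F * avg (face_pts F) f.
Proof. exact: simplex_intE. Qed.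

Lemma facet_int_ext F (f g : 'cV[R]_d -> R) : F \in facets M ->
  (forall x, facet F x -> f x = g x) -> facet_int F f = facet_int F g.
Proof.
move=> FF fg; rewrite /facet_int !simplex_int_bcoord; congr (_ * _).
apply: eq_std_int => // y y0 ys; apply: fg.
rewrite -{1}(ori_fverts meshM FF) [ori F]surjective_pairing.
apply: (face_facet meshM); last exact: bcoord_sum.
by move=> i; rewrite /bcoord; case: unliftP => [j _|_]; rewrite ?subr_ge0.
Qed.

Lemma face_pts_facet F j : F \in facets M -> facet F (face_pts F j).
Proof.
move=> FF; rewrite -{1}(ori_fverts meshM FF) [X in fverts X]surjective_pairing.
apply/(facetP meshM); split=> [l|]; rewrite (lam_vertex (vN _)) ?ler0n //.
by rewrite eq_sym (negPf (neq_lift _ _)).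
Qed.

Lemma map_mx_evB m l x (a b : 'M[Poly R d]_(m, l)) :
  map_mx (ev x) (a - b) = map_mx (ev x) a - map_mx (ev x) b.
Proof. by apply/matrixP => i j; rewrite !mxE evB. Qed.

Lemma map_mx_ev0 m l x : map_mx (ev x) (0 : 'M[Poly R d]_(m, l)) = 0.
Proof. by apply/matrixP => i j; rewrite !mxE ev0. Qed.

Lemma jump_map (V W : zmodType) (f : V -> W) F (z : 'I_(ne M) -> V) :
  {morph f : a b / a - b} -> jump F (fun T => f (z T)) = f (jump F z).
Proof.
move=> fB; rewrite /jump fB; congr (_ - _); case: (minus F) => //.
by rewrite -[in RHS](subrr 0) fB subrr.
Qed.

Lemma tangB (nn a b : 'cV[R]_d) : tang nn (a - b) = tang nn a - tang nn b.
Proof. by rewrite /tang dotBl scalerBl; apply/matrixP => i j; rewrite !mxE; ring. Qed.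

Lemma jump_tE F x (v : vec_field M) :
  jump_t F x v = tang (normal F) (map_mx (ev x) (jump F v)).
Proof.
apply: (@jump_map _ _ (fun w => tang (normal F) (map_mx (ev x) w))) => a b.
by rewrite map_mx_evB tangB.
Qed.

Lemma jump_nE F x (v : vec_field M) :
  jump_n F x v = dot (map_mx (ev x) (jump F v)) (normal F).
Proof.
apply: (@jump_map _ _ (fun w => dot (map_mx (ev x) w) (normal F))) => a b.
by rewrite map_mx_evB dotBl.
Qed.

Lemma nt0 (nn : 'cV[R]_d) : nt nn 0 = 0.
Proof. by rewrite /nt mul0mx dotE big1 ?scale0r ?subrr // => i _; rewrite mxE mulr0. Qed.

(** Tangential part taken at the level of polynomials, so that facet integrands stay polynomial. *)
Definition tang_poly (nn : 'cV[R]_d) (w : 'cV[Poly R d]_d) : 'cV[Poly R d]_d :=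
  \col_c (w c 0 - nn c 0 *: \sum_e nn e 0 *: w e 0).

Lemma ev_tang_poly nn w x : map_mx (ev x) (tang_poly nn w) = tang nn (map_mx (ev x) w).
Proof.
apply/matrixP => a b; rewrite (ord1 b) [LHS]mxE [X in ev x X]mxE evB evZ ev_sum.
rewrite /tang [RHS]mxE [X in _ = X + _]mxE [X in _ = _ + X]mxE [X in _ = _ + - X]mxE.
rewrite dotE mulrC; congr (_ - _ * _); apply: eq_bigr => e _.
by rewrite evZ [X in _ = X * _]mxE mulrC.
Qed.

Lemma Pk_tang_poly k nn (w : 'cV[Poly R d]_d) : (forall c, Pk k (w c 0)) -> forall c, Pk k (tang_poly nn w c 0).
Proof.
by move=> wk c; rewrite mxE; apply: PkB => //; apply: PkZ; apply: Pk_sum => e; exact: PkZ.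
Qed.

Lemma form_b2_nt0 (t : mx_field M) u :
  (forall F, F \in facets M -> forall x, facet F x ->
     nt (normal F) (map_mx (ev x) (t (plus F))) = 0) ->
  form_b2 t u = - omega_int (fun T => frob (t T) (grad_vec (u.1 T) - u.2 T)).
Proof.
move=> h; rewrite /form_b2 [X in _ + X]big1 ?addr0 // => F FF.
rewrite (@facet_int_ext _ _ (fun x => ev x 0)) // ?facet_intE ?avg0 ?mulr0 // => x Fx.
by rewrite h // ev0 dotE big1 // => i _; rewrite mxE mul0r.
Qed.

(** The factor [c] ranges over all normalizations because the sign of the facet normal relative to T
    depends on the orientation. *)
Definition nt_free T (t0 : 'M[Poly R d]_d) : Prop :=
  forall l x (c : R), lam (vert T) l x = 0 ->
    dot (c *: gradbary (vert T) l) (c *: gradbary (vert T) l) = 1 ->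
    nt (c *: gradbary (vert T) l) (map_mx (ev x) t0) = 0.

Lemma nt_free_single T t0 F x T0 i : nt_free T t0 -> F \in facets M -> facet F x ->
  fverts (T0, i) = F -> nt (normal F) (map_mx (ev x) (single T t0 T0)) = 0.
Proof.
move=> h FF Fx T0F; have [E|T0T] := eqVneq T0 T; last by rewrite single_neq // map_mx_ev0 nt0.
rewrite E in T0F *; rewrite single_id.
have [c _ nE] := normal_gradbary meshM FF T0F.
have := normal_unit meshM F; rewrite nE => n1.
by apply: h => //; exact: (facet_lam0 meshM T0F Fx).
Qed.

Lemma Sigma_h_single k T t0 : PkM k t0 -> \tr t0 = 0 -> nt_free T t0 ->
  Sigma_h k (single T t0 : mx_field M).
Proof.
move=> tk tr0 h; split=> [T0|T0|F Fi x Fx].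
- by apply: (@single_ind _ _ _ _ T _ (PkM k)) => // i j; rewrite mxE; exact: Pk0.
- by apply: (@single_ind _ _ _ _ T _ (fun t => \tr t = 0)) => //; exact: mxtrace0.
- have FF : F \in facets M by case/setIdP: Fi.
  by apply: (jump_eq0 meshM FF) => T0 i; exact: nt_free_single.
Qed.

Lemma form_b2_single T t0 u : nt_free T t0 ->
  form_b2 (single T t0 : mx_field M) u =
  - (vol T * avg (vert T) (frob t0 (grad_vec (u.1 T) - u.2 T))).
Proof.
move=> h; rewrite form_b2_nt0 => [|F FF x Fx]; last first.
  by apply: (nt_free_single h FF Fx); exact: (ori_fverts meshM FF).
congr (- _); apply: omega_int_single; first by rewrite single_id.
by move=> T0 T0T; rewrite single_neq // /frob big1 // => i _; rewrite big1 // => j _; rewrite mxE mul0r.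
Qed.

Lemma frob0r (t : 'M[Poly R d]_d) : frob t 0 = 0.
Proof. by apply: big1 => i _; apply: big1 => j _; rewrite mxE mulr0. Qed.

(** With grad v = g the volume term of b_2 drops out, and a stress whose nt-trace is the jump on F
    and zero on all other facets leaves the integral of the squared jump. The jump is a rigid motion
    vanishing on F, hence zero. *)
Lemma jump_rigid k F (v : vec_field M) (g : mx_field M) : F \in facets M ->
  V_h k v -> (forall T c, Pk k (v T c 0)) ->
  (forall T, (g T)^T = - g T) -> (forall T c a b, pd c (g T a b) = 0) ->
  (forall T, grad_vec (v T) = g T) ->
  (forall t, Sigma_h k t -> form_b2 t (v, g) = 0) -> jump F v = 0.
Proof.
move=> FF [_ vj] vk gT gc gv h; set w := jump F v.
pose W := tang_poly (normal F) w.
have Wk c : Pk k (W c 0).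
  apply: Pk_tang_poly => {}c; rewrite /w /jump mxE [X in _ + X]mxE.
  by apply: PkB => //; case: (minus F) => [T|]; rewrite ?mxE //; exact: Pk0.
pose kf T i := dot (normal F) (gradbary (vert T) i) /
  dot (gradbary (vert T) i) (gradbary (vert T) i).
have kfP T i : fverts (T, i) = F -> kf T i != 0 /\ normal F = kf T i *: gradbary (vert T) i.
  move=> TF; have [c c0 nE] := normal_gradbary meshM FF TF.
  suff -> : kf T i = c by [].
  by rewrite /kf nE dotZl mulfK // gt_eqF // (gradbary_dot_gt0 meshM).
(* Every neighbour of F carries a stress built from the same [W] and its own multiple [kf] of the
   gradient, so the nt-trace on F is single valued. *)
pose t : mx_field M := [ffun T => if [pick i | fverts (T, i) == F] is Some i
  then facet_stress (vert T) i (kf T i) W else 0].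
(* On F the normal jump is zero, so the tangential part [W] and the full jump [w] agree there,
   though not as polynomials. *)
have nWE x : facet F x -> map_mx (ev x) W = map_mx (ev x) w.
  move=> Fx; rewrite ev_tang_poly /tang -jump_nE vj // scale0r subr0 //.
have nW x : facet F x -> dot (normal F) (map_mx (ev x) W) = 0.
  by move=> Fx; rewrite nWE // dotC -jump_nE vj.
have tnt F' x T i : F' \in facets M -> facet F' x -> fverts (T, i) = F' ->
    nt (normal F') (map_mx (ev x) (t T)) = if F' == F then map_mx (ev x) W else 0.
  move=> FF' Fx TF'; rewrite ffunE; case: pickP => [j /eqP TjF|hj]; last first.
    rewrite map_mx_ev0 nt0; case: eqP => // E.
    by have := hj i; rewrite TF' E eqxx.
  case: eqP => [E|FN].
    have -> : j = i by apply: (fverts_inj meshM (T := T)); rewrite TjF TF' E.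
    rewrite E in TF' Fx *; have [c0 nE] := kfP _ _ TF'.
    have := normal_unit meshM F; have := nW _ Fx; rewrite nE => n0 n1.
    by apply: nt_facet_stress => //; exact: vN.
  have [c c0 nE] := normal_gradbary meshM FF' TF'.
  have := normal_unit meshM F'; rewrite nE => n1.
  apply: nt_facet_stress_other => //; first exact: vN.
  by apply/eqP => ij; apply: FN; rewrite -TF' -TjF ij.
have St : Sigma_h k t.
  split=> [T|T|F' Fi x Fx].
  - rewrite ffunE; case: pickP => [j _|_]; first exact: PkM_facet_stress.
    by move=> i j; rewrite mxE; exact: Pk0.
  - rewrite ffunE; case: pickP => [j _|_]; last exact: mxtrace0.
    by apply: tr_facet_stress => //; exact: vN.
  - have FF' : F' \in facets M by case/setIdP: Fi.
    apply: (@jump_const _ _ _ _ meshM _ _ _ (if F' == F then map_mx (ev x) W else 0)) => //.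
      by rewrite -(int_facetsP meshM FF').
    by move=> T i TF'; exact: (tnt F' x T i FF' Fx TF').
have := h _ St; rewrite /form_b2.
rewrite (_ : omega_int _ = 0) ?oppr0 ?add0r; last first.
  by rewrite omega_intE big1 // => T _; rewrite /= gv subrr frob0r avg0 mulr0.
rewrite (bigD1 F) //= [X in _ + X]big1 ?addr0 => [|F' /andP[FF' F'F]]; last first.
  rewrite (@facet_int_ext _ _ (fun x => ev x 0)) // ?facet_intE ?avg0 ?mulr0 // => x Fx.
  rewrite (tnt _ _ _ (ori F').2) //; last exact: (ori_fverts meshM FF').
  by rewrite (negPf F'F) ev0 dotE big1 // => i _; rewrite mxE mul0r.
rewrite (@facet_int_ext _ _ (fun x => ev x (\sum_c W c 0 ^+ 2))) // => [|x Fx]; last first.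
  rewrite (tnt _ _ _ (ori F).2) //; last exact: (ori_fverts meshM FF).
  rewrite eqxx jump_tE -/w -ev_tang_poly -/W dotE ev_sum; apply: eq_bigr => c _.
  by rewrite expr2 evM [X in X * _]mxE [X in _ * X]mxE.
rewrite facet_intE => /eqP; rewrite mulf_eq0 gt_eqF ?area_gt0 //= => /eqP z.
have sqE x : ev x (\sum_c W c 0 ^+ 2) = \sum_c ev x (W c 0) ^+ 2.
  by rewrite ev_sum; apply: eq_bigr => c _; rewrite /ev rmorphXn.
have W0 j c : ev (face_pts F j) (W c 0) = 0.
  have : ev (face_pts F j) (\sum_c W c 0 ^+ 2) = 0.
    apply: avg_eq0_vertex z j => l _ _; rewrite sqE; apply: sumr_ge0 => e _; exact: sqr_ge0.
  rewrite sqE => /eqP; rewrite psumr_eq0 => [/allP/(_ c (mem_index_enum c))|e _]; last exact: sqr_ge0.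
  by rewrite /= sqrf_eq0 => /eqP.
pose G T : 'M[R]_d := \matrix_(a, b) mcoeff mnm0 (g T a b).
have gG T a b : g T a b = mpolyC d (G T a b).
  by rewrite mxE; apply: grad0_const => c; exact: gc.
have GT T : (G T)^T = - G T.
  apply/matrixP => a b; rewrite !mxE.
  have := congr1 (fun X : 'M[Poly R d]_d => mcoeff mnm0 (X a b)) (gT T).
  by rewrite !mxE mcoeffN.
apply: (@rigid_face_eq0 _ _ _ (vN (plus F)) (ori F).2 w
   (G (plus F) - if minus F is Some T then G T else 0)) => //.
- by case: (minus F) => [T|]; [rewrite linearB /= !GT opprB opprK addrC|rewrite !subr0 GT].
- move=> a b; have dv T : pd b (v T a 0) = mpolyC d (G T a b).
    by rewrite -gG -gv mxE.
  have subE (V : zmodType) r (X Y : 'M[V]_(d, r)) i j : (X - Y) i j = X i j - Y i j.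
    by rewrite !mxE.
  rewrite /w /jump !subE pdB dv mpolyCB; congr (_ - _).
  by case: (minus F) => [T|]; [exact: dv | rewrite !mxE pd0 mpolyC0].
- move=> j a; case: (unliftP (ori F).2 j) => [j' ->|-> /eqP//] _.
  have := congr1 (fun X : 'cV[R]_d => X a 0) (nWE _ (face_pts_facet j' FF)).
  by rewrite [LHS]mxE [RHS]mxE W0.
Qed.

Lemma Sigma_h0 k : Sigma_h k (0 : mx_field M).
Proof.
split=> [T i j|T|F Fi x Fx]; rewrite ?ffunE ?mxE ?mxtrace0 //; first exact: Pk0.
have FF : F \in facets M by case/setIdP: Fi.
by apply: (jump_eq0 meshM FF) => T i _; rewrite ffunE map_mx_ev0 nt0.
Qed.

Hypothesis d23 : d = 2%N \/ d = 3%N.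

Lemma dev_curl_curl0 (p : 'I_d.+1 -> 'cV[R]_d) : dev_curl_curl p 0 = 0.
Proof.
have /eqP := dev_curl_curlD d23 p 0 0.
by rewrite addr0 -subr_eq0 opprD addrA subrr sub0r oppr_eq0 => /eqP.
Qed.

Lemma PkK_perp0 k T : PkK_perp k T (0 : 'M[Poly R d]_d).
Proof.
split; first by split; [move=> i j; rewrite mxE; exact: Pk0 | rewrite trmx0 oppr0].
by move=> s _; rewrite elt_intE frobC frob0r avg0 mulr0.
Qed.

Lemma deltaSigma_h0 k : deltaSigma_h k (0 : mx_field M).
Proof. by exists (fun=> 0) => T; rewrite dev_curl_curl0 ffunE; split=> //; exact: PkK_perp0. Qed.

Lemma Sigma_h_sub_plus k (t : mx_field M) : Sigma_h k t -> Sigma_h_plus k t.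
Proof. by move=> St; exists t, 0; split=> //; [exact: deltaSigma_h0 | rewrite addr0]. Qed.

Lemma nt_free_dev_curl_curl T (g : 'M[Poly R d]_d) : nt_free T (dev_curl_curl (vert T) g).
Proof. by move=> l x c lx c1; apply: nt_dev_curl_curl => //; exact: vN. Qed.

Lemma single_add (V : zmodType) T (a b : V) : single T (a + b) = single T a + single T b.
Proof. by apply/ffunP => T0; rewrite !ffunE; case: ifP; rewrite ?addr0. Qed.

(** Split g into its projection g0 of degree k - 1 and the rest. The field of g0 has degree k and no
    nt-trace, so it lies in Sigma_h; the rest is orthogonal to degree k - 1 and produces an element
    of deltaSigma_h. *)
Lemma single_dev_curl_curl k T (g : 'M[Poly R d]_d) : (0 < k)%N -> PkK k g ->
  Sigma_h_plus k (single T (dev_curl_curl (vert T) g) : mx_field M).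
Proof.
move=> k0 [gk gT].
have [g0 [g0k g0T] g0P] := skew_projection (vN T) k.-1 gT.
exists (single T (dev_curl_curl (vert T) g0)), (single T (dev_curl_curl (vert T) (g - g0))); split.
- apply: Sigma_h_single; last exact: nt_free_dev_curl_curl.
    by rewrite -(prednK k0); exact: dev_curl_curl_degree.
  exact: tr_dev_curl_curl.
- exists (fun T0 => if T0 == T then g - g0 else 0) => T0; rewrite ffunE.
  have [->|_] := eqVneq T0 T; last by split; [exact: PkK_perp0 | rewrite dev_curl_curl0].
  split=> //; split; first split.
  + by move=> i j; rewrite mxE [X in _ + X]mxE; apply: PkB => //; apply: Pk_le (g0k i j); exact: leq_pred.
  + by rewrite linearB /= gT g0T opprB opprK addrC.
  + by move=> s [sk _]; rewrite elt_intE g0P // mulr0.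
- by rewrite -single_add -dev_curl_curlD // addrC subrK.
Qed.

Lemma tr_skew (g : 'M[Poly R d]_d) : g^T = - g -> \tr g = 0.
Proof.
move=> gT; apply: big1 => i _; apply: ev_inj => x; rewrite ev0.
have := congr1 (fun X : 'M[Poly R d]_d => ev x (X i i)) gT.
by rewrite !mxE evN; lra.
Qed.

Lemma tr_grad_vec (v : 'cV[Poly R d]_d) : \tr (grad_vec v) = div_poly v.
Proof. by apply: eq_bigr => i _; rewrite mxE. Qed.

Lemma b2_inj k u : (0 < k)%N -> polyhedral_domain Omega -> U_h k u ->
  (forall t : mx_field M, Sigma_h_plus k t -> form_b2 t u = 0) ->
  (forall q : sc_field M, Q_h k q -> form_b1 u q = 0) -> u = 0.
Proof.
case: u => v g k0 domOmega [/= Vv Wg] h2 h1.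
have [vRT vj] := Vv.
have gk T : PkM k (g T) by case: (Wg T).
have gT T : (g T)^T = - g T by case: (Wg T).
have dv T : div_poly (v T) = 0.
  (* The divergence is itself an admissible q: it has degree at most k, and its integral is 0 by the
     divergence theorem. *)
  pose q : sc_field M := [ffun T => div_poly (v T)].
  have Qq : Q_h k q.
    split=> [T0|]; last first.
      by rewrite -[RHS](V_h_div_eq0 meshM Vv); congr omega_int; apply/funext => T0; rewrite ffunE.
    rewrite ffunE; have [a [r [ak rk vE]]] := vRT T0.
    apply: Pk_sum => i; rewrite vE pdD pdM pdXE eqxx mul1r.
    apply: PkD; first by apply: Pk_le (Pk_pd i (ak i)); exact: leq_pred.
    apply: PkD => //; rewrite -(prednK k0); apply: (@Pk_mul _ _ 1 k.-1); first exact: PkX.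
    exact: Pk_pd.
  have := h1 _ Qq; rewrite /form_b1 => hq.
  have {}hq : omega_int (fun T => \sum_(i < 1) (fun T _ => div_poly (v T)) T i ^+ 2) = 0.
    rewrite -[RHS]hq; congr omega_int; apply/funext => T0.
    by rewrite big_ord1 ffunE expr2.
  exact: (omega_int_sq_eq0 meshM hq T ord0).
have vk T c : Pk k (v T c 0) by apply: RT_div_eq0.
have trD T : \tr (grad_vec (v T) - g T) = 0.
  by rewrite linearB /= (tr_skew (gT T)) tr_grad_vec dv subr0.
have test T t0 : nt_free T t0 -> Sigma_h_plus k (single T t0 : mx_field M) ->
    avg (vert T) (frob t0 (grad_vec (v T) - g T)) = 0.
  move=> tf St; have := h2 _ St; rewrite form_b2_single //= => /eqP.
  by rewrite oppr_eq0 mulf_eq0 gt_eqF ?(vol_mesh_gt0 meshM) //= => /eqP.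
have gc T c a b : pd c (g T a b) = 0.
  apply: (dev_curl_curl_test d23 (vN T) (gT T) (trD T)).
  apply: test; first exact: nt_free_dev_curl_curl.
  exact: single_dev_curl_curl.
have D0 T : grad_vec (v T) = g T.
  apply/eqP; rewrite -subr_eq0; apply/eqP; apply: (stress_bubble_test (vN T)) => i.
  have tf : nt_free T (stress_bubble (vert T) (grad_vec (v T) - g T) i).
    by move=> l x c lx c1; apply: nt_stress_bubble => //; exact: vN.
  apply: test => //; apply: Sigma_h_sub_plus; apply: Sigma_h_single => //.
    (* As g is already constant, grad v - g has degree k - 1, which leaves room for the factor
       lam_i. *)
    apply: PkM_stress_bubble => // a b; rewrite mxE [X in Pk _ (X + _)]mxE [X in Pk _ (_ + X)]mxE.
    apply: PkB; first exact: Pk_pd.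
    by rewrite (grad0_const (fun c => gc T c a b)); exact: PkC.
  by apply: tr_stress_bubble => //; exact: vN.
have J0 F : F \in facets M -> jump F v = 0.
  move=> FF; apply: (jump_rigid FF Vv vk gT gc D0) => t St.
  by apply: h2; exact: Sigma_h_sub_plus.
have vF F T i : F \in facets M -> fverts (T, i) = F -> v T = v (plus F).
  move=> FF TF; have := J0 _ FF; rewrite /jump.
  case: (minusP meshM FF) => [T' i' _ _ hh /eqP|hh _]; last by rewrite (hh _ _ TF).
  by rewrite subr_eq0 => /eqP E; case: (hh _ _ TF) => ->.
have vcst := mesh_constant meshM domOmega (z := v) _.
have [F0 F0F mF0] := boundary_facet meshM domOmega.
have v0 T : v T = 0.
  have {}vcst : v T = v (plus F0).
    apply: vcst => T1 i T2 i' e; have FF := fverts_facets (T1, i).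
    by rewrite (vF _ _ _ FF (erefl _)) (vF _ T2 i' FF).
  by rewrite vcst; have := J0 _ F0F; rewrite /jump mF0 subr0.
congr pair; apply/ffunP => T; rewrite ffunE //.
by rewrite -D0 v0; apply/matrixP => i j; rewrite !mxE pd0.
Qed.

End Injectivity.

(** * Bilinearity of the forms *)

Section Combinations.
Variables (R : realType) (d : nat) (V : lmodType (Poly R d)).

(** The field spaces are modules over polynomials; linearity over R is obtained by restricting to
    constant polynomials. *)
Definition real_linear (f : V -> R) : Prop :=
  forall c x y, f (mpolyC d c *: x + y) = c * f x + f y.

Lemma real_linear_sum f m (c : 'I_m -> R) (e : 'I_m -> V) : real_linear f ->
  f (\sum_i mpolyC d (c i) *: e i) = \sum_i c i * f (e i).
Proof.
move=> fl; have f0 : f 0 = 0.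
  have := fl 1 0 0; rewrite scaler0 addr0 mul1r => /eqP.
  by rewrite -subr_eq0 opprD addrA subrr sub0r oppr_eq0 => /eqP.
elim: m c e => [|m IH] c e; first by rewrite !big_ord0.
by rewrite !big_ord_recl fl IH.
Qed.

Lemma combination_closed (P : V -> Prop) m (c : 'I_m -> R) (e : 'I_m -> V) :
  P 0 -> (forall a x y, P x -> P y -> P (mpolyC d a *: x + y)) ->
  (forall i, P (e i)) -> P (\sum_i mpolyC d (c i) *: e i).
Proof.
move=> P0 Pl; elim: m c e => [|m IH] c e Pe; first by rewrite big_ord0.
by rewrite big_ord_recl; apply: Pl => //; apply: IH.
Qed.

End Combinations.

Section Linearity.
Variables (R : realType) (n : nat).
Local Notation d := n.+1.
Variables (M : mesh R d) (Omega : set 'cV[R]_d).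
Hypothesis meshM : is_mesh M Omega.
Implicit Types (s t : mx_field M) (q r : sc_field M) (u : vec_field M * mx_field M).
Local Notation C := (mpolyC d).

Lemma ffun_combE (V : lmodType (Poly R d)) (a : Poly R d) (x y : {ffun 'I_(ne M) -> V}) T :
  (a *: x + y) T = a *: x T + y T.
Proof. by rewrite !ffunE. Qed.

Lemma mx_combE p m (a : Poly R d) (x y : 'M[Poly R d]_(p, m)) i j :
  (a *: x + y) i j = a * x i j + y i j.
Proof. by rewrite mxE [X in X + _]mxE. Qed.

Lemma mul_mpolyC_pd i c (f : Poly R d) : pd i (C c * f) = C c * pd i f.
Proof. by rewrite pdM pdC mul0r add0r. Qed.

Lemma div_poly_lin c (v w : 'cV[Poly R d]_d) :
  div_poly (C c *: v + w) = C c * div_poly v + div_poly w.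
Proof.
rewrite /div_poly mulr_sumr -big_split; apply: eq_bigr => i _ /=.
by rewrite mx_combE pdD mul_mpolyC_pd.
Qed.

Lemma grad_vec_lin c (v w : 'cV[Poly R d]_d) :
  grad_vec (C c *: v + w) = C c *: grad_vec v + grad_vec w.
Proof.
apply/matrixP => i j; rewrite mx_combE [LHS]mxE mx_combE pdD mul_mpolyC_pd.
by rewrite [grad_vec v _ _]mxE [grad_vec w _ _]mxE.
Qed.

Lemma dev_lin (a : Poly R d) (s t : 'M[Poly R d]_d) : dev (a *: s + t) = a *: dev s + dev t.
Proof.
rewrite devD; congr (_ + _); rewrite /dev scalerBr mxtraceZ; congr (_ - _).
by rewrite scale_scalar_mx scalerAr.
Qed.

Lemma jump_lin F (a : Poly R d) (v w : vec_field M) :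
  jump F (a *: v + w) = a *: jump F v + jump F w.
Proof.
rewrite /jump ffun_combE; case: (minus F) => [T|]; last by rewrite !subr0.
by rewrite ffun_combE scalerBr addrACA opprD.
Qed.

Lemma tang_poly_lin nn c (v w : 'cV[Poly R d]_d) :
  tang_poly nn (C c *: v + w) = C c *: tang_poly nn v + tang_poly nn w.
Proof.
apply/matrixP => a b; rewrite mx_combE (ord1 b) ![tang_poly _ _ _ _]mxE mx_combE.
have -> : \sum_e nn e 0 *: (C c *: v + w) e 0 =
    C c * (\sum_e nn e 0 *: v e 0) + \sum_e nn e 0 *: w e 0.
  rewrite mulr_sumr -big_split; apply: eq_bigr => e _ /=.
  by rewrite mx_combE scalerDr scalerAr.
by rewrite scalerDr scalerAr; ring.
Qed.

(** Writes the facet integrands as evaluations of polynomials, which makes the linearity of [avg]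
    applicable to them. *)
Lemma form_b2E t u : form_b2 t u =
  - omega_int (fun T => frob (t T) (grad_vec (u.1 T) - u.2 T)) +
  \sum_(F in facets M) area F * avg (face_pts F)
     (\sum_c tang_poly (normal F) (t (plus F) *m map_mx (@mpolyC d R) (normal F)) c 0 *
             tang_poly (normal F) (jump F u.1) c 0).
Proof.
congr (_ + _); apply: eq_bigr => F FF; rewrite -facet_intE; congr facet_int.
apply/funext => x; rewrite jump_tE -ev_tang_poly.
have -> : nt (normal F) (map_mx (ev x) (t (plus F))) =
    map_mx (ev x) (tang_poly (normal F) (t (plus F) *m map_mx (@mpolyC d R) (normal F))).
  rewrite ev_tang_poly /tang /nt dotC.
  have -> // : map_mx (ev x) (t (plus F)) *m normal F =
     map_mx (ev x) (t (plus F) *m map_mx (@mpolyC d R) (normal F)).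
  apply/matrixP => a b; rewrite [LHS]mxE [RHS]mxE [X in _ = ev x X]mxE ev_sum.
  by apply: eq_bigr => e _; rewrite evM [map_mx _ _ e b]mxE evC [X in X * _]mxE.
rewrite dotE ev_sum; apply: eq_bigr => c _.
by rewrite evM [X in X * _]mxE [X in _ * X]mxE.
Qed.

Lemma omega_int_linE c (f g h : 'I_(ne M) -> Poly R d) :
  (forall T, f T = C c * g T + h T) -> omega_int f = c * omega_int g + omega_int h.
Proof.
by move=> E; rewrite -omega_int_lin; congr omega_int; apply/funext.
Qed.

Lemma form_a_sym nu s t : form_a nu s t = form_a nu t s.
Proof.
apply: (congr1 (@omega_int R d M)); apply/funext => T.
by rewrite [X in _ *: X = _]frobC.
Qed.

Lemma form_a_linear nu t : real_linear (fun s => form_a nu s t).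
Proof.
move=> c x y; apply: omega_int_linE => T.
by rewrite ffun_combE dev_lin frobDl frobZl scalerDr scalerAr.
Qed.

Lemma form_mass_sym q r : form_mass q r = form_mass r q.
Proof. by congr omega_int; apply/funext => T; rewrite mulrC. Qed.

Lemma form_mass_linear r : real_linear (fun q : sc_field M => form_mass q r).
Proof.
by move=> c x y; apply: omega_int_linE => T; rewrite ffun_combE mulrDl -mulrA.
Qed.

Lemma form_b1_linear_l q : real_linear (fun u => form_b1 u q).
Proof.
move=> c x y; apply: omega_int_linE => T.
by rewrite /= ffun_combE div_poly_lin mulrDr mulrCA.
Qed.

Lemma form_b1_linear_r u : real_linear (fun q : sc_field M => form_b1 u q).
Proof.
by move=> c x y; apply: omega_int_linE => T; rewrite ffun_combE mulrDl -mulrA.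
Qed.

Lemma form_b2_linear_l u : real_linear (fun t => form_b2 t u).
Proof.
move=> c x y; rewrite !form_b2E mulrDr addrACA mulrN -opprD; congr (- _ + _).
  by apply: omega_int_linE => T; rewrite ffun_combE frobDl frobZl.
rewrite mulr_sumr -big_split; apply: eq_bigr => F _ /=.
rewrite mulrCA -mulrDr -avg_lin; congr (_ * avg _ _).
rewrite scaler_sumr -big_split; apply: eq_bigr => e _ /=.
rewrite ffun_combE mulmxDl -scalemxAl tang_poly_lin mx_combE mulrDl -mulrA.
by rewrite mul_mpolyC.
Qed.

Lemma form_b2_linear_r t : real_linear (fun u => form_b2 t u).
Proof.
move=> c x y; rewrite !form_b2E mulrDr addrACA mulrN -opprD; congr (- _ + _).
  apply: omega_int_linE => T; rewrite /= !ffun_combE grad_vec_lin.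
  have -> : C c *: grad_vec (x.1 T) + grad_vec (y.1 T) - (C c *: x.2 T + y.2 T) =
     C c *: (grad_vec (x.1 T) - x.2 T) + (grad_vec (y.1 T) - y.2 T).
    by rewrite scalerBr opprD addrACA.
  by rewrite [LHS]frobDr frobZr.
rewrite mulr_sumr -big_split; apply: eq_bigr => F _ /=.
rewrite mulrCA -mulrDr -avg_lin; congr (_ * avg _ _).
rewrite scaler_sumr -big_split; apply: eq_bigr => e _ /=.
by rewrite jump_lin tang_poly_lin mx_combE mulrDr mulrCA mul_mpolyC.
Qed.

Lemma Q_h_lin k c q r : Q_h k q -> Q_h k r -> Q_h k (C c *: q + r : sc_field M).
Proof.
move=> [qk q0] [rk r0]; split=> [T|].
  by rewrite ffun_combE; apply: PkD => //; rewrite [_ *: _]mul_mpolyC; exact: PkZ.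
rewrite (@omega_int_linE c _ q r) ?q0 ?r0 ?mulr0 ?addr0 // => T.
by rewrite ffun_combE.
Qed.

Lemma Q_h0 k : Q_h k (0 : sc_field M).
Proof.
split=> [T|]; first by rewrite ffunE; exact: Pk0.
by rewrite omega_intE big1 // => T _; rewrite ffunE avg0 mulr0.
Qed.

Lemma PkK_lin k c (g h : 'M[Poly R d]_d) : PkK k g -> PkK k h -> PkK k (C c *: g + h).
Proof.
move=> [gk gT] [hk hT]; split=> [i j|].
  by rewrite mx_combE mul_mpolyC; apply: PkD => //; exact: PkZ.
by rewrite linearD linearZ /= gT hT scalerN opprD.
Qed.

Lemma RTk_lin k c (v w : 'cV[Poly R d]_d) : RTk k v -> RTk k w -> RTk k (C c *: v + w).
Proof.
move=> [a [p [ak pk vE]]] [b [q [bk qk wE]]].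
exists (C c *: a + b), (C c * p + q); split.
- by move=> i; rewrite mx_combE mul_mpolyC; apply: PkD => //; exact: PkZ.
- by rewrite mul_mpolyC; apply: PkD => //; exact: PkZ.
- by move=> i; rewrite !mx_combE vE wE; ring.
Qed.

Lemma U_h_lin k c u u' : U_h k u -> U_h k u' -> U_h k (C c *: u + u').
Proof.
move=> [[uk uj] gk] [[uk' uj'] gk']; split; last first.
  by move=> T; rewrite /= ffun_combE; exact: PkK_lin.
split=> [T|F FF x Fx]; first by rewrite /= ffun_combE; exact: RTk_lin.
rewrite jump_nE /= jump_lin.
have -> : map_mx (ev x) (C c *: jump F u.1 + jump F u'.1) =
   c *: map_mx (ev x) (jump F u.1) + map_mx (ev x) (jump F u'.1).
  apply/matrixP => i j; rewrite [LHS]mxE mx_combE evD evM evC.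
  by rewrite [RHS]mxE [X in _ = X + _]mxE [X in _ = _ * X + _]mxE [X in _ = _ + X]mxE.
by rewrite dotDl dotZl -!jump_nE uj // uj' // mulr0 addr0.
Qed.

Lemma U_h0 k : U_h k (0 : vec_field M * mx_field M).
Proof.
split; last exact: W_h0.
apply: (V_h_local meshM) => [T|T l x _]; first by rewrite ffunE; exact: RTk0.
by apply: big1 => c _; rewrite ffunE [X in ev x X]mxE ev0 mulr0.
Qed.

Lemma form_a_ge0 nu t : 0 < nu -> 0 <= form_a nu t t.
Proof.
move=> nu0; rewrite /form_a omega_intE; apply: sumr_ge0 => T _.
rewrite mulr_ge0 ?(ltW (vol_mesh_gt0 meshM T)) //; apply: avg_ge0 => l _ _.
rewrite evZ mulr_ge0 ?invr_ge0 ?(ltW nu0) // /frob ev_sum; apply: sumr_ge0 => i _.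
by rewrite ev_sum; apply: sumr_ge0 => j _; rewrite evM -expr2 sqr_ge0.
Qed.

(** The form sees only deviators, so definiteness rests on the trace condition, which makes [dev]
    the identity. *)
Lemma form_a_eq0 nu t : 0 < nu -> (forall T, \tr (t T) = 0) -> form_a nu t t = 0 -> t = 0.
Proof.
move=> nu0 tr0 h.
have {}h : omega_int (fun T => \sum_(ij : 'I_d * 'I_d) (t T ij.1 ij.2) ^+ 2) = 0.
  apply/eqP; have /eqP := h; rewrite /form_a !omega_intE.
  under eq_bigr do rewrite avgZ mulrCA.
  rewrite -mulr_sumr mulf_eq0 invr_eq0 (gt_eqF nu0) /= => /eqP h0; rewrite -[X in _ == X]h0; apply/eqP.
  apply: eq_bigr => T _; congr (_ * avg _ _); rewrite dev_id // /frob pair_bigA /=.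
  by apply: eq_bigr => ij _; rewrite expr2.
apply/ffunP => T; rewrite ffunE; apply/matrixP => i j; rewrite mxE.
exact: (omega_int_sq_eq0 meshM (q := fun T ij => t T ij.1 ij.2) h T (i, j)).
Qed.

Lemma form_mass_ge0 q : 0 <= form_mass q q.
Proof.
rewrite /form_mass omega_intE; apply: sumr_ge0 => T _.
rewrite mulr_ge0 ?(ltW (vol_mesh_gt0 meshM T)) //; apply: avg_ge0 => l _ _.
by rewrite evM -expr2 sqr_ge0.
Qed.

Lemma form_mass_eq0 q : form_mass q q = 0 -> q = 0.
Proof.
move=> h; have {}h : omega_int (fun T => \sum_(i < 1) (q T : Poly R d) ^+ 2) = 0.
  by rewrite -[RHS]h; congr omega_int; apply/funext => T; rewrite big_ord1 expr2.
apply/ffunP => T; rewrite ffunE.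
exact: (omega_int_sq_eq0 meshM (q := fun T _ => q T : Poly R d) h T ord0).
Qed.

Hypothesis d23 : d = 2%N \/ d = 3%N.

Lemma tr_Sigma_h_plus k t T : Sigma_h_plus k t -> \tr (t T) = 0.
Proof.
move=> [s [e [[_ s0 _] [r rP] ->]]]; rewrite ffunE linearD /= s0 add0r.
by case: (rP T) => _ ->; rewrite tr_dev_curl_curl.
Qed.

End Linearity.

(** * The spectrum of the preconditioned matrix *)

Section Quadratic.
Variable R : realType.

(** Row vectors are used throughout because [eigenvalue] and [kermx] refer to multiplication from
    the left. *)
Definition bf n (X : 'M[R]_n) (x y : 'rV[R]_n) : R := (x *m X *m y^T) 0 0.

Definition spd n (X : 'M[R]_n) : Prop :=
  X^T = X /\ forall x, 0 <= bf X x x /\ (bf X x x = 0 -> x = 0).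

Variable n : nat.
Implicit Types (X Y : 'M[R]_n) (x y z : 'rV[R]_n).

Lemma bfDl X x y z : bf X (x + y) z = bf X x z + bf X y z.
Proof. by rewrite /bf !mulmxDl mxE. Qed.

Lemma bfZl X c x y : bf X (c *: x) y = c * bf X x y.
Proof. by rewrite /bf -!scalemxAl mxE. Qed.

Lemma bfC X x y : X^T = X -> bf X x y = bf X y x.
Proof.
move=> XT; rewrite /bf.
have -> : x *m X *m y^T = (y *m X *m x^T)^T by rewrite !trmx_mul trmxK XT mulmxA.
by rewrite [LHS]mxE.
Qed.

Lemma bfMD X Y x y : bf (X + Y) x y = bf X x y + bf Y x y.
Proof. by rewrite /bf mulmxDr mulmxDl mxE. Qed.

Lemma bfMZ c X x y : bf (c *: X) x y = c * bf X x y.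
Proof. by rewrite /bf -scalemxAr -scalemxAl mxE. Qed.

Lemma bf_congr m (X : 'M[R]_m) (B : 'M[R]_(n, m)) x y :
  bf (B *m X *m B^T) x y = bf X (x *m B) (y *m B).
Proof. by rewrite /bf trmx_mul !mulmxA. Qed.

Lemma spd_unit X : spd X -> X \in unitmx.
Proof.
move=> [_ Xp]; rewrite -row_free_unit -kermx_eq0; apply/eqP/row_matrixP => i.
rewrite row0; apply: (Xp _).2.
have /sub_kermxP E : (row i (kermx X) <= kermx X)%MS by exact: row_sub.
by rewrite /bf E mul0mx mxE.
Qed.

Lemma bf_invmx X x : spd X -> bf (invmx X) x x = bf X (x *m invmx X) (x *m invmx X).
Proof.
by move=> sX; rewrite /bf (mulmxKV (spd_unit sX)) trmx_mul trmx_inv sX.1 mulmxA.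
Qed.

Lemma spd_inv X : spd X -> spd (invmx X).
Proof.
move=> sX; have Xu := spd_unit sX; have [XT Xp] := sX.
split=> [|x]; first by rewrite trmx_inv XT.
rewrite bf_invmx //; have [p0 pz] := Xp (x *m invmx X); split=> // /pz h.
by rewrite -[x](mulmxKV Xu) h mul0mx.
Qed.

End Quadratic.

(** * Eigenvalue bounds for the saddle-point system *)

Section SaddlePoint.
Variables (R : realType) (s u q : nat).
Variables (A : 'M[R]_s) (B1 : 'M[R]_(q, u)) (B2 : 'M[R]_(u, s)) (MQ : 'M[R]_q).
Variables (nu eta : R).
Hypotheses (nu0 : 0 < nu) (eta0 : 0 < eta) (spdA : spd A) (spdMQ : spd MQ).
Hypothesis kerU : forall x : 'rV_u, x *m B2 = 0 -> x *m B1^T = 0 -> x = 0.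
Hypothesis kerQ : forall x : 'rV_q, x *m B1 = 0 -> x = 0.

Local Notation K := (B2 *m invmx A *m B2^T).
Local Notation C := (aug B1 MQ nu eta).
Local Notation S := (S_U A B1 B2 MQ nu eta).
Local Notation Q := (S_Q A B1 B2 MQ nu eta).

Lemma K_ge0 x : 0 <= bf K x x.
Proof. by rewrite bf_congr; case: (spd_inv spdA) => _ /(_ (x *m B2)) []. Qed.

Lemma bf_aug x : bf C x x = eta * nu * bf (invmx MQ) (x *m B1^T) (x *m B1^T).
Proof. by rewrite /aug bfMZ -[X in _ *m X]trmxK bf_congr. Qed.

Lemma aug_ge0 x : 0 <= bf C x x.
Proof.
rewrite bf_aug mulr_ge0 ?mulr_ge0 ?(ltW nu0) ?(ltW eta0) //.
by case: (spd_inv spdMQ) => _ /(_ (x *m B1^T)) [].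
Qed.

Lemma K_sym : K^T = K.
Proof. by rewrite !trmx_mul trmxK trmx_inv spdA.1 mulmxA. Qed.

Lemma aug_sym : C^T = C.
Proof. by rewrite /aug linearZ /= !trmx_mul trmxK trmx_inv spdMQ.1 mulmxA. Qed.

(** Zero energy forces both nonnegative parts to vanish: the first gives x B2 = 0, the second, since
    eta nu > 0, gives x B1^T = 0; [kerU] concludes. *)
Lemma spd_S_U : spd S.
Proof.
split=> [|x]; first by rewrite /S_U linearD /= K_sym aug_sym.
rewrite bfMD; split; first by rewrite addr_ge0 ?K_ge0 ?aug_ge0.
move/eqP; rewrite paddr_eq0 ?K_ge0 ?aug_ge0 // => /andP[/eqP k0 /eqP c0]; apply: kerU.
  by move: k0; rewrite bf_congr; apply: ((spd_inv spdA).2 _).2.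
apply: ((spd_inv spdMQ).2 _).2; apply/eqP; move/eqP: c0; rewrite bf_aug !mulf_eq0.
by rewrite (gt_eqF eta0) (gt_eqF nu0).
Qed.

Lemma spd_S_Q : spd Q.
Proof.
have si := spd_inv spd_S_U; split=> [|x].
  by rewrite /S_Q !trmx_mul trmxK si.1 mulmxA.
rewrite /S_Q bf_congr; have [h0 hz] := si.2 (x *m B1); split=> // /hz; exact: kerQ.
Qed.

Variables (al : R) (sg : 'rV[R]_s) (v : 'rV[R]_u) (p : 'rV[R]_q).
Hypothesis eq1 : sg *m A + v *m B2 = al *: (sg *m A).
Hypothesis eq2 : sg *m B2^T - v *m C + p *m B1 = al *: (v *m S).
Hypothesis eq3 : v *m B1^T = al *: (p *m Q).

Lemma bf_young m (X : 'M[R]_m) x y : spd X ->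
  `|2 * bf X x y| <= bf X x x + bf X y y.
Proof.
move=> [XT Xp]; have [h1 _] := Xp (x + y); have [h2 _] := Xp (x + (-1) *: y).
move: h1 h2; rewrite !(bfDl, bfZl) !(bfC _ (_ + _) XT) !(bfDl, bfZl) (bfC y x XT) => h1 h2.
by rewrite ler_norml; apply/andP; split; lra.
Qed.

(** Pairing the three equations with sg, v and p gives al N = |sg|_A^2 + 2 b_2(sg,v) - |v|_C^2 + 2
    b_1(v,p), with N the sum of squared norms. Young bounds the mixed terms by |sg|_A^2 + |v|_K^2
    and |v|_S^2 + |p|_Q^2, and S = K + C closes the estimate. *)
Lemma rayleigh_bound : `|al| * (bf A sg sg + bf S v v + bf Q p p) <=
   2 * (bf A sg sg + bf S v v + bf Q p p).
Proof.
have Au := spd_unit spdA; have Su := spd_unit spd_S_U.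
have E1 := congr1 (fun X => (X *m sg^T) 0 0) eq1.
have E2 := congr1 (fun X => (X *m v^T) 0 0) eq2.
have E3 := congr1 (fun X => (X *m p^T) 0 0) eq3.
rewrite /= !mulmxDl -scalemxAl mxE [RHS]mxE -/(bf A sg sg) in E1.
rewrite /= !mulmxDl -scalemxAl mxE [X in X + _]mxE [RHS]mxE mulNmx [X in _ + X + _]mxE -/(bf C v v) -/(bf S v v) in E2.
rewrite /= -scalemxAl [RHS]mxE -/(bf Q p p) in E3.
have tr m l (x : 'rV[R]_m) (B : 'M[R]_(m, l)) (y : 'rV_l) : (x *m B *m y^T) 0 0 = (y *m B^T *m x^T) 0 0.
  have -> : y *m B^T *m x^T = (x *m B *m y^T)^T by rewrite !trmx_mul trmxK mulmxA.
  by rewrite [RHS]mxE.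
rewrite tr in E1; rewrite [X in _ + X]tr in E2.
have y1 : `|2 * (sg *m B2^T *m v^T) 0 0| <= bf A sg sg + bf K v v.
  have := bf_young sg (v *m B2 *m invmx A) spdA.
  have -> : bf A sg (v *m B2 *m invmx A) = (sg *m B2^T *m v^T) 0 0.
    by rewrite /bf !trmx_mul trmx_inv spdA.1 !mulmxA mulmxK.
  have -> : bf A (v *m B2 *m invmx A) (v *m B2 *m invmx A) = bf K v v.
    by rewrite bf_congr (bf_invmx _ spdA).
  by [].
have y2 : `|2 * (v *m B1^T *m p^T) 0 0| <= bf S v v + bf Q p p.
  have := bf_young v (p *m B1 *m invmx S) spd_S_U.
  have -> : bf S v (p *m B1 *m invmx S) = (v *m B1^T *m p^T) 0 0.
    by rewrite /bf !trmx_mul trmx_inv spd_S_U.1 !mulmxA mulmxK.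
  have -> : bf S (p *m B1 *m invmx S) (p *m B1 *m invmx S) = bf Q p p.
    by rewrite /S_Q bf_congr (bf_invmx _ spd_S_U).
  by [].
have SE : bf S v v = bf K v v + bf C v v by rewrite bfMD.
have n0 := (spdA.2 sg).1; have n1 := K_ge0 v; have n2 := aug_ge0 v; have n3 := (spd_S_Q.2 p).1.
have N0 : 0 <= bf A sg sg + bf S v v + bf Q p p by rewrite SE; lra.
rewrite -[X in _ * X](ger0_norm N0) -normrM.
move: y1 y2; rewrite !ler_norml => /andP[a1 a2] /andP[b1 b2].
have EE : al * (bf A sg sg + bf S v v + bf Q p p) =
   bf A sg sg + 2 * (sg *m B2^T *m v^T) 0 0 - bf C v v + 2 * (v *m B1^T *m p^T) 0 0.
  by rewrite !mulrDr -E1 -E2 -E3; ring.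
by rewrite EE SE; apply/andP; split; lra.
Qed.

(* Eliminating [sg] gives [B1^T p = X v], with [X = a K + b C] and [0 < a, b <= 2], hence
   [X <= 2 S]. Then [|p|_Q^2 = |X v|_{S^-1}^2 <= 2 |v|_X^2 = 2 al |p|_Q^2]. *)
Lemma small_eigenvalue_trivial : `|al| < 6^-1 -> [/\ sg = 0, v = 0 & p = 0].
Proof.
rewrite ltr_norml => /andP[al1 al2].
have Au := spd_unit spdA; have Su := spd_unit spd_S_U.
have al10 : 1 - al != 0 by rewrite gt_eqF //; lra.
have sgE : sg = - (1 - al)^-1 *: (v *m B2 *m invmx A).
  apply: (can_inj (mulmxK Au)); rewrite -scalemxAl mulmxKV //.
  apply: (can_inj (scalerK al10)).
  rewrite scalerA mulrN mulfV // scaleN1r scalerBl scale1r -eq1.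
  by rewrite opprD addrA subrr sub0r.
(* Substituting sg = -(1-al)^-1 v B2 A^-1 in the second equation yields these coefficients of K and
   C. *)
pose a := (1 - al)^-1 + al; pose b := 1 + al.
have i1 : 0 < (1 - al)^-1 by rewrite invr_gt0; lra.
have i2 : (1 - al)^-1 * (1 - al) = 1 by rewrite mulVf.
have a0 : 0 < a by rewrite /a; nra.
have a2 : a <= 2 by rewrite /a; nra.
have b0 : 0 < b by rewrite /b; lra.
have b2 : b <= 2 by rewrite /b; lra.
pose X := a *: K + b *: C.
have scT (c : R) (Y : 'M[R]_u) : (c *: Y)^T = c *: Y^T by exact: linearZ.
have XT : X^T = X.
  by rewrite /X linearD /= [X in X + _]scT [X in _ + X]scT K_sym aug_sym.
have fE : p *m B1 = v *m X.
  have : p *m B1 = al *: (v *m S) - (sg *m B2^T - v *m C) by rewrite -eq2 addrAC subrr add0r.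
  move=> ->; rewrite sgE /X /S_U !mulmxDr -!scalemxAr -!scalemxAl !mulmxA /a /b.
  rewrite !scalerDl !scalerDr scale1r scaleNr.
  move: (v *m B2 *m invmx A *m B2^T) (v *m B1^T *m invmx MQ *m B1) => y z.
  by apply/matrixP => i j; rewrite !mxE; ring.
pose g := p *m B1 *m invmx S.
have gS : g *m S = v *m X by rewrite /g mulmxKV // fE.
have wE : bf Q p p = bf S g g.
  by rewrite /S_Q bf_congr (bf_invmx _ spd_S_U).
have w1 : bf X v g = bf Q p p by rewrite wE /bf gS.
have w2 : bf X v v = al * bf Q p p.
  transitivity ((v *m B1^T *m p^T) 0 0); last by rewrite eq3 -scalemxAl mxE.
  have -> : v *m B1^T *m p^T = (p *m B1 *m v^T)^T by rewrite !trmx_mul trmxK mulmxA.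
  by rewrite fE [RHS]mxE.
have XE y : bf X y y = a * bf K y y + b * bf C y y.
  by rewrite /X bfMD; congr (_ + _); exact: bfMZ.
have Xge0 y : 0 <= bf X y y.
  by rewrite XE addr_ge0 ?mulr_ge0 ?(ltW a0) ?(ltW b0) ?K_ge0 ?aug_ge0.
have Xle : bf X g g <= 2 * bf Q p p.
  rewrite wE XE bfMD mulrDr lerD //; apply: ler_wpM2r => //; [exact: K_ge0|exact: aug_ge0].
have Qge0 := (spd_S_Q.2 p).1.
(* With q = |p|_Q^2, positivity at g - 2 v reads 0 <= X(g,g) - 4 q + 4 al q <= (4 al - 2) q, which
   forces q = 0 since al < 1/2. *)
have := Xge0 (g + (-2) *: v).
rewrite !(bfDl, bfZl) !(bfC _ (_ + _) XT) !(bfDl, bfZl) (bfC g v XT) w1 w2 => h.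
have Q0 : bf Q p p = 0 by nra.
have p0 : p = 0 by apply: (spd_S_Q.2 p).2.
have v0 : v = 0.
  apply: (spd_S_U.2 v).2; have := w2; rewrite Q0 mulr0 XE bfMD.
  move/eqP; rewrite paddr_eq0 ?mulr_ge0 ?(ltW a0) ?(ltW b0) ?K_ge0 ?aug_ge0 //.
  by rewrite !mulf_eq0 (gt_eqF a0) (gt_eqF b0) => /andP[/eqP-> /eqP->]; rewrite addr0.
by split=> //; rewrite sgE v0 !mul0mx scaler0.
Qed.

End SaddlePoint.

Section Spectrum.
Variables (R : realType) (s u q : nat).
Variables (A : 'M[R]_s) (B1 : 'M[R]_(q, u)) (B2 : 'M[R]_(u, s)) (MQ : 'M[R]_q).
Variables (nu eta : R).
Hypotheses (nu0 : 0 < nu) (eta0 : 0 < eta) (spdA : spd A) (spdMQ : spd MQ).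
Hypothesis kerU : forall x : 'rV_u, x *m B2 = 0 -> x *m B1^T = 0 -> x = 0.
Hypothesis kerQ : forall x : 'rV_q, x *m B1 = 0 -> x = 0.

Local Notation S := (S_U A B1 B2 MQ nu eta).
Local Notation Q := (S_Q A B1 B2 MQ nu eta).
Local Notation AA := (A_eta A B1 B2 MQ nu eta).
Local Notation L := (L_eta_D A B1 B2 MQ nu eta).
Local Notation sS := (spd_S_U nu0 eta0 spdA spdMQ kerU).
Local Notation sQ := (spd_S_Q nu0 eta0 spdA spdMQ kerU kerQ).

Definition norm_mx : 'M[R]_(s + (u + q)) := block_mx A 0 0 (block_mx S 0 0 Q).

Lemma L_norm_mx : L *m norm_mx = 1%:M.
Proof.
rewrite /L_eta_D /norm_mx mulmx_block !mulmx0 !mul0mx !addr0 add0r mulmx_block.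
rewrite !mulmx0 !mul0mx !addr0 !add0r !mulVmx ?spd_unit //; [|exact: sQ|exact: sS].
by rewrite -!scalar_mx_block.
Qed.

Lemma bf_norm_mx (sg : 'rV_s) (v : 'rV_u) (p : 'rV_q) (w := row_mx sg (row_mx v p)) :
  bf norm_mx w w = bf A sg sg + (bf S v v + bf Q p p).
Proof.
rewrite /bf /w /norm_mx mul_row_block !mulmx0 addr0 add0r mul_row_block.
rewrite !mulmx0 addr0 add0r !tr_row_mx mul_row_col [LHS]mxE; congr (_ + _).
by rewrite mul_row_col [LHS]mxE.
Qed.

Lemma spd_norm_mx : spd norm_mx.
Proof.
split=> [|w].
  by rewrite /norm_mx !tr_block_mx !trmx0 spdA.1 sS.1 sQ.1.
rewrite -[w]hsubmxK -[rsubmx w]hsubmxK bf_norm_mx.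
set sg := lsubmx w; set v := lsubmx _; set p := rsubmx _.
have [a0 az] := spdA.2 sg; have [s0 sz] := sS.2 v; have [q0 qz] := sQ.2 p.
split; first by rewrite !addr_ge0.
move=> /eqP; rewrite !paddr_eq0 ?addr_ge0 //.
by case/and3P=> /eqP/az -> /eqP/sz -> /eqP/qz ->; rewrite !row_mx0.
Qed.

Lemma A_eta_sym : AA^T = AA.
Proof.
rewrite /A_eta tr_block_mx tr_row_mx tr_col_mx tr_block_mx spdA.1 !trmx0 !trmxK.
by rewrite linearN /= (aug_sym _ _ _ spdMQ).
Qed.

Lemma generalized_eigenvalue (al : R) (w : 'rV_(s + (u + q))) :
  w != 0 -> w *m AA = al *: (w *m norm_mx) -> 6^-1 <= `|al| <= 2.
Proof.
rewrite -[w]hsubmxK -[rsubmx w]hsubmxK.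
set sg := lsubmx w; set v := lsubmx _; set p := rsubmx _ => w0.
have eL : row_mx sg (row_mx v p) *m AA = row_mx (sg *m A + v *m B2)
    (row_mx (sg *m B2^T - v *m aug B1 MQ nu eta + p *m B1) (v *m B1^T)).
  rewrite /A_eta mul_row_block mul_mx_row mul_row_col !mulmx0 addr0 mul_row_block.
  by rewrite mulmx0 addr0 add_row_mx add0r mulmxN addrA.
have eN : row_mx sg (row_mx v p) *m norm_mx = row_mx (sg *m A) (row_mx (v *m S) (p *m Q)).
  by rewrite /norm_mx mul_row_block !mulmx0 addr0 add0r mul_row_block !mulmx0 addr0 add0r.
rewrite eL eN !scale_row_mx => /eq_row_mx[eq1 /eq_row_mx[eq2 eq3]].
have NN := spd_norm_mx.2 (row_mx sg (row_mx v p)).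
apply/andP; split.
  rewrite leNgt; apply/negP => /(small_eigenvalue_trivial nu0 eta0 spdA spdMQ kerU kerQ eq1 eq2 eq3)[h1 h2 h3].
  by move/eqP: w0; apply; rewrite h1 h2 h3 !row_mx0.
have := rayleigh_bound nu0 eta0 spdA spdMQ kerU kerQ eq1 eq2 eq3.
rewrite -addrA -bf_norm_mx ler_pM2r // lt_neqAle NN.1 andbT eq_sym.
by apply: contraNneq w0 => /NN.2 ->.
Qed.

Lemma Re_mulC (z : R[i]) (a : R) : complex.Re (z * (a%:C)%C) = complex.Re z * a.
Proof. by case: z => x y; rewrite /= mulr0 subr0. Qed.

Lemma Im_mulC (z : R[i]) (a : R) : complex.Im (z * (a%:C)%C) = complex.Im z * a.
Proof. by case: z => x y; rewrite /= mulr0 add0r. Qed.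

(** With w = v L the problem becomes w AA = z w N for symmetric AA and definite N. Writing w = x + i
    y and comparing the symmetric values AA(x,y) and AA(y,x) gives Im z (N(x,x) + N(y,y)) = 0, so z
    is real and a nonzero part of w is a real eigenvector. *)
Lemma spectrum_real (z : R[i]) : spectrum (L *m AA) z ->
  exists2 al : R, z = (al%:C)%C & 6^-1 <= `|al| <= 2.
Proof.
move=> /eigenvalueP[v vE v0].
pose toC m l (X : 'M[R]_(m, l)) : 'M[R[i]]_(m, l) := map_mx (real_complex R) X.
have [w w0 wE] : exists2 w : 'rV[R[i]]_(s + (u + q)), w != 0 & w *m toC _ _ AA = z *: (w *m toC _ _ norm_mx).
  have wN : v *m toC _ _ L *m toC _ _ norm_mx = v.
    by rewrite -mulmxA -map_mxM L_norm_mx map_mx1 mulmx1.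
  exists (v *m toC _ _ L); first by apply: contraNneq v0 => h; rewrite -wN h mul0mx.
  by rewrite wN -vE -mulmxA -map_mxM.
pose re (X : 'rV[R[i]]_(s + (u + q))) : 'rV[R]_(s + (u + q)) := map_mx (@complex.Re R) X.
pose im (X : 'rV[R[i]]_(s + (u + q))) : 'rV[R]_(s + (u + q)) := map_mx (@complex.Im R) X.
have reM X (Y : 'M[R]__) : re (X *m toC _ _ Y) = re X *m Y.
  apply/matrixP => i j; rewrite !mxE raddf_sum; apply: eq_bigr => l _ /=.
  by rewrite [toC _ _ _ _ _]mxE Re_mulC [re X _ _]mxE.
have imM X (Y : 'M[R]__) : im (X *m toC _ _ Y) = im X *m Y.
  apply/matrixP => i j; rewrite !mxE raddf_sum; apply: eq_bigr => l _ /=.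
  by rewrite [toC _ _ _ _ _]mxE Im_mulC [im X _ _]mxE.
pose a := complex.Re z; pose b := complex.Im z; pose x := re w; pose y := im w.
have reZ X : re (z *: X) = a *: re X - b *: im X.
  by apply/matrixP => i j; rewrite !mxE /a /b; case: (z) => ? ?; case: (X i j).
have imZ X : im (z *: X) = a *: im X + b *: re X.
  by apply/matrixP => i j; rewrite !mxE /a /b; case: (z) => ? ?; case: (X i j) => ? ? /=; rewrite addrC.
have xE : x *m AA = a *: (x *m norm_mx) - b *: (y *m norm_mx).
  by rewrite -reM wE reZ reM imM.
have yE : y *m AA = a *: (y *m norm_mx) + b *: (x *m norm_mx).
  by rewrite -imM wE imZ reM imM.
have E1 : bf AA x y = a * bf norm_mx x y - b * bf norm_mx y y.
  by rewrite {1}/bf xE mulmxBl -!scalemxAl [LHS]mxE [X in X + _]mxE [X in _ + X]mxE [X in _ - X]mxE.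
have E2 : bf AA y x = a * bf norm_mx y x + b * bf norm_mx x x.
  by rewrite {1}/bf yE mulmxDl -!scalemxAl [LHS]mxE [X in X + _ = _]mxE [X in _ + X = _]mxE.
have [NT Np] := spd_norm_mx.
have xy0 : (x != 0) || (y != 0).
  rewrite -negb_and; apply: contraNN w0 => /andP[/eqP hx /eqP hy].
  apply/eqP/matrixP => i j; rewrite [RHS]mxE.
  have := congr1 (fun X : 'rV[R]__ => X i j) hx; have := congr1 (fun X : 'rV[R]__ => X i j) hy.
  by rewrite !mxE; case: (w i j) => ? ? /= -> ->.
have b0 : b = 0.
  have : b * (bf norm_mx x x + bf norm_mx y y) = 0.
    have := bfC x y A_eta_sym; rewrite E1 E2 (bfC y x NT) => h; lra.
  move/eqP; rewrite mulf_eq0 => /orP[/eqP//|]; rewrite paddr_eq0 ?(Np _).1 // => /andP[/eqP h1 /eqP h2].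
  by move: xy0; rewrite ((Np _).2 h1) ((Np _).2 h2) eqxx.
exists a; first by move: b0; rewrite /a /b; case: (z) => ? ? /= ->.
case/orP: xy0 => h; apply: generalized_eigenvalue h _.
  by rewrite xE b0 scale0r subr0.
by rewrite yE b0 scale0r addr0.
Qed.

End Spectrum.

(** * Gram matrices in a basis and the final assembly *)

Section Basis.
Variables (R : realType) (d : nat) (V : lmodType (Poly R d)) (P : V -> Prop).
Variables (m : nat) (e : 'I_m -> V).
Hypothesis eP : is_basis P e.

Lemma basis_free (c : 'rV[R]_m) : P 0 -> \sum_i mpolyC d (c 0 i) *: e i = 0 -> c = 0.
Proof.
move=> P0 c0; have [_ /(_ _ P0) [b [_ bu]]] := eP.
have h1 : b = c^T by apply: bu; rewrite -[LHS]c0; apply: eq_bigr => i _; rewrite mxE.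
have h2 : b = 0.
  by apply: bu; rewrite big1 // => i _; rewrite mxE mpolyC0 scale0r.
by rewrite -[c]trmxK -h1 h2 trmx0.
Qed.

Lemma real_linear_basis_eq0 (f : V -> R) w : real_linear f ->
  (forall i, f (e i) = 0) -> P w -> f w = 0.
Proof.
move=> fl f0 Pw; have [_ /(_ _ Pw) [b [-> _]]] := eP.
by rewrite (real_linear_sum _ _ fl) big1 // => i _; rewrite f0 mulr0.
Qed.

(** Definiteness is required only on combinations of the basis, since form a is definite on
    trace-free fields but not on all of them. *)
Lemma spd_gram (f : V -> V -> R) : (forall x y, f x y = f y x) ->
  (forall y, real_linear (fun x => f x y)) -> (forall x, 0 <= f x x) -> P 0 ->
  (forall c : 'rV[R]_m, let x := \sum_i mpolyC d (c 0 i) *: e i in f x x = 0 -> x = 0) ->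
  spd (\matrix_(i < m, j < m) f (e j) (e i)).
Proof.
move=> fC fl f0 P0 fd; split=> [|c]; first by apply/matrixP => i j; rewrite !mxE fC.
have E : bf (\matrix_(i < m, j < m) f (e j) (e i)) c c =
    let x := \sum_i mpolyC d (c 0 i) *: e i in f x x.
  rewrite /= (real_linear_sum (fun i => c 0 i) e (fl _)) /bf [LHS]mxE.
  apply: eq_bigr => j _; rewrite [c^T _ _]mxE [LHS]mulrC; congr (_ * _).
  rewrite mxE fC (real_linear_sum (fun i => c 0 i) e (fl _)).
  by apply: eq_bigr => i _; rewrite mxE fC.
by rewrite E; split=> [|/fd /basis_free]; [exact: f0 | exact].
Qed.

End Basis.

(** The first conjunct certifies that each [invmx] is a genuine inverse, as [invmx] returns a
    singular matrix unchanged. The image under [real_complex] includes the claim that the complex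
    spectrum is real. *)
Theorem theorem3p1 (R : realType) (d k : nat) (Omega : set 'cV[R]_d)
  (M : mesh R d) (c nu eta : R) (nS nU nQ : nat)
  (eS : 'I_nS -> mx_field M) (eU : 'I_nU -> vec_field M * mx_field M)
  (eQ : 'I_nQ -> sc_field M) :
  d = 2%N \/ d = 3%N -> (1 <= k)%N -> 0 < nu -> 0 < eta ->
  polyhedral_domain Omega -> is_mesh M Omega ->
  0 < c -> quasi_uniform M c ->
  is_basis (@Sigma_h_plus R d M k) eS ->
  is_basis (@U_h R d M k) eU ->
  is_basis (@Q_h R d M k) eQ ->
  let A := \matrix_(i < nS, j < nS) form_a nu (eS j) (eS i) in
  let B1 := \matrix_(i < nQ, j < nU) form_b1 (eU j) (eQ i) in
  let B2 := \matrix_(i < nU, j < nS) form_b2 (eS j) (eU i) in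
  let MQ := \matrix_(i < nQ, j < nQ) form_mass (eQ j) (eQ i) in
  let psi : R := 2 * (1 + Num.sqrt 5) in
  [/\ MQ \in unitmx, A \in unitmx,
      S_U A B1 B2 MQ nu eta \in unitmx & S_Q A B1 B2 MQ nu eta \in unitmx] /\
  spectrum (L_eta_D A B1 B2 MQ nu eta *m A_eta A B1 B2 MQ nu eta) `<=`
  real_complex R @` (`[- psi, - psi^-1] `|` `[psi^-1, psi]).
Proof.
case: d Omega M eS eU eQ => [|n] Omega M eS eU eQ d23; first by case: d23.
move=> k0 nu0 eta0 domOmega meshM _ _ bS bU bQ A B1 B2 MQ psi.
have spdA : spd A.
  apply: (spd_gram bS (form_a_sym _)); [exact: form_a_linear| | |].
  - by move=> t; apply: (form_a_ge0 meshM).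
  - by apply: Sigma_h_sub_plus => //; exact: (Sigma_h0 meshM).
  - move=> x t /(form_a_eq0 meshM nu0); apply=> T.
    rewrite sum_ffunE linear_sum big1 //= => i _.
    by rewrite ffunE linearZ /= (tr_Sigma_h_plus d23 _ (bS.1 i)) mulr0.
have spdMQ : spd MQ.
  apply: (spd_gram bQ (@form_mass_sym _ _ _)); [exact: form_mass_linear| | |].
  - by move=> q; apply: (form_mass_ge0 meshM).
  - exact: Q_h0.
  - by move=> x q; exact: (form_mass_eq0 meshM).
have kerU (x : 'rV_nU) : x *m B2 = 0 -> x *m B1^T = 0 -> x = 0.
  (* The vector [x] is the coordinate vector of a field in U_h, and the two equations say that b_2
     and b_1 vanish on it against every basis element, hence against the whole spaces. *)
  move=> x2 x1; apply: (basis_free bU); first exact: (U_h0 meshM).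
  apply: (b2_inj meshM d23 k0 domOmega).
  - apply: combination_closed => [||i]; [exact: (U_h0 meshM)|exact: U_h_lin|exact: bU.1].
  - move=> t; apply: (real_linear_basis_eq0 bS (form_b2_linear_l _)) => j.
    rewrite (real_linear_sum _ _ (form_b2_linear_r _)).
    have := congr1 (fun X : 'rV[R]_nS => X 0 j) x2; rewrite mxE [RHS]mxE => E; rewrite -[RHS]E.
    by apply: eq_bigr => i _; rewrite mxE.
  - move=> q; apply: (real_linear_basis_eq0 bQ (form_b1_linear_r _)) => j.
    rewrite (real_linear_sum _ _ (form_b1_linear_l _)).
    have := congr1 (fun X : 'rV[R]_nQ => X 0 j) x1; rewrite mxE [RHS]mxE => E; rewrite -[RHS]E.
    by apply: eq_bigr => i _; rewrite mxE mxE.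
have kerQ (x : 'rV_nQ) : x *m B1 = 0 -> x = 0.
  move=> x1; apply: (basis_free bQ); first exact: Q_h0.
  apply: (b1_inj meshM domOmega k0).
    by apply: combination_closed => [||i]; [exact: Q_h0|exact: Q_h_lin|exact: bQ.1].
  move=> u; apply: (real_linear_basis_eq0 bU (form_b1_linear_l _)) => j.
  rewrite (real_linear_sum _ _ (form_b1_linear_r _)).
  have := congr1 (fun X : 'rV[R]_nU => X 0 j) x1; rewrite mxE [RHS]mxE => E; rewrite -[RHS]E.
  by apply: eq_bigr => i _; rewrite mxE.
split.
  split; apply: spd_unit => //; [exact: spd_S_U|exact: spd_S_Q].
move=> z /(spectrum_real nu0 eta0 spdA spdMQ kerU kerQ)[al -> /andP[al1 al2]].
have s5 : 2 <= Num.sqrt 5 :> R.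
  by rewrite -[2]ger0_norm // -sqrtr_sqr ler_wsqrtr //; lra.
have psi6 : 6 <= psi by rewrite /psi; lra.
have ipsi : psi^-1 <= 6^-1 by rewrite lef_pV2 // posrE; lra.
exists al => //; have [al0|al0] := leP 0 al.
  by rewrite ger0_norm // in al1 al2; right; rewrite /= in_itv /=; apply/andP; split; lra.
by rewrite ltr0_norm // in al1 al2; left; rewrite /= in_itv /=; apply/andP; split; lra.
Qed.
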